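(* For each completely positive $\mathbb C$-linear map $\alpha:\mathcal B\to\mathcal B$, the transformation $\mathbb B_\alpha$ maps $\Sigma(\mathcal B)$ to itself.
   Context: $\mathcal B$ is a fixed unital $C^*$-algebra. Distributions. $\mathcal B\langle \mathcal X\rangle$ is the $*$-algebra of polynomials in a self-adjoint formal variable $\mathcal X$ with coefficients in $\mathcal B$, where $\mathcal X$ and $\mathcal B$ are algebraically independent: as a vector space it is $\bigoplus_{n\ge 0}$ of the spans of the monomials $b_0\mathcal X b_1\cdots \mathcal X b_n$, the $n$-th span being isomorphic to $\mathcal B^{\otimes_{\mathbb C}(n+1)}$. $\Sigma_{alg}(\mathcal B)$ is the set of all $\mathbb C$-linear $\mathcal B$-bimodule maps $\mu:\mathcal B\langle\mathcal X\rangle\to\mathcal B$ with $\mu[b]=b$ for $b\in\mathcal B$. $\Sigma(\mathcal B)$ is the set of those $\mu\in\Sigma_{alg}(\mathcal B)$ that are positive ($\mu[P^*P]\ge 0$ for all $P$; such $\mu$ is automatically completely positive). Series. $\mathrm{Ser}(\mathcal B)$ is the set of sequences $F=(F^{[n]})_{n\ge1}$ with $F^{[1]}\in\mathcal B$ and $F^{[n]}:\mathcal B^{n-1}\to\mathcal B$ $\mathbb C$-multilinear. For linear $\alpha:\mathcal B\to\mathcal B$, $(\alpha\circ F)^{[n]}:=\alpha\circ F^{[n]}$. The moment series of $\mu\in\Sigma_{alg}(\mathcal B)$ is $M_\mu^{[1]}=\mu[\mathcal X]$, $M_\mu^{[n]}(b_1,\dots,b_{n-1})=\mu[\mathcal Xb_1\mathcal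 X\cdots b_{n-1}\mathcal X]$; $\mu\mapsto M_\mu$ is a bijection $\Sigma_{alg}(\mathcal B)\to\mathrm{Ser}(\mathcal B)$. Nested functionals. $NC(n)$ is the set of non-crossing partitions of $\{1,\dots,n\}$. For $F\in\mathrm{Ser}(\mathcal B)$ and $\pi\in NC(n)$, the multilinear map $F^{[\pi]}:\mathcal B^{n-1}\to\mathcal B$ is obtained by reading the string $W_1b_1W_2b_2\cdots W_{n-1}b_{n-1}W_n$ as a parenthesized expression, where: if $m$ is the minimum of a block $V$ with $|V|=k\ge2$ then $W_m$ is ''$F^{[k]}($''; if $m$ is the maximum of a block with at least 2 elements then $W_m$ is ''$)$''; if $m\in V$ with $\min V<m<\max V$ then $W_m$ is a comma; if $\{m\}$ is a block then $W_m$ is ''$F^{[1]}$''. Example: for $\pi=\{\{1,4,5\},\{2,3\}\}$, $F^{[\pi]}(b_1,\dots,b_4)=F^{[3]}(b_1F^{[2]}(b_2)b_3,b_4)$. If $c:\pi\to\{1,2\}$ is a colouring of the blocks and $F,G\in\mathrm{Ser}(\mathcal B)$, then $(F,G)^{[\pi,c]}$ is defined by the same rule, except that blocks $V$ with $c(V)=1$ use the term $F^{[|V|]}$ and blocks with $c(V)=2$ use the term $G^{[|V|]}$. $R$-transform. For $\mu\in\Sigma_{alg}(\mathcal B)$, $R_\mu\in\mathrm{Ser}(\mathcal B)$ is the unique series with $M_\mu^{[n]}=\sum_{\pi\in NC(n)}R_\mu^{[\pi]}$ for all $n\ge1$; $\mu\mapsto R_\mu$ is a bijection $\Sigma_{alg}(\mathcal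 B)\to\mathrm{Ser}(\mathcal B)$. The maps $\widehat{\mathrm{RB}}_\alpha$ and $\mathbb B_\alpha$. For $\pi\in NC(n)$ write $\pi\ll 1_n$ if $1$ and $n$ lie in the same block of $\pi$; that block is denoted $V_o(\pi)$. Let $\mathrm o_\pi$ be the colouring of $\pi$ with $\mathrm o_\pi(V_o(\pi))=1$ and $\mathrm o_\pi(V)=2$ for all other blocks. For linear $\alpha:\mathcal B\to\mathcal B$, $\widehat{\mathrm{RB}}_\alpha:\mathrm{Ser}(\mathcal B)\to\mathrm{Ser}(\mathcal B)$ is given by $\widehat{\mathrm{RB}}_\alpha(F)^{[n]}=\sum_{\pi\in NC(n),\,\pi\ll1_n}(F,\alpha\circ F)^{[\pi,\mathrm o_\pi]}$, $n\ge1$. For $\mu\in\Sigma_{alg}(\mathcal B)$, $\mathbb B_\alpha(\mu)\in\Sigma_{alg}(\mathcal B)$ is the distribution determined by $R_{\mathbb B_\alpha(\mu)}=\widehat{\mathrm{RB}}_\alpha(R_\mu)$. *)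

(* Defs.v *)
From HB Require Import structures.
From mathcomp Require Import all_boot all_order all_algebra complex.
From mathcomp Require Import boolp reals.

Set Implicit Arguments.
Unset Strict Implicit.
Unset Printing Implicit Defensive.

Import Order.TTheory GRing.Theory Num.Theory.

Local Open Scope ring_scope.
Local Open Scope quotient_scope.

(* The norm and its completeness are fields of the structure because            *)
(* [completeNormedModType] and [algType] have no join in the hierarchy.         *)
HB.mixin Record isCStarAlgebra (R : realType) B of GRing.Algebra R[i] B := {
  star : B -> B;
  starK : involutive star;
  starD : forall a b : B, star (a + b) = star a + star b;
  starZ : forall (c : R[i]) (a : B), star (c *: a) = c^*%C *: star a;
  starM : forall a b : B, star (a * b) = star b * star a;
  cnorm : B -> R;
  cnorm0_eq0 : forall a : B, cnorm a = 0 -> a = 0;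
  cnormD : forall a b : B, cnorm (a + b) <= cnorm a + cnorm b;
  cnormZ : forall (c : R[i]) (a : B),
    cnorm (c *: a) = ComplexField.Normc.normc c * cnorm a;
  cnormM : forall a b : B, cnorm (a * b) <= cnorm a * cnorm b;
  cnorm_star : forall a : B, cnorm (star a * a) = cnorm a ^+ 2;
  cnorm_complete : forall u : nat -> B,
    (forall e : R, 0 < e -> exists N : nat, forall m n : nat,
      (N <= m)%N -> (N <= n)%N -> cnorm (u m - u n) < e) ->
    exists l : B, forall e : R, 0 < e -> exists N : nat, forall n : nat,
      (N <= n)%N -> cnorm (u n - l) < e;
}.

#[short(type="cstarAlgType")]
HB.structure Definition CStarAlgebra (R : realType) :=
  { B of GRing.Algebra R[i] B & isCStarAlgebra R B }.

Section Positivity.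
Variables (R : realType) (B : cstarAlgType R).

Definition positive (a : B) : Prop := exists c : B, a = star c * c.

(* Positivity in the C*-algebra M_n(B), whose involution is the conjugate       *)
(* transpose.                                                                   *)
Definition mxstar n (M : 'M[B]_n) : 'M[B]_n := (map_mx star M)^T.

Definition mxpositive n (M : 'M[B]_n) : Prop :=
  exists C : 'M[B]_n, M = mxstar C *m C.

Definition completely_positive (alpha : B -> B) : Prop :=
  forall n (M : 'M[B]_n), mxpositive M -> mxpositive (map_mx alpha M).

End Positivity.

Definition multilinear (K : fieldType) (A : algType K) (V : lmodType K)
    (f : seq A -> V) : Prop :=
  forall (u v : seq A) (c : K) (a b : A),
    f (u ++ (c *: a + b) :: v) = c *: f (u ++ a :: v) + f (u ++ b :: v).

(* The algebra A<X>. The pair (a_0, [:: a_1; ...; a_n]) stands for the monomial *)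
(* a_0 X a_1 ... X a_n, a list of such pairs for the sum of its entries, and    *)
(* [peq] imposes the relations of the tensor power of order n + 1 over K on the *)
(* monomials of degree n. So A<X> is the direct sum of these tensor powers.     *)
Section Polynomials.
Variables (K : fieldType) (A : algType K).

Definition mono : Type := (A * seq A)%type.

Definition slot (u : seq A) (a : A) (v : seq A) : mono :=
  if u is x :: u' then (x, u' ++ a :: v) else (a, v).

Definition mscale (c : K) (m : mono) : mono := (c *: m.1, m.2).

Inductive peq : seq mono -> seq mono -> Prop :=
| peq_refl s : peq s s
| peq_sym s t : peq s t -> peq t s
| peq_trans s t r : peq s t -> peq t r -> peq s r
| peq_cat s s' t t' : peq s s' -> peq t t' -> peq (s ++ t) (s' ++ t')
| peq_catC s t : peq (s ++ t) (t ++ s)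
| peq_0 v : peq [:: (0, v)] [::]
| peq_D u a b v : peq [:: slot u (a + b) v] [:: slot u a v; slot u b v]
| peq_Z u c a v : peq [:: slot u (c *: a) v] [:: mscale c (slot u a v)].

(* (a_0 X ... X a_n) (b_0 X ... X b_m) = a_0 X ... X (a_n b_0) X ... X b_m      *)
Fixpoint mmul_rec (a : A) (s : seq A) (m : mono) : mono :=
  if s is b :: s' then
    let p := mmul_rec b s' m in (a, p.1 :: p.2)
  else (a * m.1, m.2).

Definition mmul (m1 m2 : mono) : mono := mmul_rec m1.1 m1.2 m2.

Definition smul (s t : seq mono) : seq mono :=
  flatten [seq [seq mmul m n | n <- t] | m <- s].

Definition peqb (s t : seq mono) : bool := `[< peq s t >].

Lemma peqb_refl : reflexive peqb.
Proof. by move=> s; apply/asboolP/peq_refl. Qed.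
Lemma peqb_sym : symmetric peqb.
Proof. by move=> s t; apply/asboolP/asboolP; apply: peq_sym. Qed.
Lemma peqb_trans : transitive peqb.
Proof.
by move=> t s r /asboolP st /asboolP tr; apply/asboolP; apply: peq_trans tr.
Qed.

Canonical peqb_equiv := EquivRel peqb peqb_refl peqb_sym peqb_trans.

Definition polyX := {eq_quot peqb}.
HB.instance Definition _ := Choice.on polyX.
HB.instance Definition _ := EqQuotient.on polyX.

Definition cls (s : seq mono) : polyX := \pi s.

Lemma clsP s t : peq s t <-> cls s = cls t.
Proof.
split=> [st|/eqmodP/asboolP//].
by apply/eqmodP/asboolP.
Qed.

Lemma cls_repr (P : polyX) : cls (repr P) = P.
Proof. exact: reprK. Qed.

Lemma peq_repr s : peq (repr (cls s)) s.
Proof. by apply/clsP; rewrite cls_repr. Qed.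

Lemma poly_ind (Q : polyX -> Prop) : (forall s, Q (cls s)) -> forall P, Q P.
Proof. by move=> h P; rewrite -(cls_repr P). Qed.

Lemma slot_seq u a v : (slot u a v).1 :: (slot u a v).2 = u ++ a :: v.
Proof. by case: u. Qed.

Lemma mono_seq_inj (m n : mono) : m.1 :: m.2 = n.1 :: n.2 -> m = n.
Proof. by case: m n => [a s] [b t] [-> ->]. Qed.

Lemma peq_slot0 u v : peq [:: slot u 0 v] [::].
Proof.
rewrite -[X in slot u X v](scale0r 0).
apply: peq_trans (peq_Z _ _ _ _) _.
by rewrite /mscale scale0r; apply: peq_0.
Qed.

Lemma peq_flatten (T : Type) (F G : T -> seq mono) (r : seq T) :
  (forall x, peq (F x) (G x)) ->
  peq (flatten (map F r)) (flatten (map G r)).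
Proof.
move=> FG; elim: r => [|x r IH] /=; first exact: peq_refl.
exact: peq_cat.
Qed.

Lemma peq_catCA s t r : peq (s ++ (t ++ r)) (t ++ (s ++ r)).
Proof.
rewrite !catA; apply: peq_cat; [exact: peq_catC|exact: peq_refl].
Qed.

Lemma peq_catACA s t r q : peq ((s ++ t) ++ (r ++ q)) ((s ++ r) ++ (t ++ q)).
Proof.
rewrite -!catA; apply: peq_cat; first exact: peq_refl.
exact: peq_catCA.
Qed.

Lemma peq_flattenD (T : Type) (F G : T -> seq mono) (r : seq T) :
  peq (flatten [seq F x ++ G x | x <- r])
      (flatten (map F r) ++ flatten (map G r)).
Proof.
elim: r => [|x r IH] /=; first exact: peq_refl.
apply: peq_trans (peq_catACA _ _ _ _).
by apply: peq_cat IH; apply: peq_refl.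
Qed.

Lemma flatten_seq1 (T T' : Type) (f : T -> T') (r : seq T) :
  flatten [seq [:: f x] | x <- r] = map f r.
Proof. by elim: r => //= x r ->. Qed.

Lemma mmul_slotl0 u a n : mmul (slot u a [::]) n = slot u (a * n.1) n.2.
Proof.
case: u => [//|x u]; rewrite /mmul /=.
by elim: u x => //= y u IH x; rewrite IH.
Qed.

Lemma mmul_slotlS u a b v n :
  mmul (slot u a (b :: v)) n
    = slot u a ((mmul (b, v) n).1 :: (mmul (b, v) n).2).
Proof.
case: u => [//|x u]; rewrite /mmul /=.
by elim: u x => //= y u IH x; rewrite IH.
Qed.

Lemma mmul_slotr0 m a v : mmul m (slot [::] a v) =
  slot (belast m.1 m.2) (last m.1 m.2 * a) v.
Proof.
case: m => x s; rewrite /mmul /=.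
elim: s x => //= y s IH x; rewrite IH /=.
by congr (_, _); apply: slot_seq.
Qed.

Lemma mmul_slotrS m x u a v : mmul m (slot (x :: u) a v) =
  slot ((mmul m (x, u)).1 :: (mmul m (x, u)).2) a v.
Proof.
case: m => y s; rewrite /mmul /=.
by elim: s y => [|z s IH] y //=; rewrite IH.
Qed.

Lemma mscale_mmul c m n : mmul (mscale c m) n = mscale c (mmul m n).
Proof. by case: m => a [|b s]; rewrite /mmul /mscale //= scalerAl. Qed.

Lemma peq_mmul_scaler c m n : peq [:: mmul m (mscale c n)]
  [:: mscale c (mmul m n)].
Proof.
case: n => b t; rewrite /mscale /= -[(b, t)]/(slot [::] b t).
rewrite -[(c *: b, t)]/(slot [::] (c *: b) t) !mmul_slotr0 -scalerAr.
exact: peq_Z.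
Qed.

Lemma peq_mmul_Dl u a b v n : peq [:: mmul (slot u (a + b) v) n]
  [:: mmul (slot u a v) n; mmul (slot u b v) n].
Proof.
case: v => [|x v]; rewrite !(mmul_slotl0, mmul_slotlS) ?mulrDl; exact: peq_D.
Qed.

Lemma peq_mmul_Dr u a b v n : peq [:: mmul n (slot u (a + b) v)]
  [:: mmul n (slot u a v); mmul n (slot u b v)].
Proof.
case: u => [|x u]; rewrite !(mmul_slotr0, mmul_slotrS) ?mulrDr; exact: peq_D.
Qed.

Lemma peq_mmul_Zl u c a v n : peq [:: mmul (slot u (c *: a) v) n]
  [:: mscale c (mmul (slot u a v) n)].
Proof.
case: v => [|x v]; rewrite !(mmul_slotl0, mmul_slotlS) -?scalerAl; exact: peq_Z.
Qed.

Lemma peq_mmul_Zr u c a v n : peq [:: mmul n (slot u (c *: a) v)]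
  [:: mscale c (mmul n (slot u a v))].
Proof.
case: u => [|x u]; rewrite !(mmul_slotr0, mmul_slotrS) -?scalerAr; exact: peq_Z.
Qed.

Lemma peq_mmul_0l v n : peq [:: mmul (0, v) n] [::].
Proof. by case: v => [|x v]; rewrite /mmul /= ?mul0r; apply: peq_0. Qed.

Lemma peq_mmul_0r v n : peq [:: mmul n (0, v)] [::].
Proof.
rewrite -[(0, v)]/(slot [::] 0 v) mmul_slotr0 mulr0; exact: peq_slot0.
Qed.

Lemma peq_smull s s' t : peq s s' -> peq (smul s t) (smul s' t).
Proof.
elim=> {s s'} [s|s s' _|s s' r _ H1 _ H2|s s' r r' _ H1 _ H2|s s'|v|u a b v|u c a v].
- exact: peq_refl.
- exact: peq_sym.
- exact: peq_trans H2.
- by rewrite /smul !map_cat !flatten_cat; apply: peq_cat.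
- by rewrite /smul !map_cat !flatten_cat; apply: peq_catC.
- rewrite /smul /= cats0 -flatten_seq1.
  have E : flatten [seq [::] | _ <- t] = [::] :> seq mono by elim: t.
  rewrite -[X in peq _ X]E.
  by apply: peq_flatten => n; apply: peq_mmul_0l.
- rewrite /smul /= !cats0 -!(flatten_seq1 (mmul _) t).
  apply: peq_trans (peq_flattenD _ _ _).
  by apply: peq_flatten => n; apply: peq_mmul_Dl.
- rewrite /smul /= !cats0 -!(flatten_seq1 (mmul _) t).
  apply: peq_flatten => n; rewrite mscale_mmul; exact: peq_mmul_Zl.
Qed.

Lemma peq_smulr s t t' : peq t t' -> peq (smul s t) (smul s t').
Proof.
move=> tt'; apply: peq_flatten => m.
elim: tt' => {t t'} [t|t t' _|t t' r _ H1 _ H2|t t' r r' _ H1 _ H2|t t'|v|u a b v|u c a v].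
- exact: peq_refl.
- exact: peq_sym.
- exact: peq_trans H2.
- by rewrite !map_cat; apply: peq_cat.
- by rewrite !map_cat; apply: peq_catC.
- exact: peq_mmul_0r.
- exact: peq_mmul_Dr.
- apply: peq_trans (peq_mmul_Zr _ _ _ _ _) _; apply: peq_sym.
  exact: peq_mmul_scaler.
Qed.

Lemma peq_mapscale c s t : peq s t -> peq (map (mscale c) s) (map (mscale c) t).
Proof.
have E m : mscale c m = mmul (c%:A, [::]) m.
  by rewrite /mmul /mscale /= mulr_algl.
move=> /(peq_smulr [:: (c%:A, [::])]); rewrite /smul /= !cats0.
by rewrite !(eq_map E).
Qed.

Definition padd (P Q : polyX) : polyX := cls (repr P ++ repr Q).
Definition pscale (c : K) (P : polyX) : polyX := cls (map (mscale c) (repr P)).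
Definition pmul (P Q : polyX) : polyX := cls (smul (repr P) (repr Q)).

Lemma padd_cls s t : padd (cls s) (cls t) = cls (s ++ t).
Proof. by apply/clsP/peq_cat; apply: peq_repr. Qed.
Lemma pscale_cls c s : pscale c (cls s) = cls (map (mscale c) s).
Proof. by apply/clsP/peq_mapscale/peq_repr. Qed.
Lemma pmul_cls s t : pmul (cls s) (cls t) = cls (smul s t).
Proof.
apply/clsP; apply: peq_trans (peq_smull _ (peq_repr s)) _.
exact/peq_smulr/peq_repr.
Qed.

Lemma paddA : associative padd.
Proof.
elim/poly_ind=> s; elim/poly_ind=> t; elim/poly_ind=> r.
by rewrite !padd_cls catA.
Qed.
Lemma paddC : commutative padd.
Proof.
elim/poly_ind=> s; elim/poly_ind=> t; rewrite !padd_cls.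
exact/clsP/peq_catC.
Qed.
Lemma padd0 : left_id (cls [::]) padd.
Proof. by elim/poly_ind=> s; rewrite padd_cls. Qed.

Lemma peq_scaleD c d s :
  peq (map (mscale (c + d)) s) (map (mscale c) s ++ map (mscale d) s).
Proof.
rewrite -!(flatten_seq1 (mscale _) s); apply: peq_trans (peq_flattenD _ _ _).
apply: peq_flatten => -[a v]; rewrite /mscale /= scalerDl.
exact: (peq_D [::]).
Qed.

Lemma peq_scale0 s : peq (map (mscale 0) s) [::].
Proof.
have E : flatten [seq [::] | _ <- s] = [::] :> seq mono by elim: s.
rewrite -[X in peq _ X]E -flatten_seq1; apply: peq_flatten => -[a v].
by rewrite /mscale /= scale0r; apply: peq_0.
Qed.

Lemma mscale1 s : map (mscale 1) s = s.
Proof. by elim: s => //= -[a v] s ->; rewrite /mscale /= scale1r. Qed.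

Lemma paddN : left_inverse (cls [::]) (pscale (-1)) padd.
Proof.
elim/poly_ind=> s; rewrite pscale_cls padd_cls.
rewrite -[X in _ ++ X]mscale1; apply/clsP.
apply: peq_trans (peq_sym (peq_scaleD _ _ _)) _.
by rewrite addNr; apply: peq_scale0.
Qed.

HB.instance Definition _ :=
  GRing.isZmodule.Build polyX paddA paddC padd0 paddN.

Lemma cls_cat s t : cls (s ++ t) = cls s + cls t.
Proof. by rewrite -padd_cls. Qed.

Lemma cls_sum s : cls s = \sum_(m <- s) cls [:: m].
Proof.
elim: s => [|m s IH]; first by rewrite big_nil.
by rewrite big_cons -IH -cls_cat.
Qed.

Lemma mmulA : associative mmul.
Proof.
move=> [a s] m n; rewrite /mmul /=; elim: s a => [|b s IH] a /=.
  by case: m => c [|d t] /=; rewrite ?mulrA.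
by rewrite IH.
Qed.

Lemma smul_catl s t r : smul (s ++ t) r = smul s r ++ smul t r.
Proof. by rewrite /smul map_cat flatten_cat. Qed.

Lemma smul_catr s t r : peq (smul r (s ++ t)) (smul r s ++ smul r t).
Proof.
rewrite /smul; under eq_map do rewrite map_cat.
exact: peq_flattenD.
Qed.

Lemma smulA : associative smul.
Proof.
move=> s t r; elim: s => [//|m s IH].
rewrite -cat1s !smul_catl IH; congr (_ ++ _).
rewrite /smul /= !cats0; elim: t {IH} => [//|n t IHt] /=.
rewrite map_cat -IHt; congr (_ ++ _).
by rewrite -map_comp; apply: eq_map => k /=; rewrite mmulA.
Qed.

Lemma pmulA : associative pmul.
Proof.
elim/poly_ind=> s; elim/poly_ind=> t; elim/poly_ind=> r.
by rewrite !pmul_cls smulA.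
Qed.

Lemma pmul1 : left_id (cls [:: (1, [::])]) pmul.
Proof.
elim/poly_ind=> s; rewrite pmul_cls /smul /= cats0.
congr cls; rewrite -[RHS]map_id; apply: eq_map => -[a v].
by rewrite /mmul /= mul1r.
Qed.

Lemma pmul1r : right_id (cls [:: (1, [::])]) pmul.
Proof.
elim/poly_ind=> s; rewrite pmul_cls /smul /= flatten_seq1.
congr cls; rewrite -[RHS]map_id; apply: eq_map => -[a v].
rewrite /mmul /=; elim: v a => [|b v IH] a /=; first by rewrite mulr1.
by rewrite IH.
Qed.

Lemma pmulDl : left_distributive pmul +%R.
Proof.
elim/poly_ind=> s; elim/poly_ind=> t; elim/poly_ind=> r.
by rewrite -cls_cat !pmul_cls smul_catl cls_cat.
Qed.

Lemma pmulDr : right_distributive pmul +%R.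
Proof.
elim/poly_ind=> s; elim/poly_ind=> t; elim/poly_ind=> r.
rewrite -cls_cat !pmul_cls -cls_cat; exact/clsP/smul_catr.
Qed.

Definition seval (V : lmodType K) (f : seq A -> V) (s : seq mono) : V :=
  \sum_(m <- s) f (m.1 :: m.2).

Lemma multilinear0 (V : lmodType K) (f : seq A -> V) u v :
  multilinear f -> f (u ++ 0 :: v) = 0.
Proof.
move=> fM; have := fM u v (-1) 0 0.
by rewrite scaler0 addr0 scaleN1r addNr.
Qed.

Lemma multilinearD (V : lmodType K) (f : seq A -> V) u v a b :
  multilinear f -> f (u ++ (a + b) :: v) = f (u ++ a :: v) + f (u ++ b :: v).
Proof. by move=> fM; have := fM u v 1 a b; rewrite !scale1r. Qed.

Lemma multilinearZ (V : lmodType K) (f : seq A -> V) u v c a :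
  multilinear f -> f (u ++ (c *: a) :: v) = c *: f (u ++ a :: v).
Proof.
move=> fM; have := fM u v c a 0.
by rewrite addr0 (multilinear0 _ _ fM) addr0.
Qed.

Lemma seval_peq (V : lmodType K) (f : seq A -> V) s t :
  multilinear f -> peq s t -> seval f s = seval f t.
Proof.
move=> fM; rewrite /seval.
elim=> {s t} [//|//|s s' r _ -> //|s s' r r' _ H1 _ H2|s s'|v|u a b v|u c a v].
- by rewrite !big_cat /= H1 H2.
- by rewrite !big_cat /= addrC.
- by rewrite big_seq1 big_nil (multilinear0 [::]).
- by rewrite big_seq1 big_cons big_seq1 !slot_seq multilinearD.
- rewrite !big_seq1 !slot_seq multilinearZ // /mscale /= -slot_seq.
  by rewrite (multilinearZ [::]).
Qed.

Lemma seval_scale (V : lmodType K) (f : seq A -> V) c s :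
  multilinear f -> seval f (map (mscale c) s) = c *: seval f s.
Proof.
move=> fM; rewrite /seval big_map scaler_sumr; apply: eq_bigr => m _.
by rewrite /= (multilinearZ [::]).
Qed.

Lemma pone_neq0 : cls [:: (1, [::])] != 0.
Proof.
apply/eqP => /clsP.
pose f (s : seq A) : A := if s is [:: a] then a else 0.
have fM : multilinear f.
  by move=> [|x [|y u]] [|z v] c a b; rewrite /f /= ?scaler0 ?addr0.
move=> /(seval_peq fM); rewrite /seval big_seq1 big_nil /=.
by apply/eqP/oner_neq0.
Qed.

HB.instance Definition _ := GRing.Zmodule_isNzRing.Build polyX
  pmulA pmul1 pmul1r pmulDl pmulDr pone_neq0.

Lemma pscaleA c d P : pscale c (pscale d P) = pscale (c * d) P.
Proof.
elim/poly_ind: P => s; rewrite !pscale_cls -map_comp; congr cls.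
by apply: eq_map => m; rewrite /mscale /= scalerA.
Qed.
Lemma pscale1 : left_id 1 pscale.
Proof. by elim/poly_ind=> s; rewrite pscale_cls mscale1. Qed.
Lemma pscaleDr : right_distributive pscale +%R.
Proof.
move=> c; elim/poly_ind=> s; elim/poly_ind=> t.
by rewrite -cls_cat !pscale_cls map_cat cls_cat.
Qed.
Lemma pscaleDl P : {morph pscale^~ P : c d / c + d}.
Proof.
move=> c d /=; elim/poly_ind: P => s; rewrite !pscale_cls -cls_cat.
exact/clsP/peq_scaleD.
Qed.

HB.instance Definition _ := GRing.Zmodule_isLmodule.Build K polyX
  pscaleA pscale1 pscaleDr pscaleDl.

Lemma cls_scale c s : cls (map (mscale c) s) = c *: cls s.
Proof. by rewrite -pscale_cls. Qed.

Lemma cls_mul s t : cls (smul s t) = cls s * cls t.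
Proof. by rewrite -pmul_cls. Qed.

Lemma pscaleAl (c : K) (P Q : polyX) : c *: (P * Q) = c *: P * Q.
Proof.
elim/poly_ind: P => s; elim/poly_ind: Q => t.
rewrite -cls_mul -!cls_scale -cls_mul; congr cls.
elim: s => [//|m s IH] /=; rewrite -cat1s -[mscale c m :: _]cat1s.
rewrite !smul_catl map_cat IH; congr (_ ++ _).
rewrite /smul /= !cats0 -map_comp; apply: eq_map => n.
by rewrite /= mscale_mmul.
Qed.

HB.instance Definition _ := GRing.Lmodule_isLalgebra.Build K polyX pscaleAl.

Lemma pscaleAr (c : K) (P Q : polyX) : c *: (P * Q) = P * (c *: Q).
Proof.
elim/poly_ind: P => s; elim/poly_ind: Q => t.
rewrite -cls_mul -!cls_scale -cls_mul; apply/clsP.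
elim: s => [|m s IH] /=; first exact: peq_refl.
rewrite -cat1s !smul_catl map_cat; apply: peq_cat IH.
rewrite /smul /= !cats0 -!map_comp.
rewrite -(flatten_seq1 (_ \o mmul m) t) -(flatten_seq1 (mmul m \o _) t).
by apply: peq_flatten => n; apply/peq_sym/peq_mmul_scaler.
Qed.

HB.instance Definition _ := GRing.Lalgebra_isAlgebra.Build K polyX pscaleAr.

Definition pcst (a : A) : polyX := cls [:: (a, [::])].
Definition pX : polyX := cls [:: (1, [:: 1])].

Definition pext (V : lmodType K) (f : seq A -> V) (P : polyX) : V :=
  seval f (repr P).

Lemma pext_cls (V : lmodType K) (f : seq A -> V) s :
  multilinear f -> pext f (cls s) = seval f s.
Proof. by move=> fM; apply: seval_peq => //; apply: peq_repr. Qed.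

Lemma pext_linear (V : lmodType K) (f : seq A -> V) :
  multilinear f -> linear (pext f).
Proof.
move=> fM c; elim/poly_ind=> s; elim/poly_ind=> t.
rewrite -cls_scale -cls_cat !pext_cls // /seval big_cat /=.
by rewrite -!/(seval f _) seval_scale.
Qed.

(* X b_1 X b_2 ... b_{n-1} X *)
Definition xword (bs : seq A) : polyX :=
  foldl (fun P b => P * pcst b * pX) pX bs.

Lemma cls_mul1 m n : cls [:: m] * cls [:: n] = cls [:: mmul m n].
Proof. by rewrite -cls_mul. Qed.

Lemma xwordE bs : xword bs = cls [:: (1, rcons bs 1)].
Proof.
elim/last_ind: bs => [//|bs b IH]; rewrite /xword foldl_rcons -/(xword bs) IH.
rewrite !cls_mul1 -!cats1; congr (cls [:: _]).
rewrite -[(1, bs ++ [:: 1])]/(slot (1 :: bs) 1 [::]) mmul_slotl0 mul1r /=.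
rewrite -[(1, bs ++ _)]/(slot (1 :: bs) b [::]) mmul_slotl0 mulr1 /=.
by rewrite -catA.
Qed.

End Polynomials.

(* F^{[pi]} and (F, G)^{[pi, c]}: the string W_1 b_1 W_2 b_2 ... b_{n-1} W_n is *)
(* read from left to right with a stack of open parentheses. A frame holds the  *)
(* arguments already completed (those followed by a comma) and the product read *)
(* so far of the argument under construction; the bottom frame stands for the   *)
(* whole expression. [F] gives the series whose term is used for each block.    *)
Section Nested.
Variables (K : fieldType) (A : algType K).

Definition frame : Type := (seq A * A)%type.

Section Reading.
Variable n : nat.
Implicit Types (V W : {set 'I_n}) (P : {set {set 'I_n}}) (m : 'I_n).

Definition isMin V m : bool := [forall j in V, (m <= j)%N].
Definition isMax V m : bool := [forall j in V, (j <= m)%N].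

Definition read_W (F : {set 'I_n} -> seq A -> A) P (st : seq frame) m :
    seq frame :=
  let V := pblock P m in
  if st is (args, cur) :: st1 then
    match isMin V m, isMax V m with
    | true, true => (args, cur * F V [::]) :: st1
    | true, false => ([::], 1) :: st
    | false, true =>
        if st1 is (args', cur') :: st2 then
          (args', cur' * F V (rcons args cur)) :: st2
        else [::]
    | false, false => (rcons args cur, 1) :: st1
    end
  else [::].

Definition read_b (b : A) (st : seq frame) : seq frame :=
  if st is (args, cur) :: st1 then (args, cur * b) :: st1 else [::].

(* The default value 1 of [nth] is only used after W_n, where there is no b_n.  *)
Definition read (F : {set 'I_n} -> seq A -> A) P (bs : seq A)
    (st : seq frame) m : seq frame :=
  read_b (nth 1 bs m) (read_W F P st m).

Definition nested (F : {set 'I_n} -> seq A -> A) P (bs : seq A) : A :=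
  (head ([::], 1) (foldl (read F P bs) [:: ([::], 1)] (enum 'I_n))).2.

Definition noncrossing P : bool :=
  [forall V in P, forall W in P, (V != W) ==>
    [forall a in V, forall b in W, forall c in V, forall d in W,
      ~~ [&& (a < b)%N, (b < c)%N & (c < d)%N]]].

Definition NC : {set {set {set 'I_n}}} :=
  [set P | partition P [set: 'I_n] & noncrossing P].

Lemma fold_inv3 (T : Type) (f g h : T -> 'I_n -> T)
    (Inv : nat -> T -> T -> T -> Prop) x y z :
  Inv 0%N x y z ->
  (forall (m : 'I_n) x y z, Inv m x y z -> Inv m.+1 (f x m) (g y m) (h z m)) ->
  Inv n (foldl f x (enum 'I_n)) (foldl g y (enum 'I_n))
    (foldl h z (enum 'I_n)).
Proof.
move=> I0 IS.
suff H k : (k <= n)%N -> Inv k (foldl f x (take k (enum 'I_n)))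
    (foldl g y (take k (enum 'I_n))) (foldl h z (take k (enum 'I_n))).
  by have := H n (leqnn n); rewrite take_oversize // size_enum_ord.
elim: k => [|k IH] kn; first by rewrite take0.
rewrite (take_nth (Ordinal kn)) ?size_enum_ord // !foldl_rcons.
have E : nth (Ordinal kn) (enum 'I_n) k = Ordinal kn.
  by apply/val_inj; rewrite /= nth_enum_ord.
by rewrite E; apply: (IS (Ordinal kn)); apply/IH/ltnW.
Qed.

Definition openB V (k : nat) : bool :=
  [exists i in V, (i < k)%N] && [exists i in V, (k <= i)%N].

Definition shape P (k : nat) (st : seq frame) : Prop :=
  size st = (\sum_(V in P) openB V k).+1 /\ (last ([::], 1) st).1 = [::].

Lemma openB_min V m : m \in V -> openB V m = ~~ isMin V m.
Proof.
move=> mV; rewrite /openB /isMin negb_forall.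
have -> : [exists i in V, (m <= i)%N].
  by apply/existsP; exists m; rewrite mV leqnn.
rewrite andbT; apply: eq_existsb => i; by rewrite negb_imply -ltnNge.
Qed.

Lemma openB_max V m : m \in V -> openB V m.+1 = ~~ isMax V m.
Proof.
move=> mV; rewrite /openB /isMax negb_forall.
have -> : [exists i in V, (i < m.+1)%N].
  by apply/existsP; exists m; rewrite mV ltnS leqnn.
rewrite andTb; apply: eq_existsb => i; by rewrite negb_imply -ltnNge.
Qed.

Lemma openB_other V m : m \notin V -> openB V m.+1 = openB V m.
Proof.
move=> mV; rewrite /openB; congr andb; apply: eq_existsb => i;
  case iV: (i \in V) => //=.
  rewrite ltnS leq_eqVlt; case: eqP => // im.
  by move: mV; rewrite -(val_inj im) iV.
rewrite [RHS]leq_eqVlt; case: eqP => // im.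
by move: mV; rewrite (val_inj im) iV.
Qed.

Lemma block_in P m : partition P [set: 'I_n] ->
  (pblock P m \in P) * (m \in pblock P m).
Proof.
case/and3P => /eqP cP _ _.
by rewrite pblock_mem ?mem_pblock cP ?inE.
Qed.

Lemma sum_openB P m (k : nat) : partition P [set: 'I_n] ->
  (\sum_(V in P) openB V k =
     openB (pblock P m) k + \sum_(V in P | V != pblock P m) openB V k)%N.
Proof. by move=> pP; rewrite (bigD1 (pblock P m)) ?(block_in m pP). Qed.

Lemma sum_openB_other P m : partition P [set: 'I_n] ->
  (\sum_(V in P | V != pblock P m) openB V m.+1
    = \sum_(V in P | V != pblock P m) openB V m)%N.
Proof.
move=> pP; apply: eq_bigr => V /andP[VP nV]; rewrite openB_other //.
apply: contra nV => mV.
by case/and3P: pP => _ tP _; rewrite (def_pblock tP VP mV).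
Qed.

Lemma shape0 P : shape P 0 [:: ([::], 1)].
Proof.
split=> //=; rewrite big1 // => V _.
rewrite /openB; have -> // : [exists i in V, (i < 0)%N] = false.
by apply/existsP; case=> i; rewrite andbF.
Qed.

Lemma shape_end P st : shape P n st -> exists a, st = [:: ([::], a)].
Proof.
move=> []; rewrite big1 => [|V _]; last first.
  rewrite /openB; have -> : [exists i in V, (n <= i)%N] = false.
    by apply/existsP; case=> i; rewrite leqNgt ltn_ord andbF.
  by rewrite andbF.
by case: st => [|[args a] [|]] //= _ ->; exists a.
Qed.

Lemma shape_W F P st m : partition P [set: 'I_n] ->
  shape P m st -> shape P m.+1 (read_W F P st m).
Proof.
move=> pP; have [VP mV] := block_in m pP.
rewrite /shape !(sum_openB m _ pP) sum_openB_other //.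
rewrite openB_min // openB_max //.
set S := (\sum_(V in P | _) _)%N.
case: st => [|[args cur] st] [] //= [] sz lst; rewrite /read_W.
case: (isMin _ m) sz; case: (isMax _ m) => /= sz; split => //=.
- by rewrite sz.
- by case: (st) lst.
- by rewrite sz.
- by case: st sz {lst} => [|[args' cur'] st] //= [->].
- by case: st sz lst => [|[args' cur'] [|g st]].
- by rewrite sz.
- by case: st sz lst.
Qed.

Lemma shape_b P k b st : shape P k st -> shape P k (read_b b st).
Proof. by case: st => [|[args cur] [|f st]]. Qed.

Lemma shape_read F P bs st m : partition P [set: 'I_n] ->
  shape P m st -> shape P m.+1 (read F P bs st m).
Proof. by move=> pP st_m; apply/shape_b/shape_W. Qed.

End Reading.

Variant lin_frame (c : K) : frame -> frame -> frame -> Prop :=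
| LinCur s x y : lin_frame c (s, c *: x + y) (s, x) (s, y)
| LinArg p q x y z :
    lin_frame c (p ++ (c *: x + y) :: q, z) (p ++ x :: q, z) (p ++ y :: q, z).

Variant lin_stack (c : K) : seq frame -> seq frame -> seq frame -> Prop :=
| LinStack u w f1 f2 f3 of lin_frame c f1 f2 f3 :
    lin_stack c (u ++ f1 :: w) (u ++ f2 :: w) (u ++ f3 :: w).

Lemma lin_b c b s1 s2 s3 :
  lin_stack c s1 s2 s3 -> lin_stack c (read_b b s1) (read_b b s2) (read_b b s3).
Proof.
case=> u w f1 f2 f3 H; case: u => [|[a x] u] /=; last first.
  exact: (@LinStack c ((a, x * b) :: u)).
case: H => [s x y|p q x y z] /=.
  by rewrite mulrDl -scalerAl; apply: (@LinStack c [::]); constructor.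
by apply: (@LinStack c [::]); constructor.
Qed.

Lemma lin_W n c (F : {set 'I_n} -> seq A -> A) P m s1 s2 s3 :
  (forall V, multilinear (F V)) ->
  (1 < size s1)%N || isMin (pblock P m) m ->
  lin_stack c s1 s2 s3 ->
  lin_stack c (read_W F P s1 m) (read_W F P s2 m) (read_W F P s3 m).
Proof.
move=> FM + H; case: H => u w f1 f2 f3 H sz; rewrite /read_W.
have FC V s x y : F V (rcons s (c *: x + y)) =
    c *: F V (rcons s x) + F V (rcons s y).
  by rewrite -!cats1; apply: FM.
case: u sz => [|[a z] u] /= sz.
  case: H => [s x y|p q x y z] /=.
    case: (isMin _ m) sz => sz; case: (isMax _ m).
    - by rewrite mulrDl -scalerAl; apply: (@LinStack c [::]); constructor.
    - by apply: (@LinStack c [:: ([::], 1)]); constructor.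
    - case: w sz => [//|[a' z'] w] _.
      rewrite FC mulrDr -scalerAr.
      by apply: (@LinStack c [::]); constructor.
    - apply: (@LinStack c [::]); rewrite -!cats1.
      exact: LinArg.
  case: (isMin _ m) sz => sz; case: (isMax _ m).
  - by apply: (@LinStack c [::]); constructor.
  - by apply: (@LinStack c [:: ([::], 1)]); constructor.
  - case: w sz => [//|[a' z'] w] _.
    rewrite !rcons_cat !rcons_cons FM mulrDr -scalerAr.
    by apply: (@LinStack c [::]); constructor.
  - apply: (@LinStack c [::]); rewrite !rcons_cat !rcons_cons.
    exact: LinArg.
case: (isMin _ m); case: (isMax _ m).
- exact: (@LinStack c (_ :: u)).
- exact: (@LinStack c (_ :: _ :: u)).
- case: u sz => [|[a' z'] u] /= sz; last exact: (@LinStack c (_ :: u)).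
  case: H => [s x y|p q x y z'] /=.
    by rewrite mulrDl -scalerAl; apply: (@LinStack c [::]); constructor.
  by apply: (@LinStack c [::]); constructor.
- exact: (@LinStack c (_ :: u)).
Qed.

Lemma nested_multilinear n (F : {set 'I_n} -> seq A -> A) P u v c a b :
  partition P [set: 'I_n] -> (forall V, multilinear (F V)) ->
  (size u < n)%N ->
  nested F P (u ++ (c *: a + b) :: v) =
    c *: nested F P (u ++ a :: v) + nested F P (u ++ b :: v).
Proof.
move=> pP FM un.
pose Inv k (s1 s2 s3 : seq frame) := [/\ shape P k s1, shape P k s2, shape P k s3
  & if (k <= size u)%N then s1 = s2 /\ s2 = s3 else lin_stack c s1 s2 s3].
rewrite /nested.
set f1 := foldl _ _ _; set f2 := foldl _ _ _; set f3 := foldl _ _ _.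
have : Inv n f1 f2 f3.
  apply: fold_inv3; first by split=> //; apply: shape0.
  move=> m s1 s2 s3 [H1 H2 H3 H]; split; [exact: shape_read..|].
  case: (ltngtP m (size u)) => mu; rewrite /read.
  - rewrite (ltnW mu) in H; case: H => <- <-.
    by rewrite !nth_cat mu.
  - rewrite leqNgt mu /= in H; rewrite !nth_cat ltnNge (ltnW mu) /=.
    case E: (m - size u)%N => [|k] /=.
      by move: mu; rewrite -subn_gt0 E.
    apply: lin_b; apply: lin_W => //; rewrite orbC -implyNb; apply/implyP.
    have [VP mV] := block_in m pP.
    move=> nm; case: H1 => -> _; rewrite (sum_openB m _ pP) openB_min // nm.
    by rewrite ltnS leq_addr.
  - rewrite mu leqnn in H; case: H => <- <-.
    rewrite !nth_cat mu ltnn subnn /=.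
    have := shape_W F pP H1.
    case: (read_W _ _ _ _) => [[]//|[args cur] st] _ /=.
    rewrite mulrDr -scalerAr.
    by apply: (@LinStack c [::]); constructor.
move=> [/shape_end[x1 ->] /shape_end[x2 ->] /shape_end[x3 ->]].
rewrite leqNgt un /= => H; clear f1 f2 f3 Inv.
move: H; move E1: [:: ([::], x1)] => s1; move E2: [:: ([::], x2)] => s2.
move E3: [:: ([::], x3)] => s3 H; case: H E1 E2 E3.
case=> [|g w']; last by case: w' => [|h w'] w f1 f2 f3 _ /= [].
move=> w f1 f2 f3 H; case: H => [s x y|p q x y z] [].
  by move=> _ -> _ [_ -> _] [_ -> _].
by case: p.
Qed.

End Nested.

Section NestedLocality.
Variables (K : fieldType) (A : algType K) (n : nat).
Implicit Types (V W : {set 'I_n}) (P : {set {set 'I_n}}).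

Definition commas P (k : nat) : {set 'I_n} :=
  [set i : 'I_n | [&& ~~ isMin (pblock P i) i, ~~ isMax (pblock P i) i
                    & (i < k)%N]].

Lemma commas_le P (m : 'I_n) : (#|commas P m| <= #|commas P m.+1|)%N.
Proof.
apply/subset_leq_card/subsetP => i; rewrite !inE => /and3P[-> -> im] /=.
exact: ltnW.
Qed.

Lemma commasS P (m : 'I_n) :
  ~~ isMin (pblock P m) m -> ~~ isMax (pblock P m) m ->
  #|commas P m.+1| = #|commas P m|.+1.
Proof.
move=> n1 n2; have -> : commas P m.+1 = m |: commas P m.
  apply/setP => i; rewrite !inE ltnS leq_eqVlt -(inj_eq val_inj).
  case: eqP => [/val_inj ->|//] /=; by rewrite n1 n2.
by rewrite cardsU1 inE ltnn !andbF.
Qed.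

Lemma commas_bound P (m : 'I_n) :
  partition P [set: 'I_n] -> P != [set [set: 'I_n]] ->
  ~~ isMin (pblock P m) m -> isMax (pblock P m) m ->
  (#|commas P m|.+1 < n.-1)%N.
Proof.
move=> pP PT nmin max; have [VP mV] := block_in m pP.
set V := pblock P m in nmin max VP mV *.
have tP : trivIset P by case/and3P: pP.
have cP : cover P = setT by case/and3P: pP => /eqP.
have minE W : W \in P -> exists i, i \in W /\ isMin W i.
  move=> WP; have /set0Pn[j jW] : W != set0.
    by apply: contraTneq WP => ->; case/and3P: pP.
  case: (arg_minnP (fun i : 'I_n => i : nat) jW) => i iW imin; exists i.
  by split=> //; apply/forallP => k; apply/implyP/imin.
have [W WP WV] : exists2 W, W \in P & W != V.
  apply/exists_inP; apply: contraR PT; rewrite negb_exists_in => /forall_inP H.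
  have PV : P = [set V].
    apply/setP => W; rewrite inE; apply/idP/eqP => [WP|-> //].
    by apply/eqP; have := H _ WP; rewrite negbK.
  have : cover P = V by rewrite PV /cover big_set1.
  by rewrite cP => VT; rewrite PV -VT.
have [i [iV imin]] := minE _ VP; have [j [jW jmin]] := minE _ WP.
have bi : pblock P i = V by apply: def_pblock.
have bj : pblock P j = W by apply: def_pblock.
have mi : m != i by apply: contraNneq nmin => ->.
have mj : m != j.
  by apply: contraNneq WV => mj; rewrite -bj -mj.
have ij : i != j.
  by apply: contraNneq WV => ij; rewrite -bj -ij bi.
have sub : commas P m \subset ~: [set m; i; j].
  apply/subsetP => x; rewrite !inE => /and3P[x1 x2 x3].
  rewrite !negb_or; apply/andP; split; first (apply/andP; split).
  - by apply: contraTneq x3 => ->; rewrite ltnn.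
  - by apply: contraNneq x1 => ->; rewrite bi.
  - by apply: contraNneq x1 => ->; rewrite bj.
have c3 : #|[set m; i; j]| = 3%N.
  by rewrite -setUA cardsU1 cards2 ij !inE negb_or mi mj.
have := subset_leq_card sub; rewrite [X in (_ <= X)%N]cardsCs setCK c3 card_ord.
have : (3 <= n)%N by rewrite -c3 -[X in (_ <= X)%N]card_ord max_card.
move: #|commas P m| => q; move: (n) => k.
by case: k => [|[|[|k]]] //= _; rewrite !subSS subn0 !ltnS.
Qed.

Lemma nested_eq (F G : {set 'I_n} -> seq A -> A) P (bs : seq A) :
  partition P [set: 'I_n] -> P != [set [set: 'I_n]] ->
  (forall V args, (size args < n.-1)%N -> F V args = G V args) ->
  nested F P bs = nested G P bs.
Proof.
move=> pP PT FG.
pose Inv k (s t u : seq (frame A)) := s = t /\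
  all (fun f : frame A => size f.1 <= #|commas P k|)%N s.
have : Inv n (foldl (read F P bs) [:: ([::], 1)] (enum 'I_n))
    (foldl (read G P bs) [:: ([::], 1)] (enum 'I_n))
    (foldl (read G P bs) [:: ([::], 1)] (enum 'I_n)).
  apply: fold_inv3 => // m s t r [<- H]; rewrite {}/Inv.
  have H' : all (fun f : frame A => size f.1 <= #|commas P m.+1|)%N s.
    apply: sub_all H => f /leq_trans; apply; exact: commas_le.
  suff [E HW] : read_W F P s m = read_W G P s m /\
    all (fun f : frame A => size f.1 <= #|commas P m.+1|)%N (read_W F P s m).
    split; first by rewrite /read E.
    by rewrite /read; case: (read_W F P s m) HW => [|[? ?] ?].
  have n0 : (0 < n.-1)%N || (P == [set [set: 'I_n]]).
    case: (posnP n.-1) => //= n1; apply: contraR PT => _.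
    have En : n = 1%N by move: (leq_ltn_trans (leq0n _) (ltn_ord m)) n1; move: n => [|[|]].
    have sub1 (i j : 'I_n) : i = j.
      have z (k : 'I_n) : k = 0%N :> nat.
        by apply/eqP; rewrite -leqn0 -ltnS -[X in (_ < X)%N]En ltn_ord.
      by apply/val_inj; rewrite /= !z.
    have VT : pblock P m = setT.
      by apply/setP => i; rewrite (sub1 i m) inE (block_in m pP).
    apply/eqP/setP => W; rewrite inE -VT; apply/idP/eqP => [WP|->]; last first.
      by rewrite (block_in m pP).
    have /set0Pn[j jW] : W != set0.
      by apply: contraTneq WP => ->; case/and3P: pP.
    by case/and3P: pP => _ tP _; rewrite -(def_pblock tP WP jW) (sub1 j m).
  rewrite (negPf PT) orbF in n0.
  rewrite /read_W; case: s H H' => [//|[args cur] st] /=.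
  case/andP => H1 H2 /andP[H1' H2'].
  case mn: (isMin _ m); case mx: (isMax _ m) => /=.
  - by rewrite FG // H1' H2'.
  - by rewrite H1' H2'.
  - case: st H2 H2' => [//|[args' cur'] st] /= _ /andP[-> ->].
    rewrite FG // size_rcons (leq_ltn_trans _ (commas_bound pP PT _ mx)) ?mn //.
  - by rewrite size_rcons commasS ?mn ?mx // ltnS H1 -commasS ?mn ?mx.
by case=> E _; rewrite /nested E.
Qed.

End NestedLocality.

Lemma nested_full (K : fieldType) (A : algType K)
    (bs : seq A) (F : {set 'I_(size bs).+1} -> seq A -> A) :
  nested F [set [set: 'I_(size bs).+1]] bs = F setT bs.
Proof.
set n := (size bs).+1 in F *.
have blk (m : 'I_n) : pblock [set [set: 'I_n]] m = setT.
  by apply: def_pblock; rewrite ?trivIset1 ?inE.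
have mnE (m : 'I_n) : isMin setT m = (m == 0 :> nat).
  apply/forallP/eqP => [/(_ ord0)|-> //]; first by rewrite inE leqn0 => /eqP.
  by move=> j; apply/implyP.
have mxE (m : 'I_n) : isMax setT m = (m == size bs :> nat).
  apply/forallP/eqP => [/(_ ord_max)|-> j].
    by rewrite inE /= => h; apply/eqP; rewrite eqn_leq h -ltnS ltn_ord.
  by apply/implyP => _; rewrite -ltnS ltn_ord.
move Ef: (F setT) => f.
pose Inv k (s t u : seq (frame A)) := s = if k is k'.+1 then
   if (k' < size bs)%N then [:: (take k' bs, nth 1 bs k'); ([::], 1)]
   else [:: ([::], f bs)] else [:: ([::], 1)].
have : Inv n (foldl (read F [set setT] bs) [:: ([::], 1)] (enum 'I_n))
  (foldl (read F [set setT] bs) [:: ([::], 1)] (enum 'I_n))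
  (foldl (read F [set setT] bs) [:: ([::], 1)] (enum 'I_n)).
  apply: fold_inv3 => // m s t r ->; rewrite /Inv /read /read_W blk mnE mxE Ef.
  have := ltn_ord m; rewrite /n ltnS leq_eqVlt.
  case: (nat_of_ord m) => [|k] /=.
    case: (posnP (size bs)) => [s0|s0 _].
      by rewrite s0 /= (size0nil s0) /= mul1r mulr1.
    by rewrite eq_sym gtn_eqF //= take0 mul1r.
  case/orP => [/eqP Ek|kn].
    rewrite Ek eqxx -Ek leqnn ltnn /= -take_nth -?Ek // Ek take_size.
    by rewrite mul1r nth_default ?mulr1.
  by rewrite ltn_eqF // kn (ltnW kn) /= mul1r -take_nth // ltnW.
by rewrite /Inv /nested => ->; rewrite -[n]/(size bs).+1 /= ltnn.
Qed.

Lemma full_NC (n : nat) : [set [set: 'I_n.+1]] \in NC n.+1.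
Proof.
rewrite inE; apply/andP; split.
  rewrite /partition cover1 eqxx trivIset1 inE eq_sym.
  by apply/set0Pn; exists ord0.
apply/forall_inP => V /set1P ->; apply/forall_inP => W /set1P ->.
by rewrite eqxx.
Qed.

Lemma NC_partition n (P : {set {set 'I_n}}) :
  P \in NC n -> partition P [set: 'I_n].
Proof. by rewrite inE => /andP[]. Qed.

(* The term F^{[n]} of a series is its restriction to the lists of length n - 1. *)
Section Series.
Variables (K : fieldType) (A : algType K).

Record ser : Type := Ser {
  ser_fun :> seq A -> A;
  ser_multilinear : multilinear ser_fun
}.

Lemma ser_eq (F G : ser) : F =1 G -> F = G.
Proof.
case: F G => [f fM] [g gM] /= /funext fg; rewrite fg in fM *.
by rewrite (Prop_irrelevance fM gM).
Qed.

Lemma ser_comp_multilinear (alpha : {linear A -> A}) (F : ser) :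
  multilinear (fun bs => alpha (F bs)).
Proof. by move=> u v c a b; rewrite ser_multilinear linearP. Qed.

Definition ser_comp (alpha : {linear A -> A}) (F : ser) : ser :=
  Ser (ser_comp_multilinear alpha F).

Definition nested1 (F : ser) n (P : {set {set 'I_n}}) (bs : seq A) : A :=
  nested (fun _ => F) P bs.

(* The colouring [c] takes the values true and false for the colours 1 and 2.   *)
Definition nested2 (F G : ser) n (P : {set {set 'I_n}})
    (c : {set 'I_n} -> bool) (bs : seq A) : A :=
  nested (fun V => if c V then F else G) P bs.

Lemma sum_nested_multilinear
    (Q : forall n, pred {set {set 'I_n}})
    (S : forall n, {set {set 'I_n}} -> {set 'I_n} -> ser) :
  (forall n (P : {set {set 'I_n}}), Q n P -> P \in NC n) ->
  multilinear (fun bs : seq A =>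
    \sum_(P : {set {set 'I_(size bs).+1}} | Q _ P) nested (S _ P) P bs).
Proof.
move=> QNC u v c a b.
have E x : size (u ++ x :: v) = (size u + size v).+1.
  by rewrite size_cat /= addnS.
rewrite !E scaler_sumr -big_split /=; apply: eq_bigr => P QP.
apply: nested_multilinear => [|V|]; first exact/NC_partition/QNC.
  exact: ser_multilinear.
by rewrite !ltnS leqW ?leq_addr.
Qed.

Definition outer n (P : {set {set 'I_n.+1}}) : {set 'I_n.+1} := pblock P ord0.

Definition NC_outer n : {set {set {set 'I_n.+1}}} :=
  [set P in NC n.+1 | ord_max \in outer P].

Definition RBhat_fun (alpha : {linear A -> A}) (F : ser) (bs : seq A) : A :=
  \sum_(P in NC_outer (size bs))
    nested2 F (ser_comp alpha F) P (fun V => V == outer P) bs.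

Lemma RBhat_multilinear alpha F : multilinear (RBhat_fun alpha F).
Proof.
pose Q n : pred {set {set 'I_n}} :=
  if n is m.+1 then fun P => P \in NC_outer m else fun _ => false.
pose S n : {set {set 'I_n}} -> {set 'I_n} -> ser :=
  if n is m.+1 then fun P V => if V == outer P then F else ser_comp alpha F
  else fun _ _ => F.
have QNC n (P : {set {set 'I_n}}) : Q n P -> P \in NC n.
  by case: n P => [//|m] P; rewrite /Q inE => /andP[].
have := sum_nested_multilinear S QNC.
by congr multilinear; apply/funext => bs; apply: eq_bigr => P _.
Qed.

Definition RBhat (alpha : {linear A -> A}) (F : ser) : ser :=
  Ser (RBhat_multilinear alpha F).

Definition moment_cumulant (M F : ser) : Prop :=
  forall bs : seq A, M bs = \sum_(P in NC (size bs).+1) nested1 F P bs.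

Lemma ser0_multilinear : multilinear (fun _ : seq A => 0 : A).
Proof. by move=> u v c a b; rewrite scaler0 addr0. Qed.

Definition ser_rem (M F : ser) (bs : seq A) : A := M bs -
  \sum_(P in NC (size bs).+1 | P != [set setT]) nested1 F P bs.

Lemma ser_rem_multilinear M F : multilinear (ser_rem M F).
Proof.
move=> u v c a b; rewrite /ser_rem ser_multilinear.
have := @sum_nested_multilinear
  (fun n P => (P \in NC n) && (P != [set setT])) (fun n _ _ => F).
move=> -> => [|n P /andP[] //].
by rewrite scalerBr opprD addrACA.
Qed.

Fixpoint ser_iter (M : ser) (k : nat) : ser :=
  if k is k'.+1 then Ser (ser_rem_multilinear M (ser_iter M k'))
  else Ser ser0_multilinear.

Lemma ser_rem_eq (M F G : ser) bs :
  (forall cs, (size cs < size bs)%N -> F cs = G cs) ->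
  ser_rem M F bs = ser_rem M G bs.
Proof.
move=> FG; congr (_ - _); apply: eq_bigr => P /andP[PNC PT].
by apply: nested_eq => //; apply: NC_partition.
Qed.

Lemma ser_iter_stable M k l bs : (size bs < k)%N -> (size bs < l)%N ->
  ser_iter M k bs = ser_iter M l bs.
Proof.
elim: k l bs => [//|k IH] [//|l] bs bk bl; apply: ser_rem_eq => cs cb.
by apply: IH; apply: leq_trans cb _.
Qed.

Lemma moment_cumulantE M F :
  moment_cumulant M F <-> forall bs, F bs = ser_rem M F bs.
Proof.
have E bs : \sum_(P in NC (size bs).+1) nested1 F P bs = F bs +
    \sum_(P in NC (size bs).+1 | P != [set setT]) nested1 F P bs.
  by rewrite (bigD1 [set setT]) ?full_NC //= /nested1 nested_full.
split=> H bs; first by rewrite /ser_rem H E addrK.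
by rewrite E H /ser_rem subrK.
Qed.

Lemma ex_cumulant M : exists F, moment_cumulant M F.
Proof.
have FM : multilinear (fun bs => ser_iter M (size bs).+1 bs).
  move=> u v c a b.
  have E x : size (u ++ x :: v) = (size u + size v).+1.
    by rewrite size_cat /= addnS.
  by rewrite !E ser_multilinear.
exists (Ser FM); apply/moment_cumulantE => bs.
by apply: ser_rem_eq => cs cb; apply: ser_iter_stable.
Qed.

Lemma cumulant_unique M F G :
  moment_cumulant M F -> moment_cumulant M G -> F = G.
Proof.
move=> /moment_cumulantE MF /moment_cumulantE MG; apply: ser_eq => bs.
have [k] := ubnP (size bs); elim: k bs => [//|k IH] bs bk.
rewrite MF MG; apply: ser_rem_eq => cs cb; apply: IH.
exact: leq_trans cb _.
Qed.

Definition cumulant (M : ser) : ser := projT1 (cid (ex_cumulant M)).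

Lemma cumulantP M : moment_cumulant M (cumulant M).
Proof. exact: (projT2 (cid (ex_cumulant M))). Qed.

Lemma ex_moment F : exists M, moment_cumulant M F.
Proof.
have FM := @sum_nested_multilinear
  (fun n P => P \in NC n) (fun n _ _ => F) (fun n P => id).
by exists (Ser FM).
Qed.

End Series.

Section Distributions.
Variables (K : fieldType) (A : algType K).

Record distr : Type := Distr {
  distr_fun :> {linear polyX A -> A};
  distr_bimodule : forall (a b : A) (P : polyX A),
    distr_fun (pcst a * P * pcst b) = a * distr_fun P * b;
  distr_cst : forall b : A, distr_fun (pcst b) = b
}.

Lemma moments_multilinear (mu : distr) : multilinear (fun bs => mu (xword bs)).
Proof.
move=> u v c a b; rewrite !xwordE.
have E x : (1, rcons (u ++ x :: v) 1) = slot (1 :: u) x (rcons v 1).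
  by rewrite rcons_cat.
rewrite !E -linearP; congr (mu _); apply/clsP.
apply: peq_trans (peq_D _ _ _ _) _.
rewrite -cat1s; apply: peq_trans (peq_cat (peq_Z _ _ _ _) (peq_refl _)) _.
apply/clsP; rewrite cls_cat; congr (_ + _).
exact: (cls_scale c [:: _]).
Qed.

Definition moments (mu : distr) : ser A := Ser (moments_multilinear mu).

Definition Rtransform (mu : distr) : ser A := cumulant (moments mu).

Definition ser_ext (M : ser A) (s : seq A) : A :=
  match s with
  | [::] => 0
  | [:: a] => a
  | a :: b :: t => a * M (belast b t) * last b t
  end.

Lemma ser_extE M a t z : ser_ext M (a :: rcons t z) = a * M t * z.
Proof. by case: t => [//|b t] /=; rewrite belast_rcons last_rcons. Qed.

Lemma ser_ext_multilinear M : multilinear (ser_ext M).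
Proof.
move=> [|x u] v c a b; rewrite !(cat0s, cat_cons).
  case/lastP: v => [//|v z]; rewrite !ser_extE.
  by rewrite !mulrDl -!scalerAl.
case/lastP: v => [|v z].
  by rewrite !cats1 !ser_extE mulrDr scalerAr.
rewrite -!rcons_cons -!rcons_cat !ser_extE ser_multilinear.
by rewrite mulrDr mulrDl -scalerAr -scalerAl.
Qed.

Lemma seval1 (f : seq A -> A) a t : seval f [:: (a, t)] = f (a :: t).
Proof. by rewrite /seval big_seq1. Qed.

Lemma ex_distr_moments (M : ser A) : exists mu : distr, moments mu = M.
Proof.
have fM := ser_ext_multilinear M.
pose hf := GRing.isLinear.Build K (polyX A) A _ (pext (ser_ext M))
  (pext_linear fM).
pose f : {linear polyX A -> A} := HB.pack (pext (ser_ext M)) hf.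
have fcls s : f (cls s) = seval (ser_ext M) s by apply: pext_cls.
have fb a b P : f (pcst a * P * pcst b) = a * f P * b.
  elim/poly_ind: P => s; rewrite cls_sum mulr_sumr mulr_suml !linear_sum.
  rewrite mulr_sumr mulr_suml; apply: eq_bigr => -[x t] _.
  rewrite /pcst !cls_mul1 !fcls.
  case/lastP: t => [|t z]; first by rewrite !seval1.
  have -> : mmul (mmul (a, [::]) (x, rcons t z)) (b, [::])
      = (a * x, rcons t (z * b)).
    rewrite [mmul (a, _) _]/mmul /= -!cats1.
    by rewrite -[(_, t ++ [:: z])]/(slot ((a * x) :: t) z [::]) mmul_slotl0.
  by rewrite !seval1 !ser_extE !mulrA.
have fc b : f (pcst b) = b by rewrite fcls seval1.
exists (Distr fb fc); apply: ser_eq => bs.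
rewrite -[LHS]/(f (xword bs)) xwordE fcls seval1.
by rewrite ser_extE mul1r mulr1.
Qed.

Lemma moments_inj (mu nu : distr) : moments mu = moments nu -> mu =1 nu.
Proof.
move=> /(congr1 (@ser_fun _ _)) /= E; elim/poly_ind=> s.
rewrite cls_sum !linear_sum; apply: eq_bigr => -[x t] _.
case/lastP: t => [|t z]; first by rewrite !distr_cst.
have -> : cls [:: (x, rcons t z)] = pcst x * xword t * pcst z.
  rewrite xwordE /pcst !cls_mul1 [mmul (x, _) _]/mmul /= mulr1 -!cats1.
  by rewrite -[(_, t ++ [:: 1])]/(slot (x :: t) 1 [::]) mmul_slotl0 mul1r.
by rewrite !distr_bimodule; have /= -> := congr1 (@^~ t) E.
Qed.

Lemma ex_distr_Rtransform (F : ser A) : exists mu : distr, Rtransform mu = F.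
Proof.
have [M MF] := ex_moment F; have [mu muM] := ex_distr_moments M.
exists mu; rewrite /Rtransform muM.
exact: cumulant_unique (cumulantP M) MF.
Qed.

Lemma Rtransform_inj (mu nu : distr) : Rtransform mu = Rtransform nu -> mu =1 nu.
Proof.
move=> E; apply: moments_inj; apply: ser_eq => bs.
by rewrite !cumulantP -/(Rtransform mu) E.
Qed.

Definition BB (alpha : {linear A -> A}) (mu : distr) : distr :=
  projT1 (cid (ex_distr_Rtransform (RBhat alpha (Rtransform mu)))).

Lemma BBP alpha mu : Rtransform (BB alpha mu) = RBhat alpha (Rtransform mu).
Proof.
exact: (projT2 (cid (ex_distr_Rtransform (RBhat alpha (Rtransform mu))))).
Qed.

End Distributions.

Section PositiveDistributions.
Variables (R : realType) (B : cstarAlgType R).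

(* (a_0 X a_1 ... X a_n)^* = a_n^* X ... a_1^* X a_0^*                          *)
Definition mstar (m : mono B) : mono B :=
  (star (last m.1 m.2), map star (rev (belast m.1 m.2))).

Lemma mstar_slot u (a : B) v :
  mstar (slot u a v) = slot (map star (rev v)) (star a) (map star (rev u)).
Proof.
apply: mono_seq_inj; rewrite slot_seq.
have -> : forall m : mono B,
    (mstar m).1 :: (mstar m).2 = map star (rev (m.1 :: m.2)).
  by move=> m; rewrite [m.1 :: _]lastI rev_rcons.
by rewrite slot_seq rev_cat rev_cons map_cat map_rcons cat_rcons.
Qed.

Lemma star0 : star (0 : B) = 0.
Proof. by apply: (addrI (star 0)); rewrite -starD !addr0. Qed.

Lemma peq_mstar (s t : seq (mono B)) :
  peq s t -> peq (map mstar s) (map mstar t).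
Proof.
elim=> {s t} [s|s t _|s t r _ H1 _ H2|s s' t t' _ H1 _ H2|s t|v|u a b v|u c a v].
- exact: peq_refl.
- exact: peq_sym.
- exact: peq_trans H2.
- by rewrite !map_cat; apply: peq_cat.
- by rewrite !map_cat; apply: peq_catC.
- by rewrite /= -[(0, v)]/(slot [::] 0 v) mstar_slot star0; apply: peq_slot0.
- by rewrite /= !mstar_slot starD; apply: peq_D.
rewrite /= mstar_slot starZ; apply: peq_trans (peq_Z _ _ _ _) _.
rewrite -mstar_slot; case: (slot u a v) => x w; rewrite /mscale /=.
rewrite -[(c *: x, w)]/(slot [::] (c *: x) w) mstar_slot starZ.
apply: peq_sym; apply: peq_trans (peq_Z _ _ _ _) _.
by rewrite -mstar_slot; apply: peq_refl.
Qed.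

Definition pstar (P : polyX B) : polyX B := cls (map mstar (repr P)).

Lemma pstar_cls s : pstar (cls s) = cls (map mstar s).
Proof. exact/clsP/peq_mstar/peq_repr. Qed.

Definition positive_distr (mu : distr B) : Prop :=
  forall P : polyX B, positive (mu (pstar P * P)).

End PositiveDistributions.

(* Main.v *)
Require Import Defs.
From mathcomp Require Import all_boot all_order all_algebra complex.
From mathcomp Require Import boolp reals.
From mathcomp Require classical_sets.
From mathcomp Require Import zify ring lra.

Set Implicit Arguments.
Unset Strict Implicit.
Unset Printing Implicit Defensive.

Import Order.TTheory GRing.Theory Num.Theory.

(** Let mu be positive with R-transform F. For series F and f, the filling
    F[f] sums F(a_1 f(u_1), ..., a_k f(u_k)) over all ways to write a word in
    B as a_1 u_1 a_2 u_2 ... a_k u_k, with letters a_i and possibly empty words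
    u_i. Put m(b_1, ..., b_n) = M(b_1, ..., b_{n-1}) b_n for a moment series M
    and m() = 1.

    Cutting a noncrossing partition at its outer blocks gives two equations
    ([moment_boolean], [RBhat_fill]): m = 1 + F[m] X m when F is the series of
    free cumulants of M, and RBhat_alpha(F) = F[m] when m comes from the moments
    with free cumulants alpha o F. So G = RBhat_alpha(F) and its m are the
    solution of G = F[m], m = 1 + (alpha o G) X m, which is unique because the
    value of G on a word needs only m on shorter words. As filling is
    associative, RBhat_beta(RBhat_alpha(F)) solves the same system with
    alpha + beta, so these maps commute ([RBhat_comm]). For alpha = id the two
    equations say that RBhat_id sends free cumulants to Boolean cumulants, the
    series eta with m = 1 + eta X m. Therefore B_alpha(mu) has the Boolean
    cumulants eta' = RBhat_alpha(eta), where eta are those of mu.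

    A distribution is positive iff its first Boolean cumulant is self-adjoint
    and all of them together form a positive kernel, as they are the moments of
    the vector X1 under the compression of X to the orthogonal complement of 1
    in the GNS space ([theta_kernel], [pos_upto_step]). It remains to see that
    eta' forms a positive kernel. Let omega have the free cumulants alpha o eta.
    Then eta' = eta[m_omega], which is the vacuum expectation of the words in
    the operator W (x) 1 + P (x) X on the tensor product of the GNS space of
    omega, where W acts and P projects onto the vacuum, with the GNS space of
    the kernel eta ([fock_terms_kernel]). So eta' is positive up to degree n if
    omega is ([posker_fock]). The Boolean cumulants of omega are alpha o eta',
    hence omega is positive up to degree n + 1 by complete positivity of alpha,
    and an induction on n closes the loop.

    Two facts on C*-algebras enter: elements of the form c^* c are closed under
    sums (the Kelley-Vaught argument, [psd_star]), and a hermitian matrix A with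
    c^* A c >= 0 for all vectors c is, up to an arbitrarily small multiple of
    the identity, of the form C^* C ([cholesky]). *)

(** * Noncrossing partitions as words in four letters *)

Section OpenerStack.
Implicit Types (L : nat -> bool * bool).

(** Minima of the blocks that are open just before position k, innermost first,
    when [L] gives for each position the pair (first of its block, last of its
    block). *)
Fixpoint ostack L k : seq nat :=
  if k is j.+1 then
    match L j with
    | (true, false) => j :: ostack L j
    | (false, true) => behead (ostack L j)
    | _ => ostack L j
    end
  else [::].

(** The minimum of the block of k: in a noncrossing partition a position that
    continues a block continues the innermost open one. *)
Definition label L k : nat := if (L k).1 then k else head 0 (ostack L k).

Lemma ostack_path L k : path gtn k (ostack L k).
Proof.
elim: k => [//|k IH] /=.
have w (s : seq nat) : path gtn k s -> path gtn k.+1 s.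
  by case: s => //= a s /andP[ak ->]; rewrite andbT ltnS ltnW.
case: (L k) => -[] [] /=; rewrite ?ltnSn ?IH //; try exact: w.
apply: w; move: IH; case: (ostack L k) => [//|a [|b s]] //= /and3P[ak ba ->].
by rewrite andbT (ltn_trans ba).
Qed.

Lemma ostack_lt L k i : i \in ostack L k -> i < k.
Proof.
have := ostack_path L k; rewrite path_sortedE; last by move=> a b c /= ab bc;
  apply: ltn_trans bc ab.
by case/andP=> /allP H _ /H.
Qed.

Lemma ostack_uniq L k : uniq (ostack L k).
Proof.
apply: (@sorted_uniq _ gtn); last exact: path_sorted (ostack_path L k).
  by move=> a b c /= ab bc; apply: ltn_trans bc ab.
by move=> a /=; rewrite ltnn.
Qed.

Lemma ostack_head_max L k i : i \in ostack L k -> i <= head 0 (ostack L k).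
Proof.
have := path_sorted (ostack_path L k); case: (ostack L k) => [//|a s] /=.
rewrite path_sortedE; last by move=> x b c /= ab bc; apply: ltn_trans bc ab.
by case/andP => /allP H _; rewrite inE => /orP[/eqP ->|/H /ltnW].
Qed.

Lemma ostack_S L k i : i \in ostack L k.+1 -> i = k \/ i \in ostack L k.
Proof.
rewrite /=; case: (L k) => -[] []; rewrite ?inE; try by right.
  by case/orP=> [/eqP|]; [left|right].
by move/mem_behead; right.
Qed.

Lemma ostack_between L i j k : i \in ostack L k -> i < j -> j <= k ->
  i \in ostack L j.
Proof.
elim: k => [//|k IH] ik ij; rewrite leq_eqVlt ltnS => /orP[/eqP -> //|jk].
case: (ostack_S ik) => [E|/IH]; last exact.
by move: ij; rewrite E ltnNge jk.
Qed.

Lemma ostack_open L k i : i \in ostack L k -> L i = (true, false).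
Proof.
elim: k => [//|k IH] /=; case E: (L k) => [[] []]; try exact: IH.
  by rewrite inE => /orP[/eqP ->|/IH].
by move/mem_behead/IH.
Qed.

(** These are the words of noncrossing partitions. Here h counts the open
    blocks, and the flag o asks that some block be open before every letter. *)
Fixpoint valid (o : bool) h (t : seq (bool * bool)) : bool :=
  if t is l :: t' then
    [&& o ==> (0 < h), l.1 || (0 < h) &
     valid o (match l with (true, false) => h.+1 | (false, true) => h.-1 | _ =>
       h end) t']
  else h == 0.

Lemma valid_ostack o L k m :
  valid o (size (ostack L k)) [seq L j | j <- iota k m] =
  all (fun j => (o ==> (0 < size (ostack L j))) &&
    ((L j).1 || (0 < size (ostack L j)))) (iota k m)
   && (size (ostack L (k + m)) == 0).
Proof.
elim: m k => [|m IH] k /=; first by rewrite addn0.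
rewrite -addSnnS -andbA -IH /= !andbA; congr (_ && valid _ _ _).
by case: (L k) => -[] [] //; rewrite size_behead.
Qed.

End OpenerStack.

Section FromWord.
Variables (n : nat) (L : nat -> bool * bool).
Hypothesis Lopen : forall k, k < n -> (L k).1 || (0 < size (ostack L k)).
Hypothesis Lend : ostack L n = [::].
Implicit Types (i j m : 'I_n).

Let P := preim_partition (fun m : 'I_n => label L m) [set: 'I_n].

Lemma head_ostack (k : nat) : k < n -> ~~ (L k).1 ->
  head 0 (ostack L k) \in ostack L k.
Proof. by move=> kn nk; have := Lopen kn; rewrite (negPf nk) /=; case:
  (ostack L k) => //= a s _; rewrite mem_head. Qed.

Lemma label_le (k : nat) : k < n -> label L k <= k.
Proof.
rewrite /label => kn; case: ifP => // /negbT nk.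
by apply: ltnW; apply: ostack_lt; apply: head_ostack.
Qed.

Lemma from_wordP : partition P [set: 'I_n].
Proof. exact: preim_partitionP. Qed.

Lemma mem_block m j : (j \in pblock P m) = (label L m == label L j).
Proof.
rewrite /P /preim_partition pblock_equivalence_partition ?inE //.
by move=> x y z _ _ _; split=> //= /eqP ->.
Qed.

Lemma isMin_block m : isMin (pblock P m) m = (L m).1.
Proof.
apply/forallP/idP => [H|Lm j].
  apply/negPn/negP => nm.
  have ho := head_ostack (ltn_ord m) nm; have hm := ostack_lt ho.
  have hn := ltn_trans hm (ltn_ord m).
  have /implyP := H (Ordinal hn);
    rewrite mem_block /label (negPf nm) /= (ostack_open ho) /= eqxx.
  by move=> /(_ isT); rewrite leqNgt hm.
apply/implyP; rewrite mem_block {1}/label Lm => /eqP ->.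
exact: label_le.
Qed.

Lemma label_ostack (k j : nat) : j < n -> label L k = label L j -> k < j ->
  k < n ->
  label L k \in ostack L j.
Proof.
move=> jn E kj kn; rewrite E /label; case: ifP => [Lj|/negbT nj]; last exact:
  head_ostack.
move: E; rewrite [RHS]/label Lj => E.
by have := label_le kn; rewrite E leqNgt kj.
Qed.

Lemma isMax_block m : isMax (pblock P m) m = (L m).2.
Proof.
apply/forallP/idP => [H|Lm j]; last first.
  apply/implyP; rewrite mem_block => /eqP E; rewrite leqNgt; apply/negP => mj.
  have := label_ostack (ltn_ord j) E mj (ltn_ord m); rewrite E => ij.
  have im := label_le (ltn_ord m); rewrite E in im.
  have := ostack_between ij (leq_ltn_trans im (ltnSn m)) mj.
  move: E im ij; rewrite /label; case El: (L m) Lm => [[] b] /= bT;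
    rewrite bT in El.
    by move=> <- _ /ostack_open; rewrite El.
  rewrite El /= => <- _ _.
  have := ostack_uniq L m; have := head_ostack (ltn_ord m);
    rewrite El => /(_ isT).
  by case: (ostack L m) => [//|a s] /= _ /andP[/negPf ->].
apply/negPn/negP => nm.
have ho : label L m \in ostack L m.+1.
  rewrite /label /=; move: nm; case El: (L m) => [[] []] //= _;
    first by rewrite mem_head.
  by have := head_ostack (ltn_ord m); rewrite El => /(_ isT).
have [k [km kn kin knin]] :
  exists k, [/\ m < k, k < n, label L m \in ostack L k & label L m \notin ostack
  L k.+1].
  have : label L m \notin ostack L (m.+1 + (n - m.+1))
    by rewrite subnKC // Lend.
  have : m.+1 + (n - m.+1) <= n by rewrite subnKC.
  elim: (n - m.+1) => [|d IH]; first by rewrite addn0 ho.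
  rewrite addnS => dn; case: (boolP (label L m \in ostack L (m.+1 + d))) =>
    [Hin Hnin|Hn _].
    by exists (m.+1 + d); split=> //; rewrite addSn ltnS leq_addr.
  by apply: IH => //; apply: ltnW.
have labk : label L k = label L m.
  have stE : ostack L k.+1 = match L k with
    | (true, false) => k :: ostack L k
    | (false, true) => behead (ostack L k)
    | _ => ostack L k
    end by [].
  rewrite [LHS]/label; move: knin; rewrite stE; case El: (L k) => [[] []] /=.
  - by rewrite kin.
  - by rewrite inE kin orbT.
  - by case: (ostack L k) kin => [//|a s] /=;
    rewrite inE => /orP[/eqP -> //|->].
  - by rewrite kin.
have /implyP := H (Ordinal kn); rewrite mem_block /= labk eqxx => /(_ isT).
by rewrite leqNgt km.
Qed.

(** If a < b < c < d with a, c in one block and b, d in another, then both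
    minima are on the stack at b and at c. The block met at b is on top there
    and the block met at c is on top there, so each minimum would exceed the
    other. *)
Lemma from_word_NC : P \in NC n.
Proof.
rewrite inE from_wordP /=.
have blk V a c : V \in P -> a \in V -> c \in V -> label L a = label L c /\ V =
  pblock P a.
  move=> VP aV cV; have E : V = pblock P a.
    by case/and3P: from_wordP => _ tP _; rewrite (def_pblock tP VP aV).
  by split=> //; apply/eqP; rewrite -mem_block -E.
apply/forall_inP => V VP; apply/forall_inP => W WP; apply/implyP => VW.
apply/forall_inP => a aV; apply/forall_inP => b bW.
apply/forall_inP => c cV; apply/forall_inP => d dW.
apply/negP => /and3P[ab bc cd].
have [Eac EV] := blk _ _ _ VP aV cV; have [Ebd EW] := blk _ _ _ WP bW dW.
have nE : label L a != label L b.
  apply: contraNneq VW => E; rewrite EV EW; apply/eqP/setP => j.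
  by rewrite !mem_block E.
have xc := label_ostack (ltn_ord c) Eac (ltn_trans ab bc) (ltn_ord a).
have yd := label_ostack (ltn_ord d) Ebd (ltn_trans bc cd) (ltn_ord b).
have xa := label_le (ltn_ord a); have yb := label_le (ltn_ord b).
have yc := ostack_between yd (leq_ltn_trans yb bc) (ltnW cd).
have hc : head 0 (ostack L c) = label L a.
  rewrite Eac /label; case: ifP => // Lc.
  by move: Eac; rewrite [RHS]/label Lc => E; move: xa;
    rewrite E leqNgt (ltn_trans ab bc).
have := ostack_head_max yc; rewrite hc leq_eqVlt eq_sym (negPf nE) /= => yx.
have xb := ostack_between xc (leq_ltn_trans xa ab) (ltnW bc).
have := ostack_head_max xb.
have hb : head 0 (ostack L b) = label L b.
  rewrite /label; case: ifP => // Lb.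
  by move: yx; rewrite {1}/label Lb ltnNge ltnW // (leq_ltn_trans xa ab).
by rewrite hb leqNgt yx.
Qed.

End FromWord.

Section ToWord.
Variable n : nat.
Implicit Types (i j m : 'I_n) (P : {set {set 'I_n}}) (V W : {set 'I_n}).

Definition letter_at P m :
  bool * bool := (isMin (pblock P m) m, isMax (pblock P m) m).

Definition type_word P :
  n.-tuple (bool * bool) := [tuple letter_at P m | m < n].

Definition letter (t : seq (bool * bool)) (k : nat) := nth (true, true) t k.

Lemma letter_type_word P m : letter (type_word P) m = letter_at P m.
Proof. by rewrite /letter -tnth_nth tnth_mktuple. Qed.

Lemma tuple_letter (t : n.-tuple (bool * bool)) :
  val t = [seq letter t k | k <- iota 0 n].
Proof.
by rewrite -[LHS](mkseq_nth (true, true)) size_tuple.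
Qed.

Lemma minP V j : j \in V -> exists i, i \in V /\ isMin V i.
Proof.
move=> jV; case: (arg_minnP (fun i : 'I_n => i : nat) jV) => i iV imin;
  exists i.
by split=> //; apply/forallP => k; apply/implyP/imin.
Qed.

Lemma isMin_inj V i j : i \in V -> j \in V -> isMin V i -> isMin V j -> i = j.
Proof.
move=> iV jV /forallP/(_ j) + /forallP/(_ i); rewrite iV jV /= => ij ji.
by apply/val_inj/eqP; rewrite eqn_leq ij ji.
Qed.

Section OneNC.
Variable P : {set {set 'I_n}}.
Hypothesis PNC : P \in NC n.
Let pP := NC_partition PNC.
Notation L := (letter (type_word P)).

Lemma pblock_eq i j : j \in pblock P i -> pblock P j = pblock P i.
Proof.
move=> ji; case/and3P: pP => _ tP _; apply: def_pblock => //.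
by case: (block_in i pP).
Qed.

Lemma self_block i : i \in pblock P i.
Proof. by case: (block_in i pP). Qed.

Lemma no_cross (a b c d : 'I_n) : c \in pblock P a -> d \in pblock P b ->
  pblock P a != pblock P b -> a < b -> b < c -> c < d -> False.
Proof.
move=> ca db nE ab bc cd; move: PNC; rewrite inE => /andP[_ /forall_inP H].
have := H _ (block_in a pP).1;
  move/forall_inP/(_ _ (block_in b pP).1)/implyP/(_ nE).
move/forall_inP/(_ a (self_block a))/forall_inP/(_ b (self_block b)).
move/forall_inP/(_ c ca)/forall_inP/(_ d db).
by rewrite ab bc cd.
Qed.

Definition opener (k i : nat) : Prop :=
  exists m, [/\ val m = i, isMin (pblock P m) m & openB (pblock P m) k].

Lemma openBP V (k : nat) :
  reflect (exists i j, [/\ i \in V, j \in V, i < k & k <= j]) (openB V k).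
Proof.
apply: (iffP andP) => [[/existsP[i /andP[iV ik]] /existsP[j /andP[jV kj]]]|].
  by exists i, j.
by move=> [i [j [iV jV ik kj]]]; split; apply/existsP; [exists i|exists j];
  rewrite ?iV ?jV.
Qed.

Lemma block_notin m j : pblock P j != pblock P m -> m \notin pblock P j.
Proof. by apply: contraNN => /pblock_eq ->. Qed.

(** An open block W with a larger minimum than the block V of m would have
    elements on both sides of m, and V an element before W starts: a crossing.
    *)
Lemma opener_top m (i : nat) (u : 'I_n) : opener m i -> u \in pblock P m ->
  isMin (pblock P m) u ->
  ~~ isMin (pblock P m) m -> i <= u.
Proof.
move=> [v [<- vmin /openBP[a [b [av bv am mb]]]]] uV umin nm.
have Eu := pblock_eq uV.
have [E|nE] := eqVneq (pblock P v) (pblock P m).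
  have vV : v \in pblock P m by rewrite -E self_block.
  by rewrite E in vmin; rewrite (isMin_inj vV uV vmin umin).
rewrite leqNgt; apply/negP => uv.
have um : u < m.
  rewrite ltn_neqAle; have /forallP/(_ m) := umin; rewrite self_block => /= ->.
  by rewrite andbT; apply: contraNneq nm => /val_inj E; rewrite E in umin.
have va : v <= a by have /forallP/(_ a) := vmin; rewrite av.
have bm : b != m by apply: contraNneq nE => <-; rewrite (pblock_eq bv).
apply: (@no_cross u v m b) => //.
- by rewrite Eu self_block.
- by rewrite Eu eq_sym.
- exact: leq_ltn_trans va am.
by rewrite ltn_neqAle eq_sym bm.
Qed.

(** The stack is computed from the letters only. Matching it with the open
    blocks shows that the letters determine the partition. *)
Lemma ostack_opener (k : nat) : k <= n -> forall x : nat, x \in ostack L k <->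
  opener k x.
Proof.
elim: k => [_ i|k IH kn i].
  by split=> [|[m [_ _ /openBP[a [b [_ _ a0 _]]]]]]; rewrite ?in_nil.
have {}IH := IH (ltnW kn); pose m := Ordinal kn.
have other (v : 'I_n) : pblock P v != pblock P m ->
    openB (pblock P v) k.+1 = openB (pblock P v) k.
  by move=> nE; rewrite -[k]/(val m) openB_other // block_notin.
have o1 : openB (pblock P m) k = ~~ isMin (pblock P m) m.
  by rewrite -[k]/(val m) openB_min // self_block.
have o2 : openB (pblock P m) k.+1 = ~~ isMax (pblock P m) m.
  by rewrite -[k]/(val m) openB_max // self_block.
have same : isMin (pblock P m) m = isMax (pblock P m) m -> opener k.+1 i <->
  opener k i.
  move=> E; split=> -[v [vi vm vo]]; exists v; split=> //.
    have [Ev|/other <- //] := eqVneq (pblock P v) (pblock P m).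
    by move: vo; rewrite Ev o1 o2 E.
  have [Ev|/other -> //] := eqVneq (pblock P v) (pblock P m).
  by move: vo; rewrite Ev o1 o2 E.
rewrite /= (_ : L k = letter_at P m) -?letter_type_word // letter_type_word
  /letter_at.
case mn: (isMin _ m) (same) => same'; case mx: (isMax _ m) same' => same'.
- by rewrite IH same'.
- rewrite inE; split=> [/orP[/eqP ->|/IH [v [vi vm vo]]]|[v [vi vm vo]]].
  + by exists m; split=> //; rewrite o2 mx.
  + exists v; split=> //; have [Ev|/other -> //] := eqVneq (pblock P v)
    (pblock P m).
    by move: vo; rewrite Ev o1 mn.
  have [Ev|nE] := eqVneq (pblock P v) (pblock P m).
    have vV : v \in pblock P m by rewrite -Ev self_block.
    rewrite Ev in vm; have vE : v = m := isMin_inj vV (self_block m) vm mn.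
    by rewrite -vi vE eqxx.
  by apply/orP; right; apply/IH; exists v; split=> //; rewrite -other.
- have [u [uV umin]] := minP (self_block m).
  have Eu := pblock_eq uV.
  have uo : opener k u by exists u; rewrite Eu; split=> //; rewrite o1 mn.
  have hu : head 0 (ostack L k) = u.
    have hin : head 0 (ostack L k) \in ostack L k.
      by case: (ostack L k) (IH u) => [[_ /(_ uo)]//|a s _]; rewrite mem_head.
    apply/eqP; rewrite eqn_leq ostack_head_max ?andbT; last by apply/IH.
    move/IH: hin => hin; apply: (@opener_top m _ u hin uV umin).
    by rewrite mn.
  have nd : forall x : nat, x \in behead (ostack L k) <->
    x \in ostack L k /\ x != u.
    move=> x; move: (ostack_uniq L k) hu; case:
      (ostack L k) (IH u) => [[_ /(_ uo)]//|a s _] /= /andP[as_ _] <-.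
    rewrite inE; split=> [xs|[/orP[/eqP ->|//]]]; last by rewrite eqxx.
    by rewrite xs orbT; split=> //; apply: contraNneq as_ => <-.
  rewrite nd IH; split=> [[[v [vi vm vo]] vu]|[v [vi vm vo]]].
    exists v; split=> //; have [Ev|/other -> //] := eqVneq (pblock P v)
      (pblock P m).
    have vV : v \in pblock P m by rewrite -Ev self_block.
    by move: vu; rewrite Ev in vm; rewrite -vi (isMin_inj vV uV vm umin) eqxx.
  have nE : pblock P v != pblock P m.
    by apply: contraTneq vo => ->; rewrite o2 mx.
  split; first by exists v; split=> //; rewrite -other.
  by rewrite -vi; apply: contraNneq nE => /val_inj ->; rewrite Eu.
by rewrite IH same'.
Qed.

Lemma opener_end x : ~ opener n x.
Proof. by move=> [m [_ _ /openBP[a [b [_ _ _]]]]]; rewrite leqNgt ltn_ord. Qed.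

Lemma opener_min m u : u \in pblock P m -> isMin (pblock P m) u ->
  ~~ isMin (pblock P m) m -> val u \in ostack L m.
Proof.
move=> uV umin nm; apply/ostack_opener; first exact: ltnW.
by exists u; rewrite (pblock_eq uV); split=> //;
  rewrite openB_min // self_block.
Qed.

Lemma label_min m u : u \in pblock P m -> isMin (pblock P m) u -> label L m = u.
Proof.
move=> uV umin; rewrite /label letter_type_word /=; case:
  ifP => [mmin|/negbT nm].
  by rewrite (isMin_inj uV (self_block m) umin mmin).
have us := opener_min uV umin nm.
have hin : head 0 (ostack L m) \in ostack L m.
  by case: (ostack L m) us => [//|a s _]; rewrite mem_head.
apply/eqP; rewrite eqn_leq (ostack_head_max us) andbT.
move/ostack_opener: hin => /(_ (ltnW (ltn_ord m))) hin.
exact: (opener_top hin uV umin nm).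
Qed.

Lemma mem_pblock_label m j : (j \in pblock P m) = (label L m == label L j).
Proof.
have [u [uV umin]] := minP (self_block m);
  have [v [vV vmin]] := minP (self_block j).
rewrite (label_min uV umin) (label_min vV vmin).
apply/idP/eqP => [jm|/val_inj E].
  rewrite (pblock_eq jm) in vV vmin; congr val; exact:
    isMin_inj uV vV umin vmin.
by rewrite -(pblock_eq uV) E (pblock_eq vV) self_block.
Qed.

Lemma ostack_nonempty (k : nat) : k < n -> (L k).1 || (0 < size (ostack L k)).
Proof.
move=> kn; pose m := Ordinal kn; rewrite -[k]/(val m) letter_type_word /=.
case mmin: (isMin _ _) => //=.
have [u [uV umin]] := minP (self_block m).
by have := opener_min uV umin; rewrite mmin => /(_ isT); case: (ostack L _).
Qed.

Lemma ostack_end : ostack L n = [::].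
Proof.
case E: (ostack L n) => [//|a s]; have /ostack_opener : a \in ostack L n
  by rewrite E mem_head.
by move=> /(_ (leqnn n)) /opener_end.
Qed.

Lemma valid_type_word : valid false 0 (type_word P).
Proof.
rewrite tuple_letter -[0]/(size (ostack L 0)) valid_ostack add0n ostack_end
  andbT.
by apply/allP => k; rewrite mem_iota => /= /ostack_nonempty.
Qed.

End OneNC.

(** Both partitions have the same stacks, hence every position has the same
    block minimum in both. *)
Lemma type_word_inj : {in NC n &, injective type_word}.
Proof.
suff sub P Q : P \in NC n -> Q \in NC n -> type_word P = type_word Q ->
  P \subset Q.
  by move=> P Q PNC QNC E; apply/eqP; rewrite eqEsubset !sub.
move=> PNC QNC E; apply/subsetP => W WP.
have /set0Pn[x xW] : W != set0.
  by apply: contraTneq WP => ->; case/and3P: (NC_partition PNC).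
have -> : W = pblock Q x.
  case/and3P: (NC_partition PNC) => _ tP _; rewrite -(def_pblock tP WP xW).
  by apply/setP => j; rewrite (mem_pblock_label PNC) (mem_pblock_label QNC) E.
exact: (block_in x (NC_partition QNC)).1.
Qed.

Lemma type_word_onto (t : n.-tuple (bool * bool)) : valid false 0 t ->
  exists2 P, P \in NC n & t = type_word P.
Proof.
rewrite tuple_letter -[0]/(size (ostack (letter t) 0)) valid_ostack add0n =>
  /andP[/allP Lo /nilP Le].
have {}Lo k : k < n -> (letter t k).1 || (0 < size (ostack (letter t) k)).
  by move=> kn; apply: Lo; rewrite mem_iota.
exists (preim_partition (fun m : 'I_n => label (letter t) m) [set: 'I_n]).
  exact: from_word_NC.
apply: eq_from_tnth => i; rewrite tnth_mktuple /letter_at isMin_block //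
  isMax_block //.
by rewrite -surjective_pairing /letter -tnth_nth.
Qed.

Lemma image_type_word :
  [set type_word P | P in NC n] =
    [set t : n.-tuple (bool * bool) | valid false 0 t].
Proof.
apply/setP => t; rewrite inE;
  apply/imsetP/idP => [[P PNC ->]|/type_word_onto[P PNC ->]].
  exact: valid_type_word.
by exists P.
Qed.

End ToWord.

(** The words of the partitions whose first and last element share a block:
    apart from the one-letter word, height 0 occurs only at both ends. *)
Definition vouter (t : seq (bool * bool)) : bool :=
  match t with
  | [::] => false
  | [:: l] => l == (true, true)
  | l :: t' => (l == (true, false)) && valid true 1 t'
  end.

(** If the block of the first element ended at j before the last position, a
    block open after j would cross it, so the stack would be empty there. *)
Lemma outer_word n (P : {set {set 'I_n.+1}}) : P \in NC n.+1 ->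
  (ord_max \in outer P) = vouter (type_word P).
Proof.
move=> PNC; rewrite /outer; pose L := letter (type_word P).
have min0 : isMin (pblock P ord0) ord0 by apply/forallP => j; apply/implyP.
have tE : val (type_word P) = letter_at P ord0 :: [seq L k | k <- iota 1 n].
  by rewrite tuple_letter /=; congr (_ :: _); exact: (letter_type_word P ord0).
case: n => [|n] in P PNC @L min0 tE *.
  rewrite tE /= /letter_at min0 (_ : ord_max = ord0); last exact: val_inj.
  rewrite self_block //; apply/esym/eqP; congr (_, _); apply/forallP => j;
    apply/implyP => _.
  by rewrite (ord1 j).
have vE l t : 0 < size t -> vouter (l :: t) = (l == (true, false)) &&
  valid true 1 t by case: t.
rewrite tE vE ?size_map ?size_iota // /letter_at min0 -/L.
rewrite (_ : (_ == (true, false)) = ~~ isMax (pblock P ord0) ord0);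
  last by case: isMax.
have [max0|max0] := boolP (isMax _ _).
  by apply/negP => H; have /forallP/(_ ord_max) := max0; rewrite H.
have s1 : ostack L 1 = [:: 0].
  have L0 : L 0 = (true, false).
    by apply: (etrans (letter_type_word P ord0));
      rewrite /letter_at min0 (negPf max0).
  by rewrite /= L0.
have := valid_ostack true L 1 n.+1; rewrite s1 [size [:: 0]]/= => ->.
rewrite add1n (ostack_end PNC) andbT.
apply/idP/allP => [H k|H].
  rewrite mem_iota => /andP[k0 kn]; suff -> : 0 < size (ostack L k)
    by rewrite orbT.
  have : 0 \in ostack L k.
    apply/(ostack_opener PNC); first exact: ltnW.
    exists ord0; split=> //; apply/openBP; exists ord0, ord_max; split=> //.
    exact: self_block.
  by case: (ostack L k).
apply/negPn/negP => nmax.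
case: (arg_maxnP (fun i : 'I_n.+2 => i : nat) (self_block PNC ord0)) => j jV
  jmax.
have jn : j < n.+1.
  rewrite ltn_neqAle -ltnS ltn_ord andbT; apply: contraNneq nmax => E.
  by rewrite (_ : ord_max = j) //; apply: val_inj.
have hj : j.+1 \in iota 1 n.+1 by rewrite mem_iota add1n ltnS.
have /andP[+ _] := H _ hj.
case E: (ostack L j.+1) => [//|x s] _.
have /(ostack_opener PNC) : x \in ostack L j.+1 by rewrite E mem_head.
move=> /(_ (ltnW jn)) [v [_ _ /openBP[a [b [av bv aj jb]]]]].
have nE : pblock P v != pblock P ord0.
  by apply: contraTneq jb => E'; rewrite -ltnNge; apply: jmax; rewrite -E'.
have aj' : a != j.
  by apply: contraNneq nE => E';
    rewrite -(pblock_eq PNC av) E' (pblock_eq PNC jV).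
have a0 : a != ord0.
  by apply: contraNneq nE => E'; rewrite -(pblock_eq PNC av) E'.
apply: (@no_cross _ _ PNC ord0 a j b) => //.
- by rewrite (pblock_eq PNC av).
- by rewrite (pblock_eq PNC av) eq_sym.
- by rewrite lt0n; apply: contraNneq a0 => E'; apply/eqP/val_inj.
by rewrite ltn_neqAle -ltnS aj andbT.
Qed.

Local Open Scope ring_scope.
Local Notation polyX := Defs.polyX.

(** * Norm limits in a C*-algebra *)

Section CStar.
Variables (R : realType) (B : cstarAlgType R).
Implicit Types (a b c d h k x y z : B) (r s t e : R).

Notation "r *:r a" := ((r%:C)%C *: (a : B)) (at level 40).

Lemma rscA r s a : r *:r (s *:r a) = (r * s) *:r a.
Proof. by rewrite scalerA -rmorphM. Qed.
Lemma rscDl r s a : (r + s) *:r a = r *:r a + s *:r a.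
Proof. by rewrite rmorphD scalerDl. Qed.
Lemma rsc1 a : 1 *:r a = a.
Proof. by rewrite rmorph1 scale1r. Qed.
Lemma rscK r a : r != 0 -> r *:r (r^-1 *:r a) = a.
Proof. by move=> r0; rewrite rscA divff // rsc1. Qed.
Lemma rscVK r a : r != 0 -> r^-1 *:r (r *:r a) = a.
Proof. by move=> r0; rewrite rscA mulVf // rsc1. Qed.
Lemma rsc2 a : 2 *:r a = a + a.
Proof. by rewrite -[2]/(1 + 1) rscDl rsc1. Qed.

Lemma cnorm_rsc r a : cnorm (r *:r a) = `|r| * cnorm a.
Proof. by rewrite cnormZ /ComplexField.Normc.normc /= expr0n addr0 sqrtr_sqr.
  Qed.
Lemma star_rsc r a : star (r *:r a) = r *:r star a.
Proof. by rewrite starZ /= oppr0. Qed.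

Lemma cnorm0 : cnorm (0 : B) = 0.
Proof. by rewrite -[X in cnorm X](scale0r 0) -(rmorph0 (real_complex R))
  cnorm_rsc normr0 mul0r. Qed.
Lemma cnormN a : cnorm (- a) = cnorm a.
Proof. by rewrite -scaleN1r -(rmorphN1 (real_complex R)) cnorm_rsc normrN1
  mul1r. Qed.
Lemma cnorm_ge0 a : 0 <= cnorm a.
Proof.
have := cnormD a (- a); rewrite subrr cnorm0 cnormN => H; lra.
Qed.
Lemma cnorm_distC a b : cnorm (a - b) = cnorm (b - a).
Proof. by rewrite -cnormN opprB. Qed.
Lemma cnorm_tri c a b : cnorm (a - b) <= cnorm (a - c) + cnorm (c - b).
Proof. by apply: le_trans (cnormD _ _); rewrite addrA subrK. Qed.

Lemma starN a : star (- a) = - star a.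
Proof. by rewrite -scaleN1r -(rmorphN1 (real_complex R)) star_rsc rmorphN1
  scaleN1r. Qed.
Lemma starB a b : star (a - b) = star a - star b.
Proof. by rewrite starD starN. Qed.
Lemma star1 : star (1 : B) = 1.
Proof. by rewrite -[RHS]starK -[star 1 in RHS]mul1r starM starK mul1r. Qed.
Lemma star_sum (I : Type) (l : seq I) (F : I -> B) :
  star (\sum_(i <- l) F i) = \sum_(i <- l) star (F i).
Proof. by apply: (big_morph star starD); apply: star0. Qed.

Lemma cnorm_starE a : cnorm (star a) = cnorm a.
Proof.
suff H b : cnorm b <= cnorm (star b).
  by apply/eqP; rewrite eq_le H andbT -[X in _ <= cnorm X]starK H.
have [/cnorm0_eq0->|b0] := eqVneq (cnorm b) 0;
  first by rewrite cnorm0 cnorm_ge0.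
have bp : 0 < cnorm b by rewrite lt_def b0 cnorm_ge0.
have := cnormM (star b) b; rewrite cnorm_star expr2.
by rewrite ler_pM2r.
Qed.

Lemma cnorm1 : cnorm (1 : B) = 1.
Proof.
have := cnorm_star (1 : B); rewrite star1 mul1r expr2 => H.
have n0 : cnorm (1 : B) != 0.
  by apply/eqP => /cnorm0_eq0 /eqP; rewrite oner_eq0.
by apply: (mulfI n0); rewrite -H mulr1.
Qed.
Lemma cnorm_rsc1 r : 0 <= r -> cnorm (r *:r 1) = r.
Proof. by move=> r0; rewrite cnorm_rsc cnorm1 mulr1 ger0_norm. Qed.
Lemma cnorm_sa h : star h = h -> cnorm (h * h) = cnorm h ^+ 2.
Proof. by move=> sh; rewrite -cnorm_star sh. Qed.

Definition cvgs (u : nat -> B) (l : B) : Prop :=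
  forall e, 0 < e -> exists N : nat, forall n, (N <= n)%N ->
    cnorm (u n - l) < e.

Lemma cnorm_small0 a : (forall e, 0 < e -> cnorm a <= e) -> a = 0.
Proof.
move=> H; apply: cnorm0_eq0; apply/eqP; rewrite eq_le cnorm_ge0 andbT.
apply/ler_addgt0Pr => e e0; rewrite add0r; exact: H.
Qed.

Lemma cvgs_unique u l m : cvgs u l -> cvgs u m -> l = m.
Proof.
move=> ul um; apply/eqP; rewrite -subr_eq0; apply/eqP/cnorm_small0 => e e0.
have e2 : 0 < e / 2 by rewrite divr_gt0.
have [N HN] := ul _ e2; have [M HM] := um _ e2.
have := HN (maxn N M) (leq_maxl _ _); have := HM (maxn N M) (leq_maxr _ _).
have := cnorm_tri (u (maxn N M)) l m; rewrite (cnorm_distC l (u _)) => *; lra.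
Qed.

Lemma cvgs_cst a : cvgs (fun _ => a) a.
Proof. by move=> e e0; exists 0%N => n _; rewrite subrr cnorm0. Qed.

Lemma cvgsD u v l m : cvgs u l -> cvgs v m -> cvgs (fun n => u n + v n) (l + m).
Proof.
move=> ul um e e0; have e2 : 0 < e / 2 by rewrite divr_gt0.
have [N HN] := ul _ e2; have [M HM] := um _ e2.
exists (maxn N M) => n; rewrite geq_max => /andP[/HN + /HM].
by have := cnormD (u n - l) (v n - m); rewrite opprD addrACA => *; lra.
Qed.

Lemma cvgs_lip (f : B -> B) K u l :
  (forall a b, cnorm (f a - f b) <= K * cnorm (a - b)) ->
  cvgs u l -> cvgs (f \o u) (f l).
Proof.
move=> fK ul e e0; have K1 : 0 < `|K| + 1 by rewrite ltr_wpDl.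
have [N HN] := ul _ (divr_gt0 e0 K1); exists N => n /HN.
rewrite ltr_pdivlMr // => H /=; apply: le_lt_trans (fK _ _) _; apply:
  le_lt_trans H.
rewrite mulrC ler_wpM2l ?cnorm_ge0 //; have := ler_norm K; lra.
Qed.

Lemma cvgs_star u l : cvgs u l -> cvgs (star \o u) (star l).
Proof.
by apply: (@cvgs_lip _ 1) => a b; rewrite -starB cnorm_starE mul1r.
Qed.
Lemma cvgs_mull a u l : cvgs u l -> cvgs (fun n => a * u n) (a * l).
Proof.
by apply: (@cvgs_lip (fun b => a * b) (cnorm a)) => b c; rewrite -mulrBr cnormM.
Qed.
Lemma cvgs_mulr a u l : cvgs u l -> cvgs (fun n => u n * a) (l * a).
Proof.
by apply: (@cvgs_lip (fun b => b * a) (cnorm a)) => b c;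
  rewrite -mulrBl mulrC cnormM.
Qed.
Lemma cvgs_rsc r u l : cvgs u l -> cvgs (fun n => r *:r u n) (r *:r l).
Proof.
by apply: (@cvgs_lip (fun b => r *:r b) `|r|) => b c;
  rewrite -scalerBr cnorm_rsc.
Qed.
Lemma cvgs_S u l : cvgs u l -> cvgs (fun n => u n.+1) l.
Proof.
by move=> ul e /ul[N HN]; exists N => n Nn; apply: HN; apply: leq_trans Nn _.
Qed.
Lemma cvgs_le u l r : cvgs u l -> (forall n, cnorm (u n) <= r) -> cnorm l <= r.
Proof.
move=> ul ur; apply/ler_addgt0Pr => e /ul[N /(_ N (leqnn N))].
have := ur N; have := cnorm_tri (u N) l 0;
  rewrite !subr0 (cnorm_distC l (u _)) => *; lra.
Qed.
Lemma cvgs_sq u l : (forall n, cnorm (u n) <= 1) -> cvgs u l ->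
  cvgs (fun n => u n * u n) (l * l).
Proof.
move=> u1 ul e e0; have l1 := cvgs_le ul u1.
have [N HN] := ul _ (divr_gt0 e0 (ltr0n _ 2)); exists N => n /HN H.
have -> : u n * u n - l * l = u n * (u n - l) + (u n - l) * l.
  by rewrite mulrBr mulrBl addrA subrK.
apply: le_lt_trans (cnormD _ _) _.
have := cnormM (u n) (u n - l); have := cnormM (u n - l) l.
have := u1 n; have := cnorm_ge0 (u n - l).
move: H; set X := cnorm (u n - l) => *; have : cnorm (u n) * X <= 1 * X
  by rewrite ler_wpM2r.
have : X * cnorm l <= X * 1 by rewrite ler_wpM2l.
lra.
Qed.

(** The increments of u are bounded by those of a bounded increasing real
    sequence, so u is Cauchy. *)
Lemma majorized_cvg (u : nat -> B) (r : nat -> R) K :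
  (forall n, r n <= K) -> (forall n, cnorm (u n.+1 - u n) <= r n.+1 - r n) ->
  exists l, cvgs u l.
Proof.
move=> rK ur.
have inc m n : (m <= n)%N -> cnorm (u n - u m) <= r n - r m.
  elim: n => [|n IH]; first by rewrite leqn0 => /eqP ->; rewrite !subrr cnorm0.
  rewrite leq_eqVlt => /orP[/eqP->|]; first by rewrite !subrr cnorm0.
  rewrite ltnS => /IH; have := ur n; have := cnorm_tri (u n) (u n.+1) (u m) =>
    *; lra.
(* The supremum of r, within e/2 of which r stays from some N on. *)
pose S := fun x : R => exists n, r n = x.
have Ss : classical_sets.has_sup S.
  by split; [exists (r 0%N), 0%N|exists K => _ [n <-]].
apply: cnorm_complete => e e0.
have [_ [N <-] rN] := sup_adherent (divr_gt0 e0 (ltr0n _ 2)) Ss.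
have rS n : r n <= sup S by apply: sup_upper_bound => //; exists n.
exists N => m n Nm Nn.
have := inc _ _ Nm; have := inc _ _ Nn; have := cnorm_tri (u N) (u m) (u n).
rewrite (cnorm_distC (u N)); have := rS m; have := rS n => *; lra.
Qed.

Lemma neumann x : cnorm x < 1 -> exists y, (1 - x) * y = 1 /\ y * (1 - x) = 1.
Proof.
move=> x1; pose u := fix u n : B := if n is n'.+1 then 1 + x * u n' else 0.
pose r := fix r n : R := if n is n'.+1 then 1 + cnorm x * r n' else 0.
have x0 := cnorm_ge0 x.
have [l ul] : exists l, cvgs u l.
  apply: (@majorized_cvg u r (1 - cnorm x)^-1).
    have q0 : 0 < 1 - cnorm x by lra.
    elim=> [|n IH] /=; first by rewrite invr_ge0 ltW.
    have : cnorm x * r n <= cnorm x * (1 - cnorm x)^-1 by rewrite ler_wpM2l.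
    move=> H; have : (1 - cnorm x) * (1 - cnorm x)^-1 =
      1 by rewrite divff // gt_eqF.
    rewrite mulrBl mul1r; lra.
  elim=> [|n IH] /=; first by rewrite !mulr0 !addr0 !subr0 cnorm1.
  have E (V : zmodType) (p q q' : V) : p + q - (p + q') = q - q'.
    by rewrite opprD addrACA subrr add0r.
  rewrite !E -!mulrBr.
  by apply: le_trans (cnormM _ _) _; rewrite ler_wpM2l.
have E : l = 1 + x * l.
  by apply: (cvgs_unique (cvgs_S ul)); apply:
    cvgsD (cvgs_cst _) (cvgs_mull _ ul).
have comm n : u n * x = x * u n.
  by elim: n => [|n IH] /=; rewrite ?mulr0 ?mul0r // mulrDl mulrDr mul1r mulr1
    -mulrA IH.
have C : l * x = x * l.
  apply: (cvgs_unique (cvgs_mulr x ul)) => e e0.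
  have [N HN] := cvgs_mull x ul e0; exists N => n /HN; by rewrite comm.
exists l; rewrite mulrBl mulrBr C mul1r mulr1.
by rewrite {1 3}E addrK.
Qed.

End CStar.

(** * The cone of positive elements *)

Section CStar2.
Variables (R : realType) (B : cstarAlgType R).
Implicit Types (a b c d h k x y z : B) (r s t e : R).

Notation "r *:r a" := ((r%:C)%C *: (a : B)) (at level 40).

(** This is positivity of the spectrum, put as a condition on the norm, which
    makes closure under sums and limits immediate. [positiveP] identifies it
    with being of the form c^* c. *)
Definition psd a : Prop := star a = a /\ exists t, cnorm (t *:r 1 - a) <= t.

Lemma rsc_comm r a : r *:r 1 * a = a * (r *:r 1).
Proof. by rewrite -scalerAl -scalerAr mulr1 mul1r. Qed.

(** The iteration u' = (x + u^2)/2 has the limit 1 - sqrt(1 - x). All its terms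
    are polynomials in x with nonnegative coefficients, so its increments are
    bounded by those of the same iteration started at the real number x = 1. *)
Lemma sqrt_one_sub x : star x = x -> cnorm x <= 1 ->
  exists h, [/\ star h = h, h * h = 1 - x, cnorm (1 - h) <= 1
    & forall z, z * x = x * z -> z * h = h * z].
Proof.
move=> sx x1.
pose u := fix u n : B := if n is n'.+1 then 2^-1 *:r (x + u n' * u n') else 0.
pose r := fix r n : R := if n is n'.+1 then 2^-1 * (1 + r n' * r n') else 0.
have uz n z : z * x = x * z -> z * u n = u n * z.
  move=> zx; elim: n => [|n IH] /=; first by rewrite mulr0 mul0r.
  by rewrite -scalerAr -scalerAl mulrDr mulrDl zx mulrA IH -!mulrA IH.
have uu m n : u m * u n = u n * u m.
  by apply: (uz); symmetry; apply: (uz m x).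
have r01 n : 0 <= r n <= 1.
  elim: n => [|n /andP[r0 r1]] /=; first by rewrite lexx ler01.
  have : r n * r n <= 1 by rewrite mulr_ile1.
  have : 0 <= r n * r n by rewrite mulr_ge0.
  move=> *; apply/andP; lra.
have half : `|2^-1| = 2^-1 :> R by rewrite ger0_norm // invr_ge0.
have ur n : cnorm (u n) <= r n.
  elim: n => [|n IH] /=; first by rewrite cnorm0.
  rewrite cnorm_rsc half ler_wpM2l ?invr_ge0 //.
  apply: le_trans (cnormD _ _) _; apply: lerD => //.
  by apply: le_trans (cnormM _ _) _; apply: ler_pM; rewrite ?cnorm_ge0.
have [y uy] : exists y, cvgs u y.
  apply: (@majorized_cvg _ _ u r 1) => [n|]; first by case/andP: (r01 n).
  elim=> [|n IH] /=.
    rewrite !subr0 !mulr0 !addr0 cnorm_rsc half.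
    by rewrite ler_wpM2l ?invr_ge0.
  rewrite -[2^-1 *:r (x + u n * u n)]/(u n.+1).
  rewrite -[2^-1 * (1 + r n * r n)]/(r n.+1).
  rewrite -scalerBr -mulrBr cnorm_rsc half ler_wpM2l ?invr_ge0 //.
  rewrite opprD addrACA subrr add0r.
  have -> : u n.+1 * u n.+1 - u n * u n = (u n.+1 + u n) * (u n.+1 - u n).
    by rewrite mulrDl !mulrBr (uu n n.+1) addrA subrK.
  apply: le_trans (cnormM _ _) _.
  have -> : 1 + r n.+1 * r n.+1 - (1 + r n * r n) =
    (r n.+1 + r n) * (r n.+1 - r n) by ring.
  apply: ler_pM; rewrite ?cnorm_ge0 //.
  apply: le_trans (cnormD _ _) _; exact: lerD.
have u1 n : cnorm (u n) <= 1 by apply: le_trans (ur n) _; case/andP: (r01 n).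
have E : y = 2^-1 *:r (x + y * y).
  apply: (cvgs_unique (cvgs_S uy)).
  by apply: cvgs_rsc; apply: cvgsD; [exact: cvgs_cst|exact: cvgs_sq].
have su n : star (u n) = u n.
  elim: n => [|n IH] /=; first exact: star0.
  by rewrite star_rsc starD starM IH sx.
have sy : star y = y.
  apply: (cvgs_unique _ uy) => e /(cvgs_star uy) [N HN].
  by exists N => n /HN /=; rewrite su.
exists (1 - y); split.
- by rewrite starB star1 sy.
- have : 2 *:r y = x + y * y by rewrite {1}E rscK ?pnatr_eq0.
  rewrite rsc2 => H; have -> : (1 - y) * (1 - y) = 1 - y - (y - y * y).
    by rewrite mulrBr mulr1 mulrBl mul1r.
  have -> : y * y = y + y - x by rewrite H addrC addrA addNr add0r.
  by rewrite opprB [y + y - x - y]addrAC addrK addrA subrK.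
- by rewrite opprB addrC subrK; apply: cvgs_le uy u1.
move=> z zx; rewrite mulrBr mulrBl mulr1 mul1r; congr (_ - _).
apply: (cvgs_unique (cvgs_mull z uy)) => e /(cvgs_mulr z uy) [N HN].
by exists N => n /HN; rewrite uz.
Qed.

Lemma psd_ge0 a t : cnorm (t *:r 1 - a) <= t -> 0 <= t.
Proof. by apply: le_trans; apply: cnorm_ge0. Qed.

Lemma psdD a b : psd a -> psd b -> psd (a + b).
Proof.
move=> [sa [t Ht]] [sb [s Hs]]; split; first by rewrite starD sa sb.
exists (t + s); rewrite rscDl opprD addrACA.
by apply: le_trans (cnormD _ _) _; apply: lerD.
Qed.

Lemma psdZ r a : 0 <= r -> psd a -> psd (r *:r a).
Proof.
move=> r0 [sa [t Ht]]; split; first by rewrite star_rsc sa.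
by exists (r * t); rewrite -rscA -scalerBr cnorm_rsc ger0_norm // ler_wpM2l.
Qed.

Lemma psd_sub r a : star a = a -> cnorm a <= r -> psd (r *:r 1 - a).
Proof.
move=> sa ar; split; first by rewrite starB star_rsc star1 sa.
by exists r; rewrite opprB addrC subrK.
Qed.

Lemma psd_sqrt a : psd a ->
  exists h, [/\ psd h, h * h = a & forall z, z * a = a * z -> z * h = h * z].
Proof.
move=> [sa [t Ht]]; have := psd_ge0 Ht; rewrite le_eqVlt => /orP[/eqP t0|t0].
  have -> : a = 0.
    apply: cnorm0_eq0; apply/eqP; rewrite eq_le cnorm_ge0 andbT.
    by move: Ht; rewrite -t0 rmorph0 scale0r sub0r cnormN.
  exists 0; split; rewrite ?mul0r //.
  by split; [exact: star0|exists 0; rewrite rmorph0 scale0r subr0 cnorm0].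
have tn0 : t != 0 by rewrite gt_eqF.
pose x := 1 - t^-1 *:r a.
have sx : star x = x by rewrite starB star1 star_rsc sa.
have xE : x = t^-1 *:r (t *:r 1 - a).
  by rewrite scalerBr rscVK.
have x1 : cnorm x <= 1.
  rewrite xE cnorm_rsc gtr0_norm ?invr_gt0 //.
  by rewrite ler_pdivrMl ?mulr1.
have [h [sh hh h1 hz]] := sqrt_one_sub sx x1.
have q0 := sqrtr_ge0 t.
exists (Num.sqrt t *:r h); split.
- by apply: psdZ => //; split=> //; exists 1; rewrite rsc1.
- rewrite -scalerAl -scalerAr rscA -expr2 sqr_sqrtr ?ltW // hh /x opprB.
  by rewrite addrC subrK rscK.
move=> z za; rewrite -scalerAr -scalerAl hz // /x mulrBr mulrBl mulr1 mul1r.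
by rewrite -scalerAr -scalerAl za.
Qed.

Definition im : R[i] := ('i)%C.
Lemma im_sq : im * im = -1.
Proof. by rewrite /im -expr2 sqr_i. Qed.
Lemma star_im a : star (im *: a) = - (im *: star a).
Proof. by rewrite starZ -scaleNr; congr (_ *: _); apply/eqP;
  rewrite eq_complex /= oppr0 !eqxx. Qed.

(** Cartesian decomposition of an element. Both products differ only by the
    sign of the commutator. *)
Lemma star_cart h k : star h = h -> star k = k ->
  star (h + im *: k) * (h + im *: k) = h * h + k * k + im *: (h * k - k * h) /\
  (h + im *: k) * star (h + im *: k) = h * h + k * k - im *: (h * k - k * h).
Proof.
move=> sh sk; rewrite starD star_im sh sk.
set K := im *: k.
have KK : K * K = - (k * k).
  by rewrite /K -scalerAl -scalerAr scalerA im_sq scaleN1r.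
have hK : h * K = im *: (h * k) by rewrite /K -scalerAr.
have Kh : K * h = im *: (k * h) by rewrite /K -scalerAl.
split.
  by rewrite mulrBl !mulrDr opprD KK opprK hK Kh scalerBr (addrC (- _)) addrACA.
by rewrite mulrBr !mulrDl opprD KK opprK hK Kh scalerBr opprB (addrC (- _))
  addrACA.
Qed.

(** For commuting h and k, put v = h + ik: then |v|^2 = |h^2 + k^2|, and h is
    the real part of v. *)
Lemma sq_norm_mono h k : star h = h -> star k = k -> h * k = k * h ->
  cnorm (h * h) <= cnorm (h * h + k * k).
Proof.
move=> sh sk hk; have [E _] := star_cart sh sk.
pose v := h + im *: k.
have Ev : cnorm (h * h + k * k) = cnorm v ^+ 2.
  by rewrite -cnorm_star E hk subrr scaler0 addr0.
rewrite cnorm_sa // Ev; suff : cnorm h <= cnorm v.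
  by move=> H; rewrite ler_pXn2r // nnegrE cnorm_ge0.
have : cnorm (h + h) <= 2 * cnorm v.
  have -> : h + h = v + star v.
    by rewrite /v starD star_im sh sk addrACA subrr addr0.
  by apply: le_trans (cnormD _ _) _; rewrite cnorm_starE; lra.
rewrite -rsc2 cnorm_rsc ger0_norm //; lra.
Qed.

(** Write t - h^2 = k^2 by the square root lemma. Then |k^2| <= |k^2 + h^2| =
    t. *)
Lemma psd_sq h : star h = h ->
  forall t, cnorm (h * h) <= t -> cnorm (t *:r 1 - h * h) <= t.
Proof.
move=> sh t ht; have t0 : 0 <= t by apply: le_trans ht; apply: cnorm_ge0.
have shh : star (h * h) = h * h by rewrite starM sh.
have [k [[sk _] kk kz]] := psd_sqrt (psd_sub shh ht).
rewrite -kk; apply: le_trans (sq_norm_mono sk sh _) _.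
  symmetry; apply: kz; rewrite mulrBr mulrBl rsc_comm mulrA //.
by rewrite kk subrK cnorm_rsc1.
Qed.

Lemma sq_psd h : star h = h -> psd (h * h).
Proof.
move=> sh; split; first by rewrite starM sh.
by exists (cnorm (h * h)); apply: psd_sq.
Qed.

Lemma psd_norm a t : psd a -> cnorm a <= t -> cnorm (t *:r 1 - a) <= t.
Proof. by move=> /psd_sqrt [h [[sh _] <- _]]; apply: psd_sq. Qed.

Lemma psd_normB a t : psd a -> cnorm a <= t -> psd (t *:r 1 - a).
Proof. by move=> [sa _]; apply: psd_sub. Qed.

Lemma psd_mono a b : psd a -> psd b -> a * b = b * a ->
  cnorm a <= cnorm (a + b).
Proof.
move=> /psd_sqrt [h [[sh _] <- hz]] /psd_sqrt [k [[sk _] <- kz]] ab.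
apply: sq_norm_mono => //; apply: kz; symmetry; apply: hz; exact: esym.
Qed.

Lemma psdM a b : psd a -> psd b -> a * b = b * a -> psd (a * b).
Proof.
move=> /psd_sqrt [h [[sh _] <- hz]] /psd_sqrt [k [[sk _] <- kz]] ab.
have hk : h * k = k * h by apply: kz; symmetry; apply: hz; exact: esym.
have -> : h * h * (k * k) = h * k * (h * k).
  by rewrite !mulrA -(mulrA h k h) -hk !mulrA.
by apply: sq_psd; rewrite starM sh sk.
Qed.

(** If d = x + iy, then d d^* = 2 x^2 + 2 y^2 - d^* d is positive as well. On a
    Hilbert space d^* d and d d^* have the same nonzero spectrum, which forces
    d = 0. Without spectra: with w = d d^* of norm L, the relation (L + w) d =
    d (L + d^* d) and |L + d^* d| <= L bound w (L + w)^2 by L^3, and this gives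
    3 w^2 <= L^2. *)
Lemma psd_flip0 d : psd (- (star d * d)) -> d = 0.
Proof.
move=> nd.
pose x := 2^-1 *:r (d + star d); pose y := - (im *: (2^-1 *:r (d - star d))).
have sx : star x = x by rewrite star_rsc starD starK addrC.
have sy : star y = y.
  by rewrite /y starN star_im star_rsc starB starK opprK -scalerN -scalerN
    opprB.
have dE : d = x + im *: y.
  rewrite /y scalerN (scalerA im im) im_sq scaleN1r opprK /x -scalerDr
    [d + _ + _]addrACA subrr addr0.
  by rewrite -rsc2 rscVK ?pnatr_eq0.
pose w := d * star d; pose q := star d * d.
have wE : w = - q + (x * x + y * y + (x * x + y * y)).
  have [E1 E2] := star_cart sx sy; rewrite -dE in E1 E2.
  rewrite /w /q E1 E2; set A := x * x + y * y; set C := im *: _.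
  by rewrite opprD [RHS]addrACA addNr add0r addrC.
have pw : psd w.
  rewrite wE; apply: psdD => //; apply: psdD; apply: psdD; exact: sq_psd.
pose L := cnorm w.
have Lw : L = cnorm d ^+ 2 by rewrite /L /w -{1}[d]starK cnorm_star cnorm_starE.
have Lq : cnorm q = L by rewrite Lw cnorm_star.
have sw : star w = w by case: pw.
have L0 : 0 <= L by apply: cnorm_ge0.
have key : (L *:r 1 + w) * d = d * (L *:r 1 + q).
  by rewrite mulrDl mulrDr rsc_comm /w /q mulrA.
have le1 : cnorm ((L *:r 1 + w) * d) ^+ 2 <= L ^+ 3.
  have : cnorm (d * (L *:r 1 + q)) <= cnorm d * L.
    apply: le_trans (cnormM _ _) _; rewrite ler_wpM2l ?cnorm_ge0 //.
    by have := psd_norm nd (t := L); rewrite opprK cnormN Lq => ->.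
  rewrite key => H; have -> : L ^+ 3 = (cnorm d * L) ^+ 2 by rewrite exprMn -Lw;
    ring.
  by rewrite ler_pXn2r // nnegrE ?mulr_ge0 ?cnorm_ge0.
pose g := L *:r 1 + w.
have sg : star g = g by rewrite starD star_rsc star1 sw.
have wg : w * g = g * w by rewrite mulrDr mulrDl rsc_comm.
have nz : cnorm (g * d) ^+ 2 = cnorm (g * w * g).
  by rewrite -[g * d]starK cnorm_starE -cnorm_star starK starM sg /w !mulrA.
have gwg : g * w * g = (L ^+ 2) *:r w + ((2 * L) *:r (w * w) + w * w * w).
  have -> : g * w = L *:r w + w * w by rewrite mulrDl -scalerAl mul1r.
  rewrite mulrDr -scalerAr mulr1 mulrDl -scalerAl scalerDr rscA -expr2 -!addrA.
  have -> : 2 * L = L + L by ring.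
  by rewrite rscDl !addrA.
have ww : psd (w * w) by apply: sq_psd.
have ww3 : psd (w * w * w) by apply: psdM => //; rewrite mulrA.
have A0 : psd ((L ^+ 3) *:r 1 - g * w * g).
  apply: psd_normB; last by rewrite -nz.
  rewrite gwg; apply: psdD; first by apply: psdZ; rewrite ?exprn_ge0.
  by apply: psdD => //; apply: psdZ; rewrite // mulr_ge0.
have [L0'|Ln0] := eqVneq L 0.
  by apply: cnorm0_eq0; apply/eqP; rewrite -sqrf_eq0 -Lw L0'.
(* w (L + w)^2 <= L^3 and 0 <= w^3 give L^2 w + 2 L w^2 <= L^3. *)
have A1 : psd (L *:r ((L ^+ 2) *:r 1 - (L *:r w + 2 *:r (w * w)))).
  have -> : L *:r ((L ^+ 2) *:r 1 - (L *:r w + 2 *:r (w * w))) =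
     ((L ^+ 3) *:r 1 - g * w * g) + w * w * w; last exact: psdD.
  rewrite gwg !scalerBr scalerDr !rscA (mulrC L 2) -exprS -expr2.
  by rewrite !opprD !addrA subrK.
have A2 : psd ((L ^+ 2) *:r 1 - (L *:r w + 2 *:r (w * w))).
  by rewrite -[X in psd X](rscVK _ Ln0); apply: psdZ; rewrite // invr_ge0.
(* w^2 <= L w replaces L w by w^2. *)
have A3 : psd (L *:r w - w * w).
  have -> : L *:r w - w * w = w * (L *:r 1 - w).
    by rewrite mulrBr -scalerAr mulr1.
  apply: psdM => //; first exact: psd_normB.
  by rewrite mulrBr mulrBl rsc_comm.
have A4 : psd ((L ^+ 2) *:r 1 - 3 *:r (w * w)).
  have -> : (L ^+ 2) *:r 1 - 3 *:r (w * w) =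
    ((L ^+ 2) *:r 1 - (L *:r w + 2 *:r (w * w))) + (L *:r w - w * w).
    have -> : 3 = 1 + 2 :> R by ring.
    rewrite rscDl rsc1 -[RHS]addrA; congr (_ + _).
    by rewrite !opprD addrACA addNr add0r addrC.
  exact: psdD.
have : cnorm (3 *:r (w * w)) <= L ^+ 2.
  have := psd_mono (psdZ (ler0n R 3) ww) A4.
  rewrite [_ + (_ - _)]addrC subrK cnorm_rsc1 ?exprn_ge0 //.
  apply => //.
  by rewrite mulrBr mulrBl rsc_comm.
rewrite cnorm_rsc cnorm_sa // -/L ger0_norm // => H.
have L2 : 0 < L ^+ 2 by rewrite exprn_gt0 // lt_def Ln0.
have : L ^+ 2 <= 0 by lra.
by rewrite leNgt L2.
Qed.

(** Kelley-Vaught: let p = |a| for a = c^* c, and let v = p - a be twice the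
    negative part of a. Then (c v)^* (c v) = v a v = - p v^2 is negative, so c
    v = 0 and v = 0. *)
Lemma psd_star c : psd (star c * c).
Proof.
set a := star c * c.
have sa : star a = a by rewrite starM starK.
have [p [pp pE pz]] := psd_sqrt (sq_psd sa).
have sp : star p = p by case: pp.
have ap : a * p = p * a by apply: pz; rewrite mulrA.
pose v := p - a.
have sv : star v = v by rewrite starB sa sp.
have vp : v * p = p * v by rewrite mulrBl mulrBr ap.
have vv : v * v = p * v + p * v.
  rewrite {1}/v mulrBl; congr (_ + _).
  by rewrite /v !mulrBr -ap -pE opprB.
have av : a * v = - (p * v).
  by rewrite /v !mulrBr -pE opprB ap.
have E : star (c * v) * (c * v) = - (p * (v * v)).
  rewrite starM sv mulrA -(mulrA v) -/a -mulrA av mulrN.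
  by congr (- _); rewrite [LHS]mulrA vp mulrA.
have cv : c * v = 0.
  apply: psd_flip0; rewrite E opprK; apply: psdM => //; first exact: sq_psd.
  by rewrite -mulrA vp !mulrA vp.
have pvv : p * (v * v) = 0.
  by apply/eqP; rewrite -oppr_eq0 -E cv mulr0.
have v4 : v * v * (v * v) = 0.
  by rewrite {1}vv mulrDl -vp -mulrA pvv mulr0 addr0.
have v0 : v = 0.
  apply: cnorm0_eq0; apply/eqP; rewrite -sqrf_eq0 -(sqrf_eq0 (_ ^+ 2)).
  by rewrite -cnorm_sa // -cnorm_sa ?starM ?sv // v4 cnorm0.
by move/eqP: v0; rewrite subr_eq0 => /eqP <-.
Qed.

Lemma positiveP a : positive a <-> psd a.
Proof.
split; first by case=> c ->; apply: psd_star.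
by move=> /psd_sqrt [h [[sh _] <- _]]; exists h; rewrite sh.
Qed.

(** All the perturbed elements satisfy the norm condition with one common
    bound. *)
Lemma psd_closed a d : star d = d -> (forall e, 0 < e -> psd (a + e *:r d)) ->
  psd a.
Proof.
move=> sd H.
have sa : star a = a.
  have [E _] := H 1 ltr01; move: E; rewrite rsc1 starD sd; exact: addIr.
split=> //; exists (cnorm a + cnorm d).
set t := cnorm a + cnorm d.
have bound e : 0 < e <= 1 -> cnorm (t *:r 1 - a) <= t + e * cnorm d.
  case/andP=> e0 e1; have := psd_norm (H e e0) (t := t).
  have : cnorm (a + e *:r d) <= t.
    apply: le_trans (cnormD _ _) _; rewrite lerD2l cnorm_rsc gtr0_norm //.
    by rewrite ler_piMl ?cnorm_ge0.
  move=> le /(_ le) H1; have := cnormD (t *:r 1 - (a + e *:r d)) (e *:r d).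
  have -> : t *:r 1 - (a + e *:r d) + e *:r d = t *:r 1 - a.
    by rewrite opprD addrA subrK.
  rewrite cnorm_rsc gtr0_norm // => *; lra.
apply/ler_addgt0Pr => e e0.
have d1 : 0 < cnorm d + 1 by rewrite ltr_wpDl ?cnorm_ge0.
(* f <= 1 keeps the common bound, and f |d| <= e. *)
pose f := Num.min 1 (e / (cnorm d + 1)).
have f0 : 0 < f by rewrite lt_min ltr01 divr_gt0.
have f1 : f <= 1 by rewrite ge_min lexx.
apply: le_trans (bound f _) _; first by rewrite f0 f1.
rewrite lerD2l.
have : f * (cnorm d + 1) <= e by rewrite -ler_pdivlMr // ge_min lexx orbT.
rewrite mulrDr mulr1; lra.
Qed.

(** The norm condition puts a + e within a distance less than t + e of the
    scalar t + e, so a Neumann series inverts it. The inverse of the root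
    follows. *)
Lemma psd_inv a e : psd a -> 0 < e ->
  exists h hi, [/\ star h = h, h * h = a + e *:r 1, h * hi = 1 & hi * h = 1].
Proof.
move=> [sa [t Ht]] e0; have t0 := psd_ge0 Ht.
have te : 0 < t + e by rewrite ltr_wpDl.
have ten : t + e != 0 by rewrite gt_eqF.
have pae : psd (a + e *:r 1).
  apply: psdD; first by split=> //; exists t.
  split; first by rewrite star_rsc star1.
  by exists e; rewrite subrr cnorm0 ltW.
have [h [[sh _] hh _]] := psd_sqrt pae.
pose x := (t + e)^-1 *:r (t *:r 1 - a).
have x1 : cnorm x < 1.
  rewrite cnorm_rsc gtr0_norm ?invr_gt0 // ltr_pdivrMl // mulr1.
  by apply: le_lt_trans Ht _; rewrite ltrDl.
have xE : 1 - x = (t + e)^-1 *:r (h * h).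
  rewrite hh -[1 in LHS](rscVK _ ten) /x -scalerBr; congr (_ *: _).
  by rewrite rscDl opprB addrC addrA subrK.
have [y [y1 y2]] := neumann x1; rewrite xE in y1 y2.
pose r := h * ((t + e)^-1 *:r y); pose l := ((t + e)^-1 *:r y) * h.
have hr : h * r = 1 by rewrite /r mulrA -scalerAr scalerAl.
have lh : l * h = 1 by rewrite /l -mulrA -scalerAl scalerAr.
exists h, r; split=> //.
by rewrite -[r]mul1r -lh -(mulrA l) hr mulr1.
Qed.

End CStar2.

(** * Positive kernels and Cholesky factorization *)

Section Kernels.
Variables (R : realType) (B : cstarAlgType R).
Implicit Types (a b c d h z : B) (r s t e : R).

Notation "r *:r a" := ((r%:C)%C *: (a : B)) (at level 40).

Lemma psd0 : psd (0 : B).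
Proof. by split; [exact: star0|exists 0; rewrite rmorph0 scale0r subr0 cnorm0].
  Qed.

Lemma psd_sum (I : Type) (l : seq I) (F : I -> B) :
  (forall i, psd (F i)) -> psd (\sum_(i <- l) F i).
Proof. by move=> H; apply: big_ind => //; [exact: psd0|exact: psdD]. Qed.

Definition adj m n (M : 'M[B]_(m, n)) : 'M[B]_(n, m) := (map_mx star M)^T.

Lemma adjM m n p (M : 'M[B]_(m, n)) (N : 'M[B]_(n, p)) :
  adj (M *m N) = adj N *m adj M.
Proof.
apply/matrixP => i j; rewrite !mxE star_sum; apply: eq_bigr => q _.
by rewrite !mxE starM.
Qed.
Lemma adjK m n (M : 'M[B]_(m, n)) : adj (adj M) = M.
Proof. by apply/matrixP => i j; rewrite !mxE starK. Qed.
Lemma adjB m n (M N : 'M[B]_(m, n)) : adj (M - N) = adj M - adj N.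
Proof. by apply/matrixP => i j; rewrite !mxE starD starN. Qed.
Lemma adj_scalar n a : adj (a%:M : 'M[B]_n) = (star a)%:M.
Proof.
apply/matrixP => i j; rewrite !mxE eq_sym; case: eqP => _ //=; exact: star0.
Qed.
Lemma adj0 m n : adj (0 : 'M[B]_(m, n)) = 0.
Proof. by apply/matrixP => i j; rewrite !mxE star0. Qed.
Lemma adj_block m n p q (M : 'M[B]_(m, p)) (N : 'M[B]_(m, q)) (P : 'M[B]_(n, p))
  (Q : 'M[B]_(n, q)) :
  adj (block_mx M N P Q) = block_mx (adj M) (adj P) (adj N) (adj Q).
Proof. by rewrite /adj map_block_mx tr_block_mx. Qed.
Lemma adj_col m n p (M : 'M[B]_(m, p)) (N : 'M[B]_(n, p)) :
  adj (col_mx M N) = row_mx (adj M) (adj N).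
Proof. by rewrite /adj map_col_mx tr_col_mx. Qed.

(** Peel off the first row and column. The pivot is bounded below by e, hence
    invertible with an invertible root; the Schur complement inherits the lower
    bound, as one sees by inserting the vector x that minimizes the form. *)
Lemma cholesky n (A : 'M[B]_n) e : 0 < e -> adj A = A ->
  (forall c : 'cV[B]_n, psd ((adj c *m A *m c) 0 0 - e *:r (adj c *m c) 0 0)) ->
  exists C : 'M[B]_n, A = adj C *m C.
Proof.
move=> e0; elim: n A => [|n IH] A hA Apos.
  by exists 0; apply/matrixP => -[].
pose A' : 'M[B]_(1 + n) := A.
pose a := A 0 0; pose w := ursubmx A'; pose D := drsubmx A'.
have hAE i j : star (A i j) = A j i by rewrite -[in RHS]hA !mxE.
have AE : A' = block_mx a%:M w (adj w) D.
  rewrite -[LHS](@submxK _ 1 n 1 n A'); congr block_mx => //.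
    by apply/matrixP => i j; rewrite !mxE !ord1 /= mulr1n; congr (A _ _);
      apply/val_inj.
  by apply/matrixP => i j; rewrite !mxE hAE.
have hD : adj D = D.
  by apply/matrixP => i j; rewrite !mxE hAE.
have quad (x : 'cV[B]_1) (c : 'cV[B]_n) :
   psd ((adj x *m a%:M *m x + adj x *m w *m c + adj c *m adj w *m x +
     adj c *m D *m c) 0 0
     - e *:r ((adj x *m x + adj c *m c) 0 0)).
  have Apos' (v : 'cV[B]_(1 + n)) :
    psd ((adj v *m A' *m v) 0 0 - e *:r (adj v *m v) 0 0) := Apos v.
  have := Apos' (col_mx x c); rewrite {1}AE adj_col mul_row_block !mul_row_col.
  by rewrite !mulmxDl addrACA !addrA.
have a_pos : psd (a - e *:r 1).
  have := quad 1%:M 0.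
  by rewrite adj0 !mulmx0 !mul0mx !addr0 adj_scalar star1 !mulmx1 !mul1mx !mxE
    /= mulr1n.
have [h [hi [sh hh hhi hih]]] := psd_inv a_pos e0.
rewrite subrK in hh.
have shi : star hi = hi.
  have : star hi * h = 1 by rewrite -{1}sh -starM hhi star1.
  by move=> E; rewrite -[star hi]mulr1 -hhi mulrA E mul1r.
pose ai := hi * hi.
have a_ai : a * ai = 1 by rewrite -hh /ai mulrA -(mulrA h) hhi mulr1.
have ai_a : ai * a = 1 by rewrite -hh /ai mulrA -(mulrA hi) hih mulr1.
have sai : star ai = ai by rewrite starM shi.
pose S := D - adj w *m ai%:M *m w.
have hS : adj S = S.
  by rewrite adjB hD !adjM adjK adj_scalar sai mulmxA.
have [C HC] : exists C : 'M[B]_n, S = adj C *m C.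
  apply: IH => // c.
  (* x = - a^{-1} w c minimizes the form on the first coordinate. *)
  pose x : 'cV[B]_1 := - (ai%:M *m w *m c).
  have ax : a%:M *m x = - (w *m c).
    by rewrite mulmxN !mulmxA -scalar_mxM a_ai mul1mx.
  have := quad x c.
  rewrite -(mulmxA _ (a%:M)) ax mulmxN mulmxA addNr add0r.
  have -> : adj c *m adj w *m x = - (adj c *m (adj w *m ai%:M *m w) *m c).
    by rewrite /x mulmxN !mulmxA.
  rewrite [- _ + _]addrC -mulNmx -mulmxN -mulmxDl -mulmxDr => H.
  have -> : (adj c *m S *m c) 0 0 - e *:r (adj c *m c) 0 0 =
     ((adj c *m (D - adj w *m ai%:M *m w) *m c) 0 0 - e *:r
       (adj x *m x + adj c *m c) 0 0)
      + e *:r ((adj x *m x) 0 0).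
    rewrite -/S [(adj x *m x + adj c *m c) 0 0]mxE scalerDr.
    by rewrite opprD addrA [RHS]addrAC subrK.
  apply: psdD => //; apply: psdZ; first exact: ltW.
  by rewrite mxE big_ord1 !mxE; apply: psd_star.
exists (block_mx h%:M (hi%:M *m w) 0 C : 'M_(1 + n)).
rewrite -[LHS]/A' AE; set Z := block_mx h%:M _ _ _.
rewrite -[RHS]/(adj Z *m Z) {}/Z.
rewrite adj_block mulmx_block adj0 !mulmx0 !mul0mx !addr0.
rewrite adjM !adj_scalar sh shi -!mulmxA !(mulmxA h%:M) !(mulmxA hi%:M)
  -!scalar_mxM hh hhi hih !mul1mx mulmx1.
by rewrite -HC /S addrC !mulmxA subrK.
Qed.

Section Posker.
Variables (T : Type) (D : pred T) (k : T -> T -> B).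

(** The coefficients on both sides make this complete positivity of k: each
    matrix of values of k is positive. *)
Definition posker : Prop := forall l : seq (T * B), all (fun p => D p.1) l ->
  psd (\sum_(p <- l) \sum_(q <- l) star p.2 * k p.1 q.1 * q.2).

(** Polarization: a + b and i(a - b) are both self-adjoint. *)
Lemma herm_polar a b : star (a + b) = a + b ->
  star (im R *: a - im R *: b) = im R *: a - im R *: b -> star b = a.
Proof.
rewrite starD starB !star_im opprK => H1 H2.
have H3 : star b - star a = a - b.
  have /(congr1 (fun z => im R *: z)) : im R *: (star b - star a) = im R *:
    (a - b).
    by rewrite !scalerBr addrC.
  by rewrite !scalerA im_sq !scaleN1r => /oppr_inj.
have : 2 *:r star b = 2 *:r a.
  have E : star b + star b = (star a + star b) + (star b - star a).
    by rewrite [star a + _]addrC addrACA subrr addr0.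
  by rewrite !rsc2 E H1 H3 addrACA subrr addr0.
by move/(congr1 (fun z => 2^-1 *:r z)); rewrite !rscVK ?pnatr_eq0.
Qed.

Lemma posker_herm : posker -> forall x y, D x -> D y -> star (k x y) = k y x.
Proof.
move=> kp x y Dx Dy.
have sxx u : D u -> star (k u u) = k u u.
  move=> Du; have /= := kp [:: (u, 1)]; rewrite Du => /(_ isT) [+ _].
  by rewrite !big_seq1 star1 mul1r mulr1.
have H b : star (star b * k y x + k x y * b) = star b * k y x + k x y * b.
  have /= := kp [:: (x, 1); (y, b)]; rewrite Dx Dy => /(_ isT) [+ _].
  rewrite !big_cons !big_nil !addr0 /= star1 !mul1r !mulr1.
  have syy : star (star b * k y y * b) = star b * k y y * b.
    by rewrite !starM starK sxx // mulrA.
  set U := star b * k y y * b in syy *.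
  have -> : k x x + k x y * b + (star b * k y x + U) =
      (star b * k y x + k x y * b) + (k x x + U).
    by rewrite [k x x + _]addrC addrACA [k x y * b + _]addrC.
  by rewrite starD [star (k x x + U)]starD sxx // syy; apply: addIr.
have := H 1; have := H (- (im R *: 1)).
rewrite starN !star_im opprK star1 !mul1r mulr1 mulrN -!scalerAl mul1r -scalerAr
  mulr1.
by move=> H2 H1; apply: herm_polar.
Qed.

Lemma posker_family n (x : 'I_n -> T) (c : 'I_n -> B) :
  posker -> (forall i, D (x i)) ->
  psd (\sum_i \sum_j star (c i) * k (x i) (x j) * c j).
Proof.
move=> kp Dx.
have := kp [seq (x i, c i) | i <- enum 'I_n];
  rewrite all_map big_map big_enum /=.
have -> : all (preim (fun i => (x i, c i)) (fun p => D p.1)) (enum 'I_n).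
  by apply/allP => i _ /=.
move=> /(_ isT); congr psd; apply: eq_bigr => i _.
by rewrite big_map big_enum.
Qed.

Lemma posker_factor n (x : 'I_n -> T) e : posker -> (forall i, D (x i)) ->
  0 < e ->
  exists C : 'M[B]_n, forall i j,
    k (x i) (x j) + (i == j)%:R * (e *:r 1) = \sum_p star (C p i) * C p j.
Proof.
move=> kp Dx e0.
pose A : 'M[B]_n := \matrix_(i, j) (k (x i) (x j) + (i == j)%:R * (e *:r 1)).
have [||C AC] := @cholesky _ A e e0.
- apply/matrixP => i j; rewrite !mxE starD (posker_herm kp) // eq_sym.
  by case: eqP; rewrite ?mul0r ?mul1r ?star_rsc ?star0 ?star1.
- move=> c; have := posker_family (fun i => c i 0) kp Dx.
  congr psd.
  have -> : (adj c *m A *m c) 0 0 = \sum_i \sum_j star (c i 0) * A i j * c j 0.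
    rewrite mxE exchange_big; apply: eq_bigr => j _; rewrite mxE mulr_suml.
    by apply: eq_bigr => i _; rewrite !mxE.
  have -> : e *:r (adj c *m c) 0 0 =
      \sum_i \sum_j star (c i 0) * ((i == j)%:R * (e *:r 1)) * c j 0.
    rewrite mxE scaler_sumr; apply: eq_bigr => i _;
      rewrite (bigD1 i) //= eqxx mul1r.
    rewrite big1 ?addr0 => [|j ji]; last by rewrite eq_sym (negPf ji) mul0r
      mulr0 mul0r.
    by rewrite !mxE -scalerAr mulr1 scalerAl.
  rewrite -sumrB; apply: eq_bigr => i _; rewrite -sumrB; apply: eq_bigr => j _.
  by rewrite mxE mulrDr mulrDl addrK.
exists C => i j; have := congr1 (fun M : 'M_ _ => M i j) AC; rewrite !mxE => ->.
by apply: eq_bigr => p _; rewrite !mxE.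
Qed.

End Posker.

(** Factorizations exist only after adding a multiple e of the identity. Its
    contribution is e times a fixed self-adjoint element, so it can be removed
    by closedness of the cone. *)
Lemma psd_perturb n (G : 'I_n -> 'I_n -> B -> B) (A : 'I_n -> 'I_n -> B) :
  (forall i j (r : R) a b, G i j (a + r *:r b) = G i j a + r *:r G i j b) ->
  star (\sum_i G i i 1) = \sum_i G i i 1 ->
  (forall e, 0 < e -> psd
    (\sum_i \sum_j G i j (A i j + (i == j)%:R * (e *:r 1)))) ->
  psd (\sum_i \sum_j G i j (A i j)).
Proof.
move=> GD Gsa H; apply: (psd_closed Gsa) => e e0.
have := H e e0; congr psd; rewrite scaler_sumr -big_split /=; apply:
  eq_bigr => i _.
rewrite (bigD1 i) //= [in RHS](bigD1 i) //= eqxx mul1r GD addrAC; congr (_ + _).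
by apply: eq_bigr => j ji; rewrite eq_sym (negPf ji) mul0r addr0.
Qed.

(** Complete positivity of alpha concerns matrices of the form C^* C. The
    matrices of a positive kernel take this form after the perturbation. *)
Lemma posker_comp_cp (T : Type) (D : pred T) (k : T -> T -> B)
  (alpha : {linear B -> B}) :
  completely_positive alpha -> posker D k ->
    posker D (fun x y => alpha (k x y)).
Proof.
move=> acp kp l Dl; rewrite big_tnth.
under eq_bigr do rewrite big_tnth.
set t := tnth (in_tuple l).
have Dx i : D (t i).1 by move: Dl;
  rewrite -[l]/(val (in_tuple l)) => /all_tnthP; apply.
pose G i j a := star (t i).2 * alpha a * (t j).2.
have sa1 : star (alpha 1) = alpha 1.
  have := acp 1%N 1%:M; case=> [|C /matrixP /(_ 0 0)].
    by exists 1%:M; apply/matrixP => i j;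
      rewrite mulmx1 /mxstar !mxE !ord1 eqxx star1.
  by rewrite !mxE big_ord1 !mxE eqxx => ->; rewrite starM starK.
apply: (@psd_perturb _ G (fun i j => k (t i).1 (t j).1)).
- by move=> i j r a b; rewrite /G linearD linearZ mulrDr mulrDl -scalerAr
  -scalerAl.
- by rewrite star_sum; apply: eq_bigr => i _; rewrite !starM starK sa1 mulrA.
move=> e e0; have [C HC] := posker_factor kp Dx e0.
have [|E /matrixP HE] := acp _
  (\matrix_(i, j) (k (t i).1 (t j).1 + (i == j)%:R * (e *:r 1))).
  by exists C; apply/matrixP => i j; rewrite !mxE HC; apply: eq_bigr => p _;
    rewrite !mxE.
have -> : \sum_i \sum_j G i j (k (t i).1 (t j).1 + (i == j)%:R * (e *:r 1)) =
  \sum_p star (\sum_i E p i * (t i).2) * (\sum_i E p i * (t i).2).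
  under [RHS]eq_bigr do rewrite star_sum mulr_suml.
  rewrite [RHS]exchange_big; apply: eq_bigr => i _ /=.
  under [RHS]eq_bigr do rewrite mulr_sumr.
  rewrite [RHS]exchange_big; apply: eq_bigr => j _ /=.
  have := HE i j; rewrite /G !mxE => ->; rewrite mulr_sumr mulr_suml.
  by apply: eq_bigr => p _; rewrite !mxE starM !mulrA.
by apply: psd_sum => p; apply: psd_star.
Qed.

(** Insert a positive kernel k in the middle of another one, as in the inner
    tensor product of two Hilbert modules. If (k x_i x_j) = C^* C, then the new
    kernel is a sum over the rows of C of the outer kernel at rescaled vectors.
    *)
Lemma posker_mid (T Y : Type) (D : pred T) (k : T -> T -> B)
   (K : Y -> B -> Y -> B) (act : B -> Y -> Y) :
  (forall y y' (r : R) a b, K y (a + r *:r b) y' = K y a y' + r *:r K y b y') ->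
  (forall y y' a b, K y (star a * b) y' = K (act a y) 1 (act b y')) ->
  posker predT (fun y y' => K y 1 y') ->
  posker D k ->
  posker (fun p : T * Y => D p.1) (fun p q => K p.2 (k p.1 q.1) q.2).
Proof.
move=> KD Kact Kp kp l Dl; rewrite big_tnth.
under eq_bigr do rewrite big_tnth.
set t := tnth (in_tuple l).
have Dx i : D (t i).1.1 by move: Dl;
  rewrite -[l]/(val (in_tuple l)) => /all_tnthP; apply.
pose G i j a := star (t i).2 * K (t i).1.2 a (t j).1.2 * (t j).2.
apply: (@psd_perturb _ G (fun i j => k (t i).1.1 (t j).1.1)).
- by move=> i j r a b; rewrite /G KD mulrDr mulrDl -scalerAr -scalerAl.
- by rewrite star_sum; apply: eq_bigr => i _;
  rewrite !starM starK (posker_herm Kp) // mulrA.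
move=> e e0; have [C HC] := posker_factor kp Dx e0.
have -> : \sum_i \sum_j G i j (k (t i).1.1 (t j).1.1 + (i == j)%:R * (e *:r 1))
  =
  \sum_p \sum_i \sum_j star (t i).2 *
     K (act (C p i) (t i).1.2) 1 (act (C p j) (t j).1.2) * (t j).2.
  rewrite [RHS]exchange_big; apply: eq_bigr => i _ /=.
  rewrite [RHS]exchange_big; apply: eq_bigr => j _ /=.
  rewrite /G HC.
  have K0 : K (t i).1.2 0 (t j).1.2 = 0.
    have := KD (t i).1.2 (t j).1.2 (-1) 0 0.
    by rewrite rmorphN1 !scaleN1r subr0 subrr.
  have KS (F : 'I_(size l) -> B) :
     K (t i).1.2 (\sum_p F p) (t j).1.2 = \sum_p K (t i).1.2 (F p) (t j).1.2.
    apply: (big_morph (fun a => K (t i).1.2 a (t j).1.2)) => // a b.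
    by have := KD (t i).1.2 (t j).1.2 1 a b; rewrite !rsc1.
  rewrite KS mulr_sumr mulr_suml; apply: eq_bigr => p _; by rewrite Kact.
apply: psd_sum => p.
exact: (posker_family (x := fun i => act (C p i) (t i).1.2) (fun i => (t i).2)
  Kp).
Qed.

End Kernels.

(** * Splittings and fillings of words *)

Section Splits.
Variables (T : Type) (V : zmodType).
Implicit Types (Phi Psi : seq T -> seq T -> V) (w u v : seq T).

(** Recursive in w, so that splittings are handled without index arithmetic. *)
Fixpoint split_sum Phi w : V :=
  Phi [::] w + (if w is a :: w' then split_sum (fun u v => Phi (a :: u) v) w'
    else 0).

Lemma split_sum_cons Phi a w :
  split_sum Phi (a :: w) = Phi [::] (a :: w) +
    split_sum (fun u v => Phi (a :: u) v) w.
Proof. by []. Qed.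

Lemma eq_split_sum_in Phi Psi w :
  (forall u v, w = u ++ v -> Phi u v = Psi u v) -> split_sum Phi w =
    split_sum Psi w.
Proof.
elim: w Phi Psi => [|a w IH] Phi Psi H /=; rewrite H //; congr (_ + _).
by apply: IH => u v E; apply: H; rewrite E.
Qed.

Lemma eq_split_sum Phi Psi w : (forall u v, Phi u v = Psi u v) ->
  split_sum Phi w = split_sum Psi w.
Proof. by move=> H; apply: eq_split_sum_in. Qed.

Lemma split_sum0 w : split_sum (fun _ _ => 0) w = 0.
Proof. by elim: w => [|a w IH] /=; rewrite ?IH addr0. Qed.

Lemma split_sumD Phi Psi w :
  split_sum (fun u v => Phi u v + Psi u v) w = split_sum Phi w +
    split_sum Psi w.
Proof.
elim: w Phi Psi => [|a w IH] Phi Psi /=; first by rewrite !addr0.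
by rewrite IH addrACA.
Qed.

End Splits.

Lemma raddf_split_sum (T : Type) (V W : zmodType) (f : V -> W)
    (Phi : seq T -> seq T -> V) (w : seq T) :
  f 0 = 0 -> (forall x y, f (x + y) = f x + f y) ->
  f (split_sum Phi w) = split_sum (fun u v => f (Phi u v)) w.
Proof.
move=> f0 fD; elim: w Phi => [|a w IH] Phi /=; rewrite fD ?f0 //.
by rewrite IH.
Qed.

Section Splits2.
Variables (T : Type) (V : zmodType).
Implicit Types (w u v : seq T).

(** Both sides sum over the splittings of w in three parts. *)
Lemma split_sumA (Phi : seq T -> seq T -> seq T -> V) w :
  split_sum (fun u r => split_sum (fun v z => Phi u v z) r) w =
  split_sum (fun r z => split_sum (fun u v => Phi u v z) r) w.
Proof.
elim: w Phi => [//|a w IH] Phi /=.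
by rewrite IH split_sumD addrA addr0.
Qed.

Lemma split_sum_rcons (Phi : seq T -> seq T -> V) w x :
  split_sum Phi (rcons w x) = split_sum (fun u v => Phi u (rcons v x)) w +
    Phi (rcons w x) [::].
Proof.
elim: w Phi => [|a w IH] Phi /=; first by rewrite !addr0.
by rewrite IH addrA.
Qed.

End Splits2.

Section Subst.
Variables (K : fieldType) (A : algType K).
Implicit Types (f g n : seq A -> A) (w u v : seq A).

Definition conv f g w : A := split_sum (fun u v => f u * g v) w.
(** With convolution as product of series, this is left multiplication by the
    series that is the identity on one-letter words and 0 elsewhere. *)
Definition lmulX g w : A := if w is b :: v then b * g v else 0.
Definition empty_word w : A := if w is [::] then 1 else 0.

Lemma conv_empty_wordl f w : conv empty_word f w = f w.
Proof.
case: w => [|a w]; rewrite /conv /= mul1r ?addr0 //.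
by rewrite (eq_split_sum _ (Psi := fun _ _ => 0)) ?split_sum0 ?addr0 // => u v;
  rewrite mul0r.
Qed.

Lemma convA f g h w : conv f (conv g h) w = conv (conv f g) h w.
Proof.
rewrite /conv; transitivity
  (split_sum (fun u r => split_sum (fun v z => f u * (g v * h z)) r) w).
  apply: eq_split_sum => u r.
  by rewrite (raddf_split_sum (f := fun x => f u * x)) ?mulr0 // => x y;
    rewrite mulrDr.
rewrite split_sumA; apply: eq_split_sum => r z.
rewrite (raddf_split_sum (f := fun x => x * h z)) ?mul0r // => [|x y];
  last by rewrite mulrDl.
by apply: eq_split_sum => u v; rewrite mulrA.
Qed.

Lemma convDl f f' g w : conv (fun u => f u + f' u) g w = conv f g w +
  conv f' g w.
Proof. by rewrite /conv -split_sumD; apply: eq_split_sum => u v;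
  rewrite mulrDl. Qed.

Lemma lmulX_conv f g w : conv (lmulX f) g w = lmulX (conv f g) w.
Proof.
case: w => [|a w]; rewrite /conv /= mul0r ?addr0 // add0r.
rewrite (raddf_split_sum (f := fun x => a * x)) ?mulr0 // => [|x y];
  last by rewrite mulrDr.
by apply: eq_split_sum => u v; rewrite mulrA.
Qed.

Variable V : zmodType.
Implicit Types F G : seq A -> V.

(** The letter a was read last, and the letters after it up to the current
    position belong to the word that follows it; c is f with these letters
    already fed in. *)
Fixpoint fill_cons F a (c f : seq A -> A) w {struct w} : V :=
  if w is b :: w' then fill_cons F a (fun u => c (b :: u)) f w'
       + fill_cons (fun s => F (a * c [::] :: s)) b f f w'
  else F [:: a * c [::]].

(** The sum of F [:: a1 * f u1; ...; ak * f uk] over all the ways to write the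
    word as a1 :: u1 ++ ... ++ ak :: uk, that is, F composed with the series b
    f(b). *)
Definition fill F f w : V :=
  if w is a :: w' then fill_cons F a f f w' else F [::].

Lemma fill_consE F a c f w : fill_cons F a c f w =
  split_sum (fun u v => fill (fun s => F (a * c u :: s)) f v) w.
Proof.
elim: w F a c => [|b w IH] F a c /=; first by rewrite addr0.
by rewrite IH addrC.
Qed.

(** Sorting by the word u that follows the first letter. *)
Lemma fill_consS F f a w : fill F f (a :: w) =
  split_sum (fun u v => fill (fun s => F (a * f u :: s)) f v) w.
Proof. exact: fill_consE. Qed.

Lemma seq_size_ind (P : seq A -> Prop) :
  (forall w, (forall v, (size v < size w)%N -> P v) -> P w) -> forall w, P w.
Proof.
move=> H w; have [n] := ubnP (size w); elim: n w => [//|n IH] w wn.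
by apply: H => v vw; apply: IH; apply: leq_trans vw _.
Qed.

Lemma eq_fill F G f g w : (forall s, F s = G s) ->
  (forall u, (size u < size w)%N -> f u = g u) -> fill F f w = fill G g w.
Proof.
elim/seq_size_ind: w F G => -[//|a w] IH F G FG fg; first exact: FG.
rewrite !fill_consS; apply: eq_split_sum_in => u v E.
have [uw vw] : (size u <= size w /\ size v <= size w)%N.
  by rewrite E size_cat leq_addr leq_addl.
apply: IH => [|s|x xv]; rewrite ?ltnS // ?FG ?fg ?ltnS //.
by apply: leq_trans vw; rewrite ltnW // ltnS.
Qed.

Lemma fillD F G g w :
  fill (fun s => F s + G s) g w = fill F g w + fill G g w.
Proof.
elim/seq_size_ind: w F G => -[//|a w] IH F G.
rewrite !fill_consS -split_sumD; apply: eq_split_sum_in => u v E.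
by rewrite IH // E /= ltnS size_cat leq_addl.
Qed.

Lemma fill0 g w : fill (fun _ => 0 : V) g w = 0.
Proof.
elim/seq_size_ind: w => -[//|a w] IH.
rewrite fill_consS (eq_split_sum_in (Psi := fun _ _ => 0)) ?split_sum0 // => u v
  E.
by rewrite IH // E /= ltnS size_cat leq_addl.
Qed.

(** Filling a word filled beforehand by a two-part expression splits the outer
    word too, so filling distributes over splittings and over products of
    series. *)
Lemma fill_split_sum (Phi : seq A -> seq A -> V) g w :
  fill (fun s => split_sum Phi s) g w =
  split_sum (fun v1 v2 => fill (fun s1 => fill (Phi s1) g v2) g v1) w.
Proof.
elim/seq_size_ind: w Phi => -[|a w] IH Phi; first by rewrite /= addr0.
rewrite fill_consS [RHS]/= -/(fill (Phi [::]) g (a :: w)) fill_consS.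
under [X in _ = _ + X]eq_split_sum => p v2 do
  rewrite -/(fill (fun s1 => fill (Phi s1) g v2) g (a :: p)) fill_consS.
rewrite -split_sumA -split_sumD; apply: eq_split_sum_in => u v E.
by rewrite -IH ?fillD // E /= ltnS size_cat leq_addl.
Qed.

End Subst.

Section SubstAlg.
Variables (K : fieldType) (A : algType K).
Implicit Types (f g m : seq A -> A) (w u v : seq A).

Lemma raddf_fill (V W : zmodType) (L : V -> W) (F : seq A -> V) g w :
  L 0 = 0 -> (forall x y, L (x + y) = L x + L y) ->
  L (fill F g w) = fill (fun s => L (F s)) g w.
Proof.
move=> L0 LD; elim/seq_size_ind: w F => -[//|a w] IH F.
rewrite !fill_consS raddf_split_sum //; apply: eq_split_sum_in => u v E.
by rewrite IH // E /= ltnS size_cat leq_addl.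
Qed.

Lemma fill_mull (a : A) f g w : fill (fun s => a * f s) g w = a * fill f g w.
Proof. by rewrite (raddf_fill (L := fun x => a * x)) ?mulr0 // => x y;
  rewrite mulrDr. Qed.
Lemma fill_mulr (a : A) f g w : fill (fun s => f s * a) g w = fill f g w * a.
Proof. by rewrite (raddf_fill (L := fun x => x * a)) ?mul0r // => x y;
  rewrite mulrDl. Qed.

Lemma fill_conv f h g w :
  fill (conv f h) g w = conv (fill f g) (fill h g) w.
Proof.
rewrite /conv fill_split_sum; apply: eq_split_sum => v1 v2.
rewrite -fill_mulr; apply: eq_fill => // s.
by rewrite fill_mull.
Qed.

Lemma fill_lmulX f g w : fill (lmulX f) g w = lmulX (conv g (fill f g)) w.
Proof.
case: w => [//|a w]; rewrite fill_consS /=.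
rewrite [RHS](raddf_split_sum (f := fun x => a * x)) ?mulr0 // => [|x y];
  last by rewrite mulrDr.
by apply: eq_split_sum => u v; rewrite fill_mull mulrA.
Qed.

Lemma fill_empty_word g w : fill (@empty_word K A) g w = empty_word w.
Proof.
case: w => [//|a w]; rewrite fill_consS /=.
by rewrite (eq_split_sum _ (Psi := fun _ _ => 0)) ?split_sum0 // => u v;
  rewrite fill0.
Qed.

Definition madditive (V : zmodType) (F : seq A -> V) : Prop :=
  forall u v a b, F (u ++ (a + b) :: v) = F (u ++ a :: v) + F (u ++ b :: v).

Lemma madditive0 (V : zmodType) (F : seq A -> V) u v : madditive F ->
  F (u ++ 0 :: v) = 0.
Proof.
move=> FD; have := FD u v 0 0; rewrite addr0 => /eqP.
by rewrite -[X in X == _]addr0 (inj_eq (addrI _)) eq_sym => /eqP.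
Qed.

Lemma madditive_cons (V : zmodType) (F : seq A -> V) x :
  madditive F -> madditive (fun s => F (x :: s)).
Proof. by move=> FD u v a b; apply: (FD (x :: u)). Qed.

(** Substitution is associative: b f(b) at b g(b) is b g(b) f[g](b). *)
Lemma fillA (V : zmodType) (F : seq A -> V) f g w : madditive F ->
  fill (fill F f) g w = fill F (conv g (fill f g)) w.
Proof.
elim/seq_size_ind: w F => -[//|a w] IH F FD.
set h := conv g (fill f g).
rewrite !fill_consS.
pose L v2 z := fill (fun s => F (a * z :: s)) h v2.
have L0 v2 : L v2 0 = 0.
  rewrite /L -[RHS](fill0 V h v2); apply: eq_fill => // s.
  by rewrite mulr0; apply: (madditive0 [::]).
have LD v2 x y : L v2 (x + y) = L v2 x + L v2 y.
  rewrite /L -fillD; apply: eq_fill => // s; rewrite mulrDr; exact: (FD [::]).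
transitivity (split_sum
  (fun u v => split_sum (fun v1 v2 => L v2 (g u * fill f g v1)) v) w).
  apply: eq_split_sum_in => u v E.
  have vw : (size v <= size w)%N by rewrite E size_cat leq_addl.
  transitivity (fill (fun s => split_sum (fun s1 s2 =>
     fill (fun s' => F (a * g u * f s1 :: s')) f s2) s) g v).
    by apply: eq_fill => // s; rewrite fill_consS.
  rewrite fill_split_sum; apply: eq_split_sum_in => v1 v2 E2.
  have v2w : (size v2 <= size w)%N by apply: leq_trans vw;
    rewrite E2 size_cat leq_addl.
  rewrite (raddf_fill (L := fun z => L v2 (g u * z))) ?mulr0 ?L0 //; last first.
    by move=> x y; rewrite mulrDr LD.
  apply: eq_fill => // s1; rewrite IH ?ltnS //; last exact: madditive_cons.
  by apply: eq_fill => // s; rewrite mulrA.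
rewrite split_sumA; apply: eq_split_sum => p v2.
rewrite -[RHS]/(L v2 (h p)) /h /conv (raddf_split_sum (f := L v2)) //.
Qed.

(** The defining relation of Boolean cumulants, for m as in [word_moment]. *)
Definition boolean_series (e m : seq A -> A) : Prop :=
  forall w, m w = empty_word w + conv e (lmulX m) w.

Lemma conv_lmulX_eq e e' m m' w :
  (forall u, (size u < size w)%N -> e u = e' u) ->
  (forall u, (size u < size w)%N -> m u = m' u) ->
  conv e (lmulX m) w = conv e' (lmulX m') w.
Proof.
move=> Ee Em; apply: eq_split_sum_in => u [|b v] E /=; first by rewrite !mulr0.
have [su sv] : (size u < size w)%N /\ (size v < size w)%N.
  by rewrite E size_cat /= addnS !ltnS leq_addr leq_addl.
by rewrite Ee ?Em.
Qed.

(** On the word w followed by 1, the relation expresses e w through m and the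
    values of e on shorter words. *)
Lemma boolean_series_unique e e' m :
  boolean_series e m -> boolean_series e' m -> forall w, e w = e' w.
Proof.
move=> em em'; elim/seq_size_ind=> w IH.
have m0 : m [::] = 1 by rewrite em /conv /= mulr0 !addr0.
have := em (rcons w 1); rewrite em' /conv !split_sum_rcons /= !mulr0 !addr0.
move/addrI; case/lastP: w IH => [|w x] IH.
  by rewrite /= !addr0 !mul1r m0 !mulr1.
rewrite !split_sum_rcons /= !m0 !mulr1.
rewrite (eq_split_sum_in
  (Psi := fun u v => e u * lmulX m (rcons (rcons v x) 1))).
  by move/addrI.
by move=> u v E; rewrite IH // E size_rcons ltnS size_cat leq_addr.
Qed.

(** The value of G at w involves p at shorter words only, and p at w involves G
    and p at shorter words only. *)
Lemma fill_system_unique (F : seq A -> A) (c : A -> A) G p G' p' :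
  (forall w, G w = fill F p w) -> boolean_series (fun w => c (G w)) p ->
  (forall w, G' w = fill F p' w) -> boolean_series (fun w => c (G' w)) p' ->
  forall w, G w = G' w.
Proof.
move=> GE pE GE' pE'; suff H : forall w, p w = p' w /\ G w = G' w by move=> w;
  case: (H w).
elim/seq_size_ind=> w IH; split.
  rewrite pE pE'; congr (_ + _); apply: conv_lmulX_eq => u uw.
    by case: (IH u uw) => _ ->.
  by case: (IH u uw).
by rewrite GE GE'; apply: eq_fill => // u uw; case: (IH u uw).
Qed.

(** In terms of formal inverses, a series p solves p = 1 + c X p iff (X p)^{-1}
    = X^{-1} - c. Substituting one solution in another adds the series c. Here
    p is the product of m' and of m filled by m'. *)
Lemma fill_semigroup (F : seq A -> A) (alpha beta : {additive A -> A})
    Fa m G m' : madditive F ->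
  (forall w, Fa w = fill F m w) -> boolean_series (fun w => alpha (Fa w)) m ->
  (forall w, G w = fill Fa m' w) -> boolean_series (fun w => beta (G w)) m' ->
  exists p, (forall w, G w = fill F p w) /\
    boolean_series (fun w => alpha (G w) + beta (G w)) p.
Proof.
move=> FD FaE mE GE m'E; pose q := fill m m'.
(* q stands for m filled by m', which solves q = 1 + (alpha o G) X m' q. *)
exists (conv m' q).
have GE' w : G w = fill F (conv m' q) w.
  by rewrite GE -fillA //; apply: eq_fill.
split=> // w.
have qE v : q v = empty_word v + conv (fun u => alpha (G u)) (lmulX (conv m' q))
  v.
  rewrite /q (eq_fill (G := fun s => empty_word s +
    conv (fun u => alpha (Fa u)) (lmulX m) s) (g := m')) //.
  rewrite fillD fill_empty_word fill_conv; congr (_ + _); apply: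
    eq_split_sum => u r.
  rewrite fill_lmulX -[in LHS](raddf_fill (L := alpha)) ?raddf0 //; last exact:
    raddfD.
  by rewrite GE.
rewrite {1}/conv (eq_split_sum _ (Psi := fun u v =>
  empty_word u * q v + conv (fun u => beta (G u)) (lmulX m') u * q v));
    last first.
  by move=> u v; rewrite m'E mulrDl.
rewrite split_sumD -!/(conv _ _ w) conv_empty_wordl -convA qE convDl -addrA;
  congr (_ + (_ + _)).
by apply: eq_split_sum => u v; rewrite lmulX_conv.
Qed.

End SubstAlg.

(** * Summing over noncrossing partitions by running the stack *)

Lemma sum_tupleS (V : nmodType) (T : finType) n (p : pred (seq T))
  (E : seq T -> V) :
  \sum_(t : n.+1.-tuple T | p t) E t =
  \sum_(l : T) \sum_(t : n.-tuple T | p (l :: t)) E (l :: t).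
Proof.
rewrite pair_big_dep /=.
rewrite (reindex (fun q : T * n.-tuple T => [tuple of q.1 :: q.2])) //=.
exists (fun t : n.+1.-tuple T => (thead t, [tuple of behead t])) =>
  [[l t] _|t _].
  by congr (_, _); apply/val_inj.
by rewrite [RHS]tuple_eta; apply/val_inj.
Qed.

Lemma sum_letters (V : nmodType) (E : bool * bool -> V) :
  \sum_l E l = E (true, true) + E (true, false) +
    (E (false, true) + E (false, false)).
Proof.
rewrite -[LHS](eq_bigr _ (fun l _ => congr1 E (esym (surjective_pairing l)))).
by rewrite -(pair_bigA _ (fun a b => E (a, b))) /= big_bool !big_bool.
Qed.

Section Machine.
Variables (K : fieldType) (A : algType K).
Implicit Types (F G f : seq A -> A) (st : seq (frame A)) (w : seq A).

(** The effect of W_m on the stack of frames, depending on the letter of m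
    only. *)
Definition step f (l : bool * bool) st : seq (frame A) :=
  if st is (args, cur) :: st1 then
    match l.1, l.2 with
    | true, true => (args, cur * f [::]) :: st1
    | true, false => ([::], 1) :: st
    | false, true =>
        if st1 is (args', cur') :: st2 then
          (args', cur' * f (rcons args cur)) :: st2
        else [::]
    | false, false => (rcons args cur, 1) :: st1
    end
  else [::].

(** Reading a word of letters. The last position uses the series F and all
    others G: the outer block of a partition with 1 and n in one block closes
    there. *)
Fixpoint run F G st (t : seq (bool * bool)) w : A :=
  match t, w with
  | l :: t', b :: w' =>
      run F G (read_b b (step (if w' is [::] then F else G) l st)) t' w'
  | _, _ => (head ([::], 1) st).2
  end.

(** The total weight of all the valid words, by recursion on the arguments; o
    has the meaning it has for [valid]. A list of n arguments stands for n
    positions, each followed by its argument. *)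
Fixpoint stack_sum (o : bool) F G st w : A :=
  match w with
  | [::] => if st is [:: (_, x)] then x else 0
  | b :: w' =>
    let f := if w' is [::] then F else G in
    if o && (size st <= 1)%N then 0 else
    match st with
    | [::] => 0
    | (args, x) :: st1 =>
      stack_sum o F G ((args, x * f [::] * b) :: st1) w' +
        stack_sum o F G (([::], b) :: st) w' +
      if st1 is (args', x') :: st2 then
        stack_sum o F G ((args', x' * f (rcons args x) * b) :: st2) w' +
        stack_sum o F G ((rcons args x, b) :: st1) w'
      else 0
    end
  end.

Lemma sum_run o F G st w : st != [::] ->
  \sum_(t : (size w).-tuple (bool * bool) | valid o (size st).-1 t) run F G st t
    w =
  stack_sum o F G st w.
Proof.
elim: w st => [|b w IH] st st0.
  have E t : t = [tuple] :> 0.-tuple (bool * bool) by apply: tuple0.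
  case: st st0 => [//|[args x] [|g st]] _ /=; last first.
    by rewrite big1 // => t; rewrite (E t).
  rewrite (big_pred1 [tuple]) //= => t; by rewrite (E t); apply/esym/eqP.
rewrite /= (@sum_tupleS _ _ (size w) (valid o (size st).-1)
  (fun t => run F G st t (b :: w))).
rewrite sum_letters /=.
set f := (if w is [::] then F else G).
case: st st0 => [//|[args x] st1] _ /=.
case: o IH => IH /=; last first.
  rewrite -(IH ((args, x * f [::] * b) :: st1)) //
    -(IH (([::], b) :: (args, x) :: st1)) //= mul1r.
  congr (_ + _); case: st1 => [|[args' x'] st2] /=;
    first by rewrite !big_pred0_eq addr0.
  by rewrite -(IH ((args', _) :: st2)) // -(IH ((rcons args x, b) :: _)) //=
    mul1r.
case: st1 => [|[args' x'] st2] /=; first by rewrite !big_pred0_eq !addr0.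
rewrite -(IH ((args, x * f [::] * b) :: _)) //
  -(IH (([::], b) :: (args, x) :: _)) //= mul1r.
by rewrite -(IH ((args', _) :: st2)) // -(IH ((rcons args x, b) :: _)) //=
  mul1r.
Qed.

Lemma foldl_run n (Fam : {set 'I_n} -> seq A -> A) P bs F G (e : seq 'I_n) st :
  (forall p m q, e = p ++ m :: q -> isMax (pblock P m) m ->
     Fam (pblock P m) = if q is [::] then F else G) ->
  (head ([::], 1) (foldl (read Fam P bs) st e)).2 =
  run F G st [seq letter_at P m | m <- e]
    [seq nth 1 bs (nat_of_ord m) | m <- e].
Proof.
elim: e st => [//|m e IH] st H /=.
rewrite IH; last by move=> p k q E; apply: (H (m :: p)); rewrite E.
congr (run _ _ _ _ _); rewrite /read /read_W /step /=.
have := H [::] m e erefl; case: st => [//|[args x] st1].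
case: (isMin _ m); case: (isMax _ m) => //= -> //.
  by case: e {IH H}.
by case: st1 => [//|[args' x'] st2]; case: e {IH H}.
Qed.

Lemma nested_run (bs : seq A) (Fam : {set 'I_(size bs).+1} -> seq A -> A) P F G
  :
  (forall m, isMax (pblock P m) m -> Fam (pblock P m) =
    if m == ord_max then F else G) ->
  nested Fam P bs = run F G [:: ([::], 1)] (type_word P) (rcons bs 1).
Proof.
move=> H; rewrite /nested (@foldl_run _ Fam P bs F G).
  congr run; apply: (@eq_from_nth _ 1).
    by rewrite size_map size_enum_ord size_rcons.
  move=> i; rewrite size_map size_enum_ord => ib.
  rewrite (nth_map ord0) ?size_enum_ord // nth_enum_ord // nth_rcons.
  case: (ltngtP i (size bs)) => [//|bi|->]; last by rewrite nth_default.
  by move: ib; rewrite ltnS leqNgt bi.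
move=> p m q E mx; rewrite H //.
have := congr1 size E; rewrite size_enum_ord size_cat /= => sz.
have pn : nat_of_ord m = size p.
  have sp : (size p < (size bs).+1)%N.
    have : (size p < size p + (size q).+1)%N by rewrite addnS ltnS leq_addr.
    by rewrite -sz.
  by rewrite -[RHS](nth_enum_ord ord0 sp) E nth_cat ltnn subnn.
have -> : (m == ord_max) = (size q == 0)%N.
  apply/eqP/eqP => [/(congr1 (fun k : 'I_(size bs).+1 => nat_of_ord k)) /=
    E'|q0].
    by move: (size p) (size q) sz pn => sp sq sz pn; lia.
  by apply: val_inj => /=; move: (size p) (size q) sz pn q0 => sp sq sz pn q0;
    lia.
by case: q {E sz}.
Qed.

End Machine.

Lemma add4 (V : zmodType) (a b c d e f g h : V) :
  ((a + b) + (c + d)) + ((e + f) + (g + h)) = (a + c + (e + g)) +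
    (b + d + (f + h)).
Proof. by rewrite (addrACA a b) (addrACA e f) [LHS]addrACA. Qed.

Section Totals.
Variables (K : fieldType) (A : algType K).
Implicit Types (F G f : seq A -> A) (st : seq (frame A)) (w : seq A).

(** Stacks that differ in one additive place. The arguments of the bottom frame
    are excluded, as they are always empty in a valid reading. *)
Inductive add_stack : seq (frame A) -> seq (frame A) -> seq (frame A) -> Prop :=
| AddCur u a x y r : add_stack (u ++ (a, x + y) :: r) (u ++ (a, x) :: r)
  (u ++ (a, y) :: r)
| AddArg u p q x y z g r : add_stack (u ++ (p ++ (x + y) :: q, z) :: g :: r)
    (u ++ (p ++ x :: q, z) :: g :: r) (u ++ (p ++ y :: q, z) :: g :: r).

Lemma stack_sumD o F G s1 s2 s3 w : madditive F -> madditive G ->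
  add_stack s1 s2 s3 ->
  stack_sum o F G s1 w = stack_sum o F G s2 w + stack_sum o F G s3 w.
Proof.
move=> FD GD; elim: w s1 s2 s3 => [|b w IH] s1 s2 s3.
  case=> [u a x y r|u p q x y z g r].
    case: u => [|[a' x'] [|h u]] /=; rewrite ?addr0 //.
    by case: r => //=; rewrite addr0.
  by case: u => [|[a' x'] [|h u]] /=; rewrite ?addr0.
rewrite /=; set f := (if w is [::] then F else G).
have fD : madditive f by rewrite /f; case: w {IH f}.
have fR a x y : f (rcons a (x + y)) = f (rcons a x) + f (rcons a y).
  by rewrite -!cats1 fD.
case=> [u a x y r|u p q x y z g r].
  rewrite !size_cat /=; case: ifP => _; first by rewrite addr0.
  case: u => [|[a0 x0] u] /=.
    rewrite !mulrDl (IH _ _ _ (AddCur [::] _ _ _ _))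
      (IH _ _ _ (AddCur [:: (_, _)] _ _ _ _)).
    case: r => [|[a' x'] r]; first by rewrite !addr0 addrACA.
    rewrite fR mulrDr mulrDl (IH _ _ _ (AddCur [::] _ _ _ _)).
    rewrite -!cats1 (IH _ _ _ (AddArg [::] _ [::] _ _ _ _ _)).
    exact: add4.
  rewrite (IH _ _ _ (AddCur ((_, _) :: u) _ _ _ _))
    (IH _ _ _ (AddCur (_ :: (_, _) :: u) _ _ _ _)).
  case: u => [|[a' x'] u] /=.
    rewrite !mulrDl (IH _ _ _ (AddCur [::] _ _ _ _))
      (IH _ _ _ (AddCur [:: (_, _)] _ _ _ _)).
    exact: add4.
  rewrite (IH _ _ _ (AddCur ((_, _) :: u) _ _ _ _))
    (IH _ _ _ (AddCur (_ :: (_, _) :: u) _ _ _ _)).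
  exact: add4.
rewrite !size_cat /=; case: ifP => _; first by rewrite addr0.
case: u => [|[a0 x0] u] /=.
  rewrite (IH _ _ _ (AddArg [::] _ _ _ _ _ _ _))
    (IH _ _ _ (AddArg [:: (_, _)] _ _ _ _ _ _ _)).
  case: g => a' x'.
  rewrite !rcons_cat !rcons_cons fD mulrDr mulrDl
    (IH _ _ _ (AddCur [::] _ _ _ _)).
  rewrite (IH _ _ _ (AddArg [::] _ _ _ _ _ _ _)).
  exact: add4.
rewrite (IH _ _ _ (AddArg ((_, _) :: u) _ _ _ _ _ _ _))
  (IH _ _ _ (AddArg (_ :: (_, _) :: u) _ _ _ _ _ _ _)).
case: u => [|[a' x'] u] /=.
  rewrite (IH _ _ _ (AddArg [::] _ _ _ _ _ _ _))
    (IH _ _ _ (AddArg [:: (_, _)] _ _ _ _ _ _ _)).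
  exact: add4.
rewrite (IH _ _ _ (AddArg ((_, _) :: u) _ _ _ _ _ _ _))
  (IH _ _ _ (AddArg (_ :: (_, _) :: u) _ _ _ _ _ _ _)).
exact: add4.
Qed.

Lemma stack_sum_mull F G y st a x w :
  stack_sum false F G (st ++ [:: (a, y * x)]) w =
    y * stack_sum false F G (st ++ [:: (a, x)]) w.
Proof.
elim: w st x => [|b w IH] st x /=.
  by case: st => [//|[a' x'] [|g st]] /=; rewrite mulr0.
set f := (if w is [::] then F else G).
case: st => [|[a0 x0] st] /=.
  by rewrite !addr0 -!mulrA (IH [::]) (IH [:: (_, _)]) mulrDr !mulrA.
rewrite (IH ((_, _) :: st)) (IH (_ :: (_, _) :: st)).
case: st => [|[a' x'] st] /=.
  by rewrite -!mulrA (IH [::]) (IH [:: (_, _)]) -!mulrDr !mulrA.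
by rewrite (IH ((_, _) :: st)) (IH (_ :: (_, _) :: st)) -!mulrDr.
Qed.

Section FirstReturn.
Variables (o : bool) (F G : seq A -> A).
Hypotheses (FD : madditive F) (GD : madditive G).

(** The top block receives y as its next argument and meets either a comma or
    its closing parenthesis, followed by the letter b. *)
Definition advance args y b st v : A :=
  let f := if v is [::] then F else G in
  stack_sum o F G ((rcons args y, b) :: st) v +
  (if st is (args', x') :: st' then
     stack_sum o F G ((args', x' * f (rcons args y) * b) :: st') v else 0).

Lemma advanceD args y y' b g st v :
  advance args (y + y') b (g :: st) v = advance args y b (g :: st) v +
    advance args y' b (g :: st) v.
Proof.
rewrite /advance; set f := (if v is [::] then F else G).
have fD : madditive f by rewrite /f; case: v {f}.
case: g => a' x'; rewrite -!cats1 fD mulrDr mulrDl.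
rewrite (@stack_sumD o F G _ _ _ _ FD GD (AddCur [::] _ _ _ _))
  (@stack_sumD o F G _ _ _ _ FD GD (AddArg [::] _ [::] _ _ _ _ _)).
exact: addrACA.
Qed.

Lemma advance0 args b g st v : advance args 0 b (g :: st) v = 0.
Proof.
have := advanceD args 0 0 b g st v; rewrite addr0 => /eqP.
by rewrite -[X in X == _]addr0 (inj_eq (addrI _)) eq_sym => /eqP.
Qed.

(** Let u be the letters read until the frame (args, x) is on top again and its
    block continues. Up to then the reading is a reading of its own above this
    frame, with x as bottom value; it cannot reach the last position, so only G
    occurs in it. *)
Lemma first_return st1 args x g st w :
  stack_sum o F G (st1 ++ (args, x) :: g :: st) w =
  split_sum (fun u r => if r is b :: v then
     advance args (stack_sum false G G (st1 ++ [:: ([::], x)]) u) b (g :: st) v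
       else 0) w.
Proof.
elim: w st1 x => [|b w IH] st1 x.
  by rewrite /= addr0; case: st1 => [//|[a' x'] [|h st1]].
rewrite [RHS]/= [LHS]/=.
have -> : (o && (size (st1 ++ (args, x) :: g :: st) <= 1)%N) = false.
  by rewrite size_cat /= !addnS andbF.
set f := (if w is [::] then F else G).
have nil0 s (y : A) : stack_sum false G G (s ++ [:: ([::], y)]) [::] =
  if s is [::] then y else 0.
  by case: s => [//|[a' x'] [|h s]].
rewrite /= in nil0; rewrite nil0.
case: st1 => [|[a0 x0] st1] /=.
  rewrite addrC; congr (_ + _).
    by rewrite /advance -/f addrC; case: (g).
  rewrite (IH [::]) (IH [:: (_, _)]) -split_sumD; apply:
    eq_split_sum_in => u [|c v] E /=; first by rewrite addr0.
  rewrite -advanceD addr0;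
    congr (advance _ (stack_sum _ _ _ [:: (_, _ * _ * _)] _ + _) _ _ _).
  by rewrite /f; case: (w) E => [|? ?]; case: (u).
rewrite advance0 add0r (IH ((_, _) :: st1)) (IH (_ :: (_, _) :: st1))
  -split_sumD.
have fG : (if w is [::] then F else G) = G \/ w = [::] by case: (w);
  [right|left].
case: st1 => [|[a' x'] st1] /=.
  rewrite (IH [::]) (IH [:: (_, _)]) -!split_sumD; apply:
    eq_split_sum_in => u [|c v] E /=; first by rewrite !addr0.
  have -> : f = G by rewrite /f; case: (w) E => [|? ?]; case: (u).
  by rewrite -!advanceD; case: (u).
rewrite (IH ((_, _) :: st1)) (IH (_ :: (_, _) :: st1)) -!split_sumD; apply:
  eq_split_sum_in => u [|c v] E /=; first by rewrite !addr0.
have -> : f = G by rewrite /f; case: (w) E => [|? ?]; case: (u).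
by rewrite -!advanceD; case: (u).
Qed.

End FirstReturn.
End Totals.

(** * Moments, free cumulants and Boolean cumulants *)

Section Recursions.
Variables (K : fieldType) (A : algType K).
Implicit Types (F G f : seq A -> A) (st : seq (frame A)) (w : seq A).

(** The generating function of all noncrossing partitions, each position being
    followed by its argument. *)
Definition stack_moment G w : A := stack_sum false G G [:: ([::], 1)] w.

Lemma stack_sum_bottom G y w : stack_sum false G G [:: ([::], y)] w =
  y * stack_moment G w.
Proof. by rewrite -[in LHS](mulr1 y); apply: (stack_sum_mull G G y [::]). Qed.

Lemma eq_fill_cons (H H' : seq A -> A) a c f w : (forall s, H s = H' s) ->
  fill_cons H a c f w = fill_cons H' a c f w.
Proof.
by move=> E; rewrite !fill_consE; apply: eq_split_sum => u v; apply: eq_fill.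
Qed.

(** Iterating [first_return]: between two consecutive elements of the block
    lies an arbitrary noncrossing partition. If o holds, nothing may follow the
    block. *)
Lemma stack_sum_block (o : bool) F G args x w : madditive F -> madditive G ->
  o \/ F = G ->
  stack_sum o F G [:: (args, x); ([::], 1)] w =
  split_sum (fun z r => if r is b :: v then
    fill_cons (fun s => (if v is [::] then F else G) (args ++ s)) x
      (stack_moment G) (stack_moment G) z
      * b * (if o then empty_word v else stack_moment G v) else 0) w.
Proof.
move=> FD GD oFG; elim/seq_size_ind: w args x => w IH args x.
rewrite (first_return o FD GD [::]).
transitivity (split_sum (fun u r => split_sum (fun z r' => if r' is b :: v then
    fill (fun s => (if v is [::] then F else G)
      (args ++ x * stack_moment G u :: s)) (stack_moment G) z
      * b * (if o then empty_word v else stack_moment G v) else 0) r) w);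
        last first.
  rewrite split_sumA; apply: eq_split_sum => z [|b v];
    first by rewrite split_sum0.
  rewrite fill_consE [RHS](raddf_split_sum (f := fun y : A => y * b * _)) ?mul0r
    //.
  by move=> y y'; rewrite !mulrDl.
apply: eq_split_sum_in => u [|b v] E /=; first by rewrite addr0.
rewrite stack_sum_bottom /advance mul1r addrC; congr (_ + _).
  rewrite cats1; set y := (if v is [::] then F else G) _.
  case: (o) oFG => [_|[//|FG]]; last by rewrite FG stack_sum_bottom.
  by case: (v) => [|c v'] /=; rewrite ?mulr1 ?mulr0.
rewrite IH; last by rewrite E size_cat /= addnS ltnS leq_addl.
apply: eq_split_sum => z [//|c v'] /=.
by congr (_ * _ * _); apply: eq_fill_cons => s; rewrite cat_rcons.
Qed.

(** Cut after the block of the first element. Its gaps hold arbitrary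
    partitions, and so does what follows it. *)
Lemma stack_moment_boolean G : madditive G ->
  boolean_series (fill G (stack_moment G)) (stack_moment G).
Proof.
move=> GD [|b w]; first by rewrite /conv /= mulr0 !addr0.
rewrite /conv /= add0r [LHS]/stack_moment /= !addr0 mul1r stack_sum_bottom
  -mulrA; congr (_ + _); first by case: (w).
rewrite (stack_sum_block [::] b w GD GD (or_intror erefl)).
apply: eq_split_sum => z [|c v] /=; first by rewrite mulr0.
by rewrite -mulrA; congr (fill_cons _ _ _ _ _ * _); case: v.
Qed.

Lemma stack_sum_last (o : bool) F G st w c b :
  stack_sum o F G st (rcons w (c * b)) = stack_sum o F G st (rcons w c) * b.
Proof.
elim: w st => [|a w IH] st /=.
  case: ifP => _; first by rewrite mul0r.
  case: st => [|[args x] [|[args' x'] [|g st]]] /=;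
    rewrite ?mul0r ?addr0 ?add0r ?mul0r //.
    by rewrite !mulrA.
  by rewrite !mulrA.
have E y : rcons w y <> [::] by case: (w).
have -> : (if rcons w (c * b) is [::] then F else G) = G by case: (w).
have -> : (if rcons w c is [::] then F else G) = G by case: (w).
case: ifP => _; first by rewrite mul0r.
case: st => [|[args x] st1] /=; first by rewrite mul0r.
rewrite !IH -mulrDl; case: st1 => [|[args' x'] st2]; first by rewrite !addr0.
by rewrite !IH -!mulrDl.
Qed.

Lemma sum_run_size (o : bool) F G st n w : size w = n -> st != [::] ->
  \sum_(t : n.-tuple (bool * bool) | valid o (size st).-1 t) run F G st t w =
  stack_sum o F G st w.
Proof. by move=> <-; apply: sum_run. Qed.

Lemma ser_madditive (F : ser A) : madditive F.
Proof. by move=> u v a b; apply: multilinearD; apply: ser_multilinear. Qed.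

(** The value of mu at X b_1 X b_2 ... X b_n, for M the moment series of mu.
    The trailing factor makes this compatible with splittings. *)
Definition word_moment (M : seq A -> A) w : A := if w is a ::
  t then M (belast a t) * last a t else 1.

Lemma word_moment_rcons M w b : word_moment M (rcons w b) = M w * b.
Proof. by case: w => [|a w] /=; rewrite ?belast_rcons ?last_rcons. Qed.

(** Noncrossing partitions correspond to valid words, so the sum over
    partitions is the sum over runs. The word ends in 1 to supply the argument
    after W_n. *)
Lemma moment_stack_moment (M F : ser A) : moment_cumulant M F ->
  word_moment M =1 stack_moment F.
Proof.
move=> MF; case/lastP => [//|w b]; rewrite word_moment_rcons MF.
rewrite -[b]mul1r /stack_moment stack_sum_last; congr (_ * _);
  last by rewrite mul1r.
rewrite -(sum_run_size false F F (n := (size w).+1)) ?size_rcons //=.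
transitivity (\sum_(P in NC (size w).+1) run F F [:: ([::], 1)] (type_word P)
  (rcons w 1)).
  by apply: eq_bigr => P _; apply: nested_run => m _; case: ifP.
rewrite -(big_imset (fun t : (size w).+1.-tuple _ => run F F [:: ([::], 1)] t
  (rcons w 1)) (@type_word_inj _)).
by rewrite image_type_word; apply: eq_bigl => t; rewrite inE.
Qed.

Lemma vouter_valid t : vouter t -> valid false 0 t.
Proof.
have sub h s : valid true h s -> valid false h s.
  by elim: s h => [//|l s IH] h /= /and3P[_ -> /IH ->].
case: t => [//|l [|l' t]]; first by move=> /= /eqP ->.
by case/andP => /eqP -> H; apply: (sub 1%N (l' :: t) H).
Qed.

Lemma image_NC_outer n : [set type_word P | P in @NC_outer n] =
  [set t : n.+1.-tuple _ | vouter t].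
Proof.
apply/setP => t; rewrite inE; apply/imsetP/idP => [[P]|vt].
  by rewrite inE => /andP[PNC] + ->; rewrite outer_word.
have [P PNC E] := type_word_onto (vouter_valid vt).
by exists P => //; rewrite inE PNC outer_word // -E.
Qed.

Lemma split_sum_last (V : zmodType) (h : seq A -> V) w :
  split_sum (fun u v => if v is [::] then h u else 0) w = h w.
Proof.
elim: w h => [|a w IH] h /=; first by rewrite addr0.
by rewrite add0r (IH (fun u => h (a :: u))).
Qed.

(** The block of the first element ends at the last position. It carries F, and
    its gaps hold arbitrary partitions weighted by alpha o F. *)
Lemma RBhat_stack_moment (alpha : {linear A -> A}) (F : ser A) w :
  RBhat alpha F w = fill F (stack_moment (ser_comp alpha F)) w.
Proof.
set G := ser_comp alpha F; rewrite [LHS]/= /RBhat_fun.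
have FD := @ser_madditive F; have GD := @ser_madditive G.
transitivity (\sum_(P in NC_outer (size w)) run F G [:: ([::], 1)] (type_word P)
  (rcons w 1)).
  apply: eq_bigr => P; rewrite inE => /andP[PNC Pout]; apply:
    nested_run => m mx.
  have -> : (pblock P m == outer P) = (m == ord_max).
    apply/eqP/eqP => [E|->].
      rewrite -E in Pout; have /forallP/(_ ord_max) := mx; rewrite Pout /= => H.
      by apply/val_inj/eqP; rewrite eqn_leq H -ltnS ltn_ord.
    by rewrite (pblock_eq PNC Pout).
  by case: ifP.
rewrite -(big_imset (fun t : (size w).+1.-tuple _ => run F G [:: ([::], 1)] t
  (rcons w 1))); last first.
  move=> P Q; rewrite inE => /andP[PN _]; rewrite inE => /andP[QN _].
  exact: type_word_inj.
rewrite image_NC_outer (eq_bigl (fun t : (size w).+1.-tuple _ => vouter t));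
  last by move=> t; rewrite inE.
rewrite (sum_tupleS _ vouter (fun t => run F G [:: ([::], 1)] t (rcons w 1)))
  sum_letters.
case: w => [|b w].
  have E t : t = [tuple] :> 0.-tuple (bool * bool) by apply: tuple0.
  rewrite /= (big_pred1 [tuple]) => [|t]; last by rewrite (E t); apply/esym/eqP.
  rewrite !big1 => [|t|t|t]; rewrite ?(E t) //=.
  by rewrite !addr0 mul1r mulr1.
have vE l t : (0 < size t)%N -> vouter (l :: t) = (l == (true, false)) &&
  valid true 1 t by case: t.
have v0 l : l != (true, false) ->
  \sum_(t : (size (b :: w)).-tuple _ | vouter (l :: t))
     run F G [:: ([::], 1)] (l :: t) (rcons (b :: w) 1) = 0.
  by move=> nl; rewrite big_pred0 // => t; rewrite vE ?size_tuple // (negPf nl).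
rewrite (v0 (true, true)) // (v0 (false, true)) // (v0 (false, false)) // !addr0
  add0r.
rewrite (eq_bigl (fun t : (size w).+1.-tuple _ => valid true 1 t)); last first.
  by move=> t; rewrite vE ?size_tuple.
rewrite /= mul1r.
have := @sum_run_size true F G [:: ([::], b); ([::], 1)] (size w).+1
  (rcons w 1).
move=> /(_ (size_rcons _ _) isT) /= ->.
rewrite stack_sum_block //; last by left.
rewrite split_sum_rcons addr0.
rewrite (eq_split_sum _
  (Psi := fun u v => if v is [::] then fill_cons F b (stack_moment G)
  (stack_moment G) u else 0)).
  by rewrite split_sum_last.
move=> u [|c v] /=; first by rewrite !mulr1.
by case: v => [|d v] /=; rewrite mulr0.
Qed.

Lemma RBhat_fill (alpha : {linear A -> A}) (F M : ser A) w :
  moment_cumulant M (ser_comp alpha F) -> RBhat alpha F w =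
    fill F (word_moment M) w.
Proof. by move=> /moment_stack_moment MF; rewrite RBhat_stack_moment; apply:
  eq_fill => // u _; rewrite MF. Qed.

Lemma moment_boolean (M F : ser A) : moment_cumulant M F ->
  boolean_series (fill F (word_moment M)) (word_moment M).
Proof.
move=> /moment_stack_moment MF w;
  rewrite !MF (stack_moment_boolean (@ser_madditive F)); congr (_ + _).
apply: conv_lmulX_eq => u _; last by rewrite MF.
by apply: eq_fill => // v _; rewrite MF.
Qed.

Lemma eq_boolean_series (e e' m : seq A -> A) : (forall w, e w = e' w) ->
  boolean_series e m -> boolean_series e' m.
Proof. by move=> E em w; rewrite em; congr (_ + _); apply: conv_lmulX_eq => u _;
  rewrite ?E. Qed.

(** In both series the gaps of the outermost block hold the same moments, and
    alpha is applied last. For alpha = id: RBhat_id turns free cumulants into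
    Boolean ones. *)
Lemma boolean_RBhat (alpha : {linear A -> A}) (M F : ser A) :
  moment_cumulant M (ser_comp alpha F) ->
  boolean_series (fun w => alpha (RBhat alpha F w)) (word_moment M).
Proof.
move=> MF; apply: eq_boolean_series (moment_boolean MF) => w.
rewrite (RBhat_fill w MF) (raddf_fill (L := alpha)) ?raddf0 //; exact: raddfD.
Qed.

(** Both sides solve the system of [fill_system_unique] for alpha + beta. *)
Lemma RBhat_comm (alpha beta : {linear A -> A}) (F : ser A) w :
  RBhat alpha (RBhat beta F) w = RBhat beta (RBhat alpha F) w.
Proof.
have H (a b : {linear A -> A}) : exists p,
    (forall w, RBhat b (RBhat a F) w = fill F p w) /\
    boolean_series (fun w => a (RBhat b (RBhat a F) w) +
      b (RBhat b (RBhat a F) w)) p.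
  have [M MF] := ex_moment (ser_comp a F);
    have [M' MF'] := ex_moment (ser_comp b (RBhat a F)).
  apply: (@fill_semigroup _ _ F a b (RBhat a F) (word_moment M)
    (RBhat b (RBhat a F)) (word_moment M')).
  - exact: ser_madditive.
  - by move=> v; apply: RBhat_fill.
  - exact: boolean_RBhat.
  - by move=> v; apply: RBhat_fill.
  - exact: boolean_RBhat.
have [p [p1 p2]] := H beta alpha; have [q [q1 q2]] := H alpha beta.
apply: (@fill_system_unique _ _ F (fun x => beta x + alpha x) _ p _ q p1 p2 q1).
by apply: eq_boolean_series q2 => v; rewrite addrC.
Qed.

End Recursions.

(** * Boolean cumulants in the GNS space *)

Section Theta.
Variables (K : fieldType) (A : algType K).
Implicit Types (a b c : A) (s t u v w : seq A) (P Q : polyX A) (nu : distr A).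

Notation X := (pX A).

Lemma pcstD a b : pcst (a + b) = pcst a + pcst b.
Proof. by rewrite /pcst -cls_cat; apply/clsP; apply: (peq_D [::]). Qed.
Lemma pcst0 : pcst (0 : A) = 0.
Proof. by apply: (addrI (pcst 0)); rewrite -pcstD !addr0. Qed.
Lemma pcstM a b : pcst (a * b) = pcst a * pcst b.
Proof. by rewrite /pcst cls_mul1. Qed.
Lemma pcst1 : pcst (1 : A) = 1.
Proof. by []. Qed.

Lemma distr_mull nu a P : nu (pcst a * P) = a * nu P.
Proof. by have := distr_bimodule nu a 1 P; rewrite pcst1 !mulr1. Qed.
Lemma distr_mulr nu b P : nu (P * pcst b) = nu P * b.
Proof. by have := distr_bimodule nu 1 b P; rewrite pcst1 !mul1r. Qed.

Fixpoint xw w : polyX A := if w is b :: w' then X * pcst b * xw w' else 1.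

Lemma cls1E a w : cls [:: (a, w)] = pcst a * xw w.
Proof.
elim: w a => [|b w IH] a /=; first by rewrite mulr1.
rewrite -mulrA -IH /pX /pcst !cls_mul1; congr (cls [:: _]).
by rewrite /mmul /= mulr1 mul1r.
Qed.

Lemma xw_rcons w b : xw (rcons w b) = xword w * pcst b.
Proof.
rewrite xwordE -[xw _]mul1r -pcst1 -cls1E /pcst cls_mul1; congr (cls [:: _]).
by rewrite -!cats1 -[(1, w ++ [:: 1])]/(slot (1 :: w) 1 [::]) mmul_slotl0 mul1r.
Qed.

Lemma distr_xw nu : (fun w => nu (xw w)) =1 word_moment (moments nu).
Proof.
case/lastP => [|w b]; first by rewrite /= -pcst1 distr_cst.
by rewrite word_moment_rcons xw_rcons distr_mulr.
Qed.

(** The vector a_0 X' a_1 X' ... a_n X' 1 of the GNS space, where X' applies X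
    and then the projection onto the complement of 1, i.e. subtracts the
    expectation. *)
Fixpoint theta nu s : polyX A :=
  if s is a :: s' then pcst a * (X * theta nu s' - pcst (nu (X * theta nu s')))
    else 1.

(** The matrix coefficient between 1 and theta; by [boolean_bool_cumulant]
    these are the Boolean cumulants of nu. *)
Definition bool_cumulant nu s : A := nu (X * theta nu s).

Lemma distr_theta nu a s : nu (theta nu (a :: s)) = 0.
Proof. by rewrite /= distr_mull linearB /= distr_cst subrr mulr0. Qed.

Lemma pcst_theta nu b a s : pcst b * theta nu (a :: s) = theta nu (b * a :: s).
Proof. by rewrite /= mulrA -pcstM. Qed.

(** Track the last time at which the vector has returned to the line of 1,
    reading the word from right to left. *)
Lemma xw_theta nu c w : pcst c * xw w =
  split_sum (fun z r => if r is b :: v then theta nu z * pcst (b * nu (xw v))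
    else 0) (c :: w).
Proof.
elim: w c => [|d w IH] c; first by rewrite /= !addr0 mul1r -pcst1 distr_cst
  !mulr1.
rewrite [xw _]/= -[X * _ * _]mulrA IH.
rewrite (raddf_split_sum (f := fun P => pcst c * (X * P))) ?mulr0 //;
  last first.
  by move=> P Q; rewrite !mulrDr.
have E1 : nu (xw (d :: w)) =
  split_sum (fun z r => if r is b :: v then bool_cumulant nu z * (b * nu (xw v))
    else 0) (d :: w).
  rewrite [xw _]/= -mulrA IH (raddf_split_sum (f := fun P => nu (X * P))) ?mulr0
    ?linear0 //; last first.
    by move=> P Q; rewrite mulrDr linearD.
  by apply: eq_split_sum => z [|b v];
    rewrite ?mulr0 ?linear0 // mulrA distr_mulr.
rewrite [RHS]split_sum_cons mul1r -[xw (d :: w)]/(X * pcst d * xw w) E1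
  (raddf_split_sum (f := fun x => pcst (c * x))) ?mulr0 ?pcst0 //; last first.
  by move=> x y; rewrite mulrDr pcstD.
rewrite -split_sumD; apply: eq_split_sum => z [|b v];
  first by rewrite !mulr0 ?pcst0 addr0.
rewrite /= -/(bool_cumulant nu z) -mulrA mulrBl !mulrBr !mulrA -!pcstM mulrA.
by rewrite addrC subrK.
Qed.

Lemma boolean_bool_cumulant nu :
  boolean_series (bool_cumulant nu) (word_moment (moments nu)).
Proof.
move=> w; rewrite -distr_xw; case: w => [|d w].
  by rewrite /conv /= mulr0 !addr0 -pcst1 distr_cst.
rewrite /= -mulrA (xw_theta nu) (raddf_split_sum (f := fun P => nu (X * P)))
  ?mulr0 ?linear0 //; last first.
  by move=> P Q; rewrite mulrDr linearD.
rewrite add0r; apply: eq_split_sum => z [|b v];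
  rewrite ?mulr0 ?linear0 //= mulrA distr_mulr.
by rewrite -distr_xw.
Qed.

End Theta.

(** * Positivity of a distribution from its Boolean cumulants *)

Section Star.
Variables (R : realType) (B : cstarAlgType R).
Implicit Types (a b c : B) (s t u v w : seq B) (P Q : polyX B) (nu om : distr B)
  (m : mono B).

Notation X := (pX B).

Lemma pstarD P Q : pstar (P + Q) = pstar P + pstar Q.
Proof.
elim/Defs.poly_ind: P => s; elim/Defs.poly_ind: Q => t.
by rewrite -cls_cat !pstar_cls map_cat cls_cat.
Qed.
Lemma pstar0 : pstar (0 : polyX B) = 0.
Proof. by apply: (addrI (pstar 0)); rewrite -pstarD !addr0. Qed.
Lemma pstarN P : pstar (- P) = - pstar P.
Proof. by apply: (addrI (pstar P)); rewrite -pstarD !subrr pstar0. Qed.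
Lemma pstar_sum (I : Type) (l : seq I) (F : I -> polyX B) :
  pstar (\sum_(i <- l) F i) = \sum_(i <- l) pstar (F i).
Proof. by apply: (big_morph _ pstarD pstar0). Qed.

Lemma mstar_mmul m m' : mstar (mmul m m') = mmul (mstar m') (mstar m).
Proof.
have [u [a ->]] : exists u a, m = slot u a [::].
  case: m => a; case/lastP => [|s b]; first by exists [::], a.
  by exists (a :: s), b; rewrite /= cats1.
case: m' => b v; rewrite mmul_slotl0 /= mstar_slot mstar_slot /=.
by rewrite -[(b, v)]/(slot [::] b v) mstar_slot /= mmul_slotl0 starM.
Qed.

Lemma pstarM P Q : pstar (P * Q) = pstar Q * pstar P.
Proof.
elim/Defs.poly_ind: P => s; elim/Defs.poly_ind: Q => t.
rewrite (cls_sum s) (cls_sum t) mulr_suml !pstar_sum mulr_sumr; apply: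
  eq_bigr => m _.
rewrite mulr_sumr mulr_suml pstar_sum; apply: eq_bigr => m' _.
by rewrite cls_mul1 !pstar_cls /= mstar_mmul cls_mul1.
Qed.

Lemma pstar_pcst a : pstar (pcst a) = pcst (star a).
Proof. by rewrite /pcst pstar_cls. Qed.
Lemma pstarX : pstar X = X.
Proof. by rewrite /pX pstar_cls /= /mstar /= star1. Qed.
Lemma pstar1 : pstar (1 : polyX B) = 1.
Proof. by rewrite -pcst1 pstar_pcst star1. Qed.

Lemma gram_sum (T : Type) nu (f : T -> polyX B) (l : seq (T * B)) :
  \sum_(p <- l) \sum_(q <- l) star p.2 * nu (pstar (f p.1) * f q.1) * q.2 =
  nu (pstar (\sum_(p <- l) f p.1 * pcst p.2) * \sum_(p <- l) f p.1 * pcst p.2).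
Proof.
rewrite pstar_sum mulr_suml linear_sum; apply: eq_bigr => p _.
rewrite mulr_sumr linear_sum; apply: eq_bigr => q _.
by rewrite pstarM pstar_pcst mulrA distr_mulr -!mulrA distr_mull mulrA.
Qed.

(** The inner product of the GNS space, on monomials. *)
Definition gramk nu m m' : B := nu (pstar (cls [:: m]) * cls [:: m']).
Definition degle n m : bool := (size m.2 <= n)%N.
Definition pos_upto n nu : Prop := posker (degle n) (gramk nu).

(** For e the moments of a vector v, this is the matrix coefficient of c
    between m v and m' v, for m and m' read as words in the operator X. *)
Definition midkernel (e : seq B -> B) m c m' : B :=
  e (map star (rev m.2) ++ (star m.1 * c * m'.1) :: m'.2).
Definition bkernel e m m' := midkernel e m 1 m'.

Definition deg n P : Prop := exists l, all (degle n) l /\ P = cls l.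

Lemma degS n k P : (n <= k)%N -> deg n P -> deg k P.
Proof.
move=> nk [l [Hl ->]]; exists l; split=> //; apply: sub_all Hl => m.
by rewrite /degle => /leq_trans; apply.
Qed.
Lemma deg_mono n m : degle n m -> deg n (cls [:: m]).
Proof. by move=> H; exists [:: m]; rewrite /= H. Qed.
Lemma deg_pcst n a : deg n (pcst a).
Proof. exact: deg_mono. Qed.
Lemma degD n P Q : deg n P -> deg n Q -> deg n (P + Q).
Proof.
move=> [l [Hl ->]] [k [Hk ->]]; exists (l ++ k); rewrite all_cat Hl Hk.
by split=> //; rewrite cls_cat.
Qed.
Lemma deg_mull n a P : deg n P -> deg n (pcst a * P).
Proof.
move=> [l [Hl ->]]; exists [seq (a * m.1, m.2) | m <- l]; split.
  by rewrite all_map; apply: sub_all Hl.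
rewrite cls_sum [RHS]cls_sum mulr_sumr big_map; apply: eq_bigr => -[b s] _.
by rewrite /pcst cls_mul1.
Qed.
Lemma deg_mulX n P : deg n P -> deg n.+1 (X * P).
Proof.
move=> [l [Hl ->]]; exists [seq (1, m.1 :: m.2) | m <- l]; split.
  by rewrite all_map; apply: sub_all Hl.
rewrite cls_sum [RHS]cls_sum mulr_sumr big_map; apply: eq_bigr => -[b s] _.
by rewrite /pX cls_mul1 /mmul /= mul1r.
Qed.

Lemma deg_theta nu s : deg (size s) (theta nu s).
Proof.
elim: s => [|a s IH] /=; first by rewrite -pcst1; apply: deg_pcst.
apply: deg_mull; apply: degD; first exact: deg_mulX.
have -> : - pcst (nu (X * theta nu s)) = pcst (- nu (X * theta nu s)).
  by apply: (addrI (pcst (nu (X * theta nu s)))); rewrite -pcstD !subrr pcst0.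
exact: deg_pcst.
Qed.

(** Positivity in degree n makes the kernel hermitian in degree n, by
    polarization. The inductions on the degree get their adjoints from here. *)
Lemma pos_upto_herm n nu P Q : pos_upto n nu -> deg n P -> deg n Q ->
  star (nu (pstar P * Q)) = nu (pstar Q * P).
Proof.
move=> J [l [Hl ->]] [k [Hk ->]].
elim: l Hl => [|m l IH] /=.
  by move=> _; rewrite (cls_sum [::]) big_nil pstar0 mul0r mulr0 linear0 star0.
case/andP => Hm /IH {}IH; rewrite -cat1s cls_cat pstarD mulrDl mulrDr !linearD
  starD IH.
congr (_ + _) => {IH}.
elim: k Hk => [|m' k IH] /=.
  by move=> _; rewrite (cls_sum [::]) big_nil pstar0 mul0r mulr0 linear0 star0.
case/andP => Hm' /IH {}IH; rewrite -(cat1s m' k) cls_cat pstarD mulrDl mulrDr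
  !linearD starD IH.
congr (_ + _); exact: (posker_herm J).
Qed.

Lemma pos_upto0 nu : pos_upto 0 nu.
Proof.
move=> l Hl; rewrite (gram_sum nu (fun m => cls [:: m])).
have -> : \sum_(p <- l) cls [:: p.1] * pcst p.2 =
  pcst (\sum_(p <- l) p.1.1 * p.2).
  elim: l Hl => [|[[a s] b] l IH] /=; first by rewrite !big_nil pcst0.
  case/andP; rewrite /degle leqn0 => /nilP /= -> /IH E.
  by rewrite !big_cons E pcstD pcstM.
by rewrite pstar_pcst -pcstM distr_cst; apply: psd_star.
Qed.

Section Step.
Variables (nu : distr B) (n : nat).
Hypotheses (e_sa : star (bool_cumulant nu [::]) = bool_cumulant nu [::])
  (J : pos_upto n nu).

(** The vectors theta (a :: s) are orthogonal to 1 on the right by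
    construction. On the left this needs the hermitian property, which is
    available one degree below. *)
Lemma star_theta0 a s : (size s <= n)%N -> nu (pstar (theta nu (a :: s))) = 0.
Proof.
move=> sn; rewrite /= pstarM !pstar_pcst distr_mulr pstarD pstarN pstar_pcst
  pstarM pstarX.
rewrite linearB /= distr_cst.
suff -> : nu (pstar (theta nu s) * X) = star (nu (X * theta nu s))
  by rewrite subrr mul0r.
case: n J sn => [|k] Jk; first by rewrite leqn0 => /nilP ->;
  rewrite /= pstar1 mul1r; have := e_sa; rewrite /bool_cumulant /= !mulr1 => ->.
move=> sn; rewrite -[X in star (nu (X * _))]pstarX (pos_upto_herm Jk) //.
  by rewrite -[X]mulr1 -pcst1; apply: deg_mulX; apply: degS (deg_pcst 0 1).
exact: degS (deg_theta nu s).
Qed.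

(** The compressed operator is symmetric, so the letters of the first vector
    can be moved one by one to the second. *)
Lemma theta_kernel s t a c : (size s <= n.+1)%N ->
  nu (pstar (theta nu (a :: s)) * theta nu (c :: t)) =
    bkernel (bool_cumulant nu) (a, s) (c, t).
Proof.
have theta_cons x u : theta nu (x :: u) =
  pcst x * (X * theta nu u - pcst (nu (X * theta nu u))) by [].
have unfold x u y v : nu (pstar (theta nu (x :: u)) * theta nu (y :: v)) =
    nu (pstar (theta nu u) * (X * theta nu (star x * y :: v))).
  rewrite theta_cons pstarM pstarD pstarN !pstar_pcst pstarM pstarX -mulrA
    pcst_theta.
  rewrite mulrBl linearB /= distr_mull -/(theta nu (star x * y :: v))
    distr_theta.
  by rewrite mulr0 subr0 mulrA.
elim: s t a c => [|a' s IH] t a c sn.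
  by rewrite unfold pstar1 mul1r /bkernel /midkernel /= mulr1.
rewrite unfold; set S := theta nu (star a * c :: t).
have -> : nu (pstar (theta nu (a' :: s)) * (X * S)) =
   nu (pstar (theta nu (a' :: s)) * theta nu (1 :: star a * c :: t)).
  rewrite (theta_cons 1) -/S pcst1 mul1r mulrBr linearB distr_mulr.
  by rewrite star_theta0 // mul0r subr0.
rewrite IH ?(ltnW sn) // /bkernel /midkernel /= !mulr1 rev_cons map_rcons
  cat_rcons.
by [].
Qed.

(** The right span over B of 1 and of the vectors theta of degree at most k +
    1. *)
Definition spanned (k : nat) P : Prop := exists (c0 : B) (l : seq (mono B * B)),
  all (fun p => degle k p.1) l /\
  P = pcst c0 + \sum_(p <- l) theta nu (p.1.1 :: p.1.2) * pcst p.2.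

Lemma spannedD k P Q : spanned k P -> spanned k Q -> spanned k (P + Q).
Proof.
move=> [c [l [Hl ->]]] [c' [l' [Hl' ->]]]; exists (c + c'), (l ++ l').
by rewrite all_cat Hl Hl' big_cat pcstD addrACA.
Qed.

Lemma spanned_mulr k P b : spanned k P -> spanned k (P * pcst b).
Proof.
move=> [c [l [Hl ->]]]; exists (c * b), [seq (p.1, p.2 * b) | p <- l].
rewrite all_map big_map mulrDl pcstM mulr_suml; split=> //; congr (_ + _).
by apply: eq_bigr => p _; rewrite pcstM mulrA.
Qed.

Lemma spanned_mono k a s : (size s <= k.+1)%N -> spanned k (cls [:: (a, s)]).
Proof.
rewrite cls1E; elim: s k a => [|b s IH] k a sk /=.
  by exists a, [::]; rewrite big_nil addr0 mulr1.
have : (size s <= k)%N by [].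
clear sk => sk.
have [c [l [Hl E]]] : exists (c0 : B) (l : seq (mono B * B)),
  all (fun p => size p.1.2 < k)%N l /\
  pcst b * xw s = pcst c0 + \sum_(p <- l) theta nu (p.1.1 :: p.1.2) * pcst p.2.
  case: k sk => [|k] sk; last exact: IH.
  move: sk; rewrite leqn0 => /nilP ->; exists b, [::].
  by rewrite big_nil addr0 mulr1.
(* X c = theta [:: 1] c + nu(X) c; X theta z = theta (1 :: z) + bool_cumulant z *)
pose l' := ((a, [::]), c) :: [seq ((a, p.1.1 :: p.1.2), p.2) | p <- l] :
  seq (mono B * B).
exists (a * bool_cumulant nu [::] * c +
  \sum_(p <- l) a * bool_cumulant nu (p.1.1 :: p.1.2) * p.2), l'; split.
  by rewrite /l' /= all_map.
rewrite -(mulrA X) E /l' big_cons big_map pcstD addrACA.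
rewrite mulrDr mulrDr; congr (_ + _).
  by rewrite /bool_cumulant /= !pcstM -mulrDl -mulrDr addrC subrK -!mulrA mul1r.
rewrite (big_morph _ (@pcstD _ B) (@pcst0 _ B)) -big_split /= !mulr_sumr; apply:
  eq_bigr => p _.
rewrite -/(bool_cumulant nu (p.1.1 :: p.1.2)) -/(theta nu (p.1.1 :: p.1.2))
  !pcstM -mulrDl -mulrDr.
by rewrite [pcst (bool_cumulant _ _) + _]addrC subrK !mulrA.
Qed.

(** Expand a polynomial of degree n + 1 as c + Q with c in B and Q in the span
    of the vectors theta, which are orthogonal to 1. On them the form is the
    kernel of the Boolean cumulants in degree n. *)
Lemma pos_upto_step : posker (degle n) (bkernel (bool_cumulant nu)) ->
  pos_upto n.+1 nu.
Proof.
move=> kp l Hl; rewrite (gram_sum nu (fun m => cls [:: m])).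
have : spanned n (\sum_(p <- l) cls [:: p.1] * pcst p.2).
  elim: l Hl => [_|[[a s] b] l IH /= /andP[Hs /IH]].
    by exists 0, [::]; rewrite !big_nil pcst0 addr0.
  by rewrite big_cons; apply: spannedD; apply: spanned_mulr; apply:
    spanned_mono.
move=> [c [k [Hk ->]]].
set Q := \sum_(p <- k) _.
have Q0 : nu Q = 0.
  rewrite linear_sum big1 // => p _.
  by rewrite distr_mulr distr_theta mul0r.
have Qs0 : nu (pstar Q) = 0.
  rewrite pstar_sum linear_sum big_seq big1 // => p pk.
  rewrite pstarM pstar_pcst distr_mull star_theta0 ?mulr0 //.
  by move/allP: Hk => /(_ _ pk).
rewrite pstarD mulrDl !mulrDr !linearD /= pstar_pcst (distr_mull nu (star c) Q)
  (distr_mulr nu c (pstar Q)) Q0 Qs0.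
rewrite -pcstM distr_cst mulr0 mul0r addr0 add0r.
apply: psdD; first exact: psd_star.
rewrite -(gram_sum nu (fun m => theta nu (m.1 :: m.2))).
have := kp k Hk; congr psd; rewrite big_seq [RHS]big_seq; apply:
  eq_bigr => p pk.
apply: eq_bigr => q _; rewrite theta_kernel -?surjective_pairing //.
by apply: leqW; move/allP: Hk => /(_ _ pk).
Qed.

End Step.
End Star.

(** * A Fock-type model for fillings *)

Section Psi.
Variables (R : realType) (B : cstarAlgType R) (om : distr B).
Implicit Types (a b c x : B) (s t u v w : seq B) (P Q : polyX B) (m : mono B).

Notation X := (pX B).
Notation cm m := (cls [:: m]).

Definition lmul x m : mono B := (x * m.1, m.2).
Definition xmul x m : mono B := (x, m.1 :: m.2).

(** The vector a_0 T a_1 T ... T a_n (1 (x) 1) as a sum of elementary tensors w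
    (x) k, where T = W (x) 1 + P (x) X sends w (x) k to (X w) (x) k + 1 (x) X
    om(w) k. Monomials stand for vectors in both factors. *)
Fixpoint fock_terms a s : seq (mono B * mono B) :=
  if s is b :: s' then
    [seq (xmul a p.1, p.2) | p <- fock_terms b s'] ++
    [seq ((a, [::]), xmul 1 (lmul (om (cm p.1)) p.2)) | p <- fock_terms b s']
  else [:: ((a, [::]), (1, [::]))].

Lemma cls_lmul x m : cm (lmul x m) = pcst x * cm m.
Proof. by case: m => a s; rewrite /lmul !cls1E pcstM mulrA. Qed.
Lemma cls_xmul x m : cm (xmul x m) = pcst x * X * cm m.
Proof. by case: m => a s; rewrite /xmul !cls1E /= !mulrA. Qed.

Lemma fock_terms_lmul x c t : fock_terms (x * c) t =
  [seq (lmul x p.1, p.2) | p <- fock_terms c t].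
Proof.
case: t => [//|b t] /=; rewrite map_cat -!map_comp; congr (_ ++ _);
  by apply: eq_map => p.
Qed.

Lemma fock_terms_size a s : all (fun p => degle (size s) p.1) (fock_terms a s).
Proof.
elim: s a => [//|b s IH] a /=; rewrite all_cat !all_map; apply/andP; split.
  by apply: sub_all (IH b) => p.
by apply/allP.
Qed.

(** Projecting the left factor to the vacuum yields the filling: the left
    factor collects the words u_i between two uses of P (x) X. *)
Lemma fock_terms_fill (F : seq B -> B) (g : polyX B) a s :
  \sum_(p <- fock_terms a s) F ((om (g * cm p.1) * p.2.1) :: p.2.2) =
  split_sum (fun u v => fill (fun z => F (om (g * (pcst a * xw u)) :: z))
    (fun w => om (xw w)) v) s.
Proof.
elim: s F g a => [|b s IH] F g a.
  by rewrite /= big_seq1 addr0 cls1E /= !mulr1.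
rewrite split_sum_cons big_cat !big_map [RHS]addrC; congr (_ + _); last first.
  transitivity (\sum_(p <- fock_terms b s) F
    (om (g * pcst a) :: (om (1 * cm p.1) * p.2.1) :: p.2.2)).
    by apply: eq_bigr => p _; rewrite cls1E /= !mulr1 mul1r.
  rewrite (IH (fun z => F (om (g * pcst a) :: z))).
  have -> : xw [::] = 1 :> polyX B by [].
  rewrite mulr1 fill_consS.
  by apply: eq_split_sum => u v; rewrite mul1r distr_mull.
have := IH F (g * pcst a * X) b; move=> E.
transitivity (\sum_(p <- fock_terms b s) F
  (om (g * pcst a * X * cm p.1) * p.2.1 :: p.2.2)).
  by apply: eq_bigr => p _; rewrite cls_xmul !mulrA.
rewrite E; apply: eq_split_sum => u v; apply: eq_fill => // z.
by rewrite /= !mulrA.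
Qed.

(** The operator T is symmetric, so the letters of the first vector move one by
    one to the second; this reduces the claim to the vacuum expectation of a
    word, which is [fock_terms_fill]. *)
Lemma fock_terms_kernel (eta : ser B) n s t a c : pos_upto n om ->
  (size s <= n)%N ->
  \sum_(p <- fock_terms a s) \sum_(q <- fock_terms c t) midkernel eta p.2
    (gramk om p.1 q.1) q.2 =
  bkernel (fill eta (fun w => om (xw w))) (a, s) (c, t).
Proof.
move=> J; elim: s t a c => [|a' s IH] t a c sn.
  rewrite /= big_seq1 /bkernel /midkernel /= mulr1.
  have -> : (star a * c) = 1 * (star a * c) by rewrite mul1r.
  transitivity (\sum_(q <- fock_terms c t) eta
    ((om (pcst (star a) * cm q.1) * q.2.1) :: q.2.2)).
    apply: eq_bigr => q _; rewrite star1 mul1r /gramk cls1E /= mulr1 pstar_pcst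
      //.
  rewrite fock_terms_fill -[RHS]/(fill _ _ (_ :: _)) fill_consS.
  apply: eq_split_sum => u v; apply: eq_fill => // z.
  by rewrite mulrA -pcstM distr_mull mul1r.
rewrite /= big_cat !big_map /= -big_split /=.
transitivity (\sum_(p <- fock_terms a' s)
  \sum_(q <- fock_terms 1 (star a * c :: t))
    midkernel eta p.2 (gramk om p.1 q.1) q.2); last first.
  rewrite IH ?(ltnW sn) // /bkernel /midkernel /= !mulr1 rev_cons map_rcons
    cat_rcons //.
rewrite big_seq [RHS]big_seq; apply: eq_bigr => p pin.
rewrite /= fock_terms_lmul big_cat !big_map /=; congr (_ + _); apply:
  eq_bigr => q _ /=.
  rewrite /gramk !cls_xmul pstarM pstarM pstarX pstar_pcst cls_lmul pcst1 mul1r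
    !mulrA //.
rewrite /midkernel /gramk /= !cls1E /= !mulr1 pstar_pcst star1 ?mul1r.
rewrite rev_cons map_rcons cat_rcons starM -cls1E -/(lmul (star a) q.1)
  cls_lmul.
have sp : (size p.1.2 <= n)%N.
  apply: leq_trans (ltnW sn); have /allP := fock_terms_size a' s; exact.
have -> : star (om (cm p.1)) = om (pstar (cm p.1)).
  rewrite -[cm p.1]mul1r -[in LHS]pstar1 (pos_upto_herm J) ?mulr1 ?mul1r //.
    by rewrite -pcst1; apply: deg_pcst.
  exact: deg_mono.
by [].
Qed.

(** The kernel is the one of the tensor product of the GNS spaces of om and of
    eta. *)
Lemma posker_fock (eta : ser B) n : pos_upto n om ->
  posker predT (bkernel eta) ->
  posker (degle n) (bkernel (fill eta (fun w => om (xw w)))).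
Proof.
move=> J kp l Hl.
pose l' := flatten [seq [seq (q, p.2) | q <- fock_terms p.1.1 p.1.2] | p <- l].
have Hl' : all (fun p : mono B * mono B * B => degle n p.1.1) l'.
  apply/allP => x /flatten_mapP[p pl /mapP[q qin ->]] /=.
  have /allP/(_ _ qin) := fock_terms_size p.1.1 p.1.2.
  by move/allP: Hl => /(_ _ pl); rewrite /degle => H1 H2; apply: leq_trans H1.
have KD y y' (r : R) a b : midkernel eta y (a + (r%:C)%C *: b) y' =
    midkernel eta y a y' + (r%:C)%C *: midkernel eta y b y'.
  rewrite /midkernel mulrDr mulrDl -scalerAr -scalerAl addrC.
  by rewrite (ser_multilinear eta) addrC.
have Kact y y' a b : midkernel eta y (star a * b) y' =
  midkernel eta (lmul a y) 1 (lmul b y').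
  by rewrite /midkernel /= starM mulr1 !mulrA.
have := posker_mid KD Kact kp J Hl'; congr psd.
rewrite big_flatten big_map big_seq [RHS]big_seq; apply: eq_bigr => p pl.
under eq_bigr do rewrite big_flatten big_map.
rewrite big_map exchange_big; apply: eq_bigr => q _ /=.
under eq_bigr do rewrite big_map.
have sp : (size p.1.2 <= n)%N by move/allP: Hl => /(_ _ pl).
have -> : p.1 = (p.1.1, p.1.2) by case: p.1.
have -> : q.1 = (q.1.1, q.1.2) by case: q.1.
rewrite -(fock_terms_kernel _ _ _ _ J sp) mulr_sumr mulr_suml; apply:
  eq_bigr => x _ /=.
by rewrite mulr_sumr mulr_suml.
Qed.

End Psi.

(** * Positive distributions are preserved *)

Section Main.
Variables (R : realType) (B : cstarAlgType R).
Implicit Types (mu nu : distr B) (alpha : {linear B -> B}).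

(** A self-adjoint element is a difference of two positive ones. *)
Lemma cp_sa alpha (x : B) : completely_positive alpha -> star x = x ->
  star (alpha x) = alpha x.
Proof.
move=> acp sx.
have pa y : psd y -> star (alpha y) = alpha y.
  move=> /positiveP [c ->].
  have [|C /matrixP /(_ 0 0)] := acp 1%N (star c * c)%:M.
    by exists c%:M; apply/matrixP => i j;
      rewrite /mxstar !mxE big_ord1 !mxE !ord1 eqxx.
  by rewrite !mxE big_ord1 !mxE eqxx mulr1n => ->; rewrite starM starK.
have p1 := psd_sub sx (lexx (cnorm x)).
have p2 : psd ((cnorm x)%:C%C *: (1 : B)) .
  by split; [rewrite star_rsc star1|exists (cnorm x);
    rewrite subrr cnorm0 cnorm_ge0].
have -> : x = (cnorm x)%:C%C *: 1 - ((cnorm x)%:C%C *: 1 - x)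
  by rewrite opprB addrC subrK.
by rewrite linearB starB !pa.
Qed.

Lemma positive_upto mu n : positive_distr mu -> pos_upto n mu.
Proof.
move=> mupos l _; rewrite (gram_sum mu (fun m => cls [:: m])).
by apply/positiveP; apply: mupos.
Qed.

Lemma upto_positive mu : (forall n, pos_upto n mu) -> positive_distr mu.
Proof.
move=> J P; apply/positiveP; elim/Defs.poly_ind: P => s.
pose n := (\sum_(m <- s) size m.2)%N.
have Hs : all (fun p : mono B * B => degle n p.1) [seq (m, 1) | m <- s].
  rewrite all_map /n; elim: s {n} => [//|m s IH] /=.
  rewrite big_cons /degle leq_addr; apply: sub_all IH => p /=.
  by rewrite /degle => H; apply: leq_trans H _; apply: leq_addl.
have := J n _ Hs; rewrite (gram_sum mu (fun m => cls [:: m])) big_map cls_sum.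
by under eq_bigr do rewrite pcst1 mulr1.
Qed.

(** Boolean cumulants are determined by the moments. *)
Lemma bool_cumulant_mu mu w : bool_cumulant mu w =
  RBhat idfun (Rtransform mu) w.
Proof.
have MF : moment_cumulant (moments mu) (ser_comp idfun (Rtransform mu)).
  have -> : ser_comp idfun (Rtransform mu) = Rtransform mu by apply: ser_eq.
  exact: cumulantP.
by apply: boolean_series_unique (boolean_bool_cumulant mu) (boolean_RBhat MF) w.
Qed.

End Main.

Theorem theorem7p8 (R : realType) (B : cstarAlgType R)
    (alpha : {linear B -> B}) :
  completely_positive alpha ->
  forall mu : distr B, positive_distr mu -> positive_distr (BB alpha mu).
Proof.
move=> acp mu mupos.
pose eta := RBhat idfun (Rtransform mu).
have [om omE] := ex_distr_Rtransform (ser_comp alpha eta).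
have omM : moment_cumulant (moments om) (ser_comp alpha eta).
  by rewrite -omE; apply: cumulantP.
pose eta' := RBhat alpha eta.
have eta'E w : eta' w = fill eta (fun w => om (xw w)) w.
  by rewrite /eta' (RBhat_fill w omM); apply: eq_fill => // u _;
    rewrite -distr_xw.
have bom w : bool_cumulant om w = alpha (eta' w).
  by apply: boolean_series_unique (boolean_bool_cumulant om) (boolean_RBhat omM)
    w.
(* Commuting RBhat_id past RBhat_alpha expresses these cumulants by eta. *)
have bnu w : bool_cumulant (BB alpha mu) w = eta' w.
  by rewrite bool_cumulant_mu BBP RBhat_comm.
have Jmu n : pos_upto n mu := positive_upto mupos.
have bmu0 : star (bool_cumulant mu [::]) = bool_cumulant mu [::].
  have dX : deg 1 (pX B) by rewrite -[pX B]mulr1 -pcst1;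
    apply/deg_mulX/deg_pcst.
  have d1 : deg 1 (1 : polyX B) by rewrite -pcst1; apply: deg_pcst.
  have := pos_upto_herm (Jmu 1%N) dX d1.
  by rewrite pstarX pstar1 mul1r mulr1 /bool_cumulant /= mulr1.
have eta0 : star (eta' [::]) = eta' [::].
  have -> : eta' [::] = bool_cumulant mu [::] by rewrite eta'E bool_cumulant_mu.
  exact: bmu0.
have keta : posker predT (bkernel eta).
  move=> l _.
  have := mupos (\sum_(p <- l) theta mu (p.1.1 :: p.1.2) * pcst p.2).
  rewrite -(gram_sum mu (fun m => theta mu (m.1 :: m.2))) => /positiveP.
  congr psd; apply: eq_bigr => p _; apply: eq_bigr => q _.
  rewrite (theta_kernel bmu0 (Jmu (size p.1.2))) -?surjective_pairing //.
  by rewrite /bkernel /midkernel bool_cumulant_mu.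
have keta' n : pos_upto n om -> posker (degle n) (bkernel eta').
  move=> J l Hl; have := posker_fock J keta Hl; congr psd.
  by apply: eq_bigr => p _; apply: eq_bigr => q _;
    rewrite /bkernel /midkernel eta'E.
(* The loop: om up to n, eta' up to n, alpha o eta' up to n, om up to n + 1. *)
have Jom n : pos_upto n om.
  elim: n => [|n IH]; first exact: pos_upto0.
  apply: pos_upto_step => //; first by rewrite bom; apply: cp_sa.
  move=> l Hl; have := posker_comp_cp acp (keta' n IH) Hl; congr psd.
  by apply: eq_bigr => p _; apply: eq_bigr => q _;
    rewrite /bkernel /midkernel bom.
apply: upto_positive; elim=> [|n IH]; first exact: pos_upto0.
apply: pos_upto_step => //; first by rewrite bnu.
move=> l Hl; have := keta' n (Jom n) l Hl; congr psd.
by apply: eq_bigr => p _; apply: eq_bigr => q _;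
  rewrite /bkernel /midkernel bnu.
Qed.
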